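(* Let $n$ be a positive integer. Suppose that $\Omega$ is a simply connected (open) subset of the complex plane containing the points $\beta_1,\ldots,\beta_n$, and $\mathrm{C}$ is a simple closed contour in $\Omega$ that encloses the points $\beta_1,\ldots,\beta_n$. Let $\Gamma$ be an arbitrary simple contour in the complex plane. Assume that for each $1\le i\le n$, $p_i$ and $f_i$ are analytic functions in $\Omega$ satisfying $p_i(\beta_i)=f_i(\beta_i)=1$, and $p_i(v)\neq 0$ for all $v\in\Omega$. Let $q_i$ and $g_i$ ($1\le i\le n$) be continuous functions on $\Gamma$ that are square integrable, i.e. $\int_\Gamma |q_i(u)|^2|\mathrm{d}u|<\infty$ and $\int_\Gamma |g_i(u)|^2|\mathrm{d}u|<\infty$ for all $i$. Suppose there exists a function $H(v,u)$ on $\Omega\times\Gamma$ that is analytic in $v$ and satisfies $$\oint_{\mathrm{C}} \frac{f_i(v)}{\prod_{\ell=1}^{i}(v-\beta_\ell)}H(v,u)\frac{\mathrm{d}v}{2\pi\mathrm{i}}=g_i(u),\qquad u\in\Gamma,\quad\text{for all }1\le i\le n.$$ Then $$\det\left[\oint_{\mathrm{C}}\frac{\prod_{\ell=1}^{i-1}(v-\beta_\ell)}{\prod_{\ell=1}^{j}(v-\beta_\ell)}p_i(v)f_j(v)\frac{\mathrm{d}v}{2\pi\mathrm{i}}+\int_\Gamma q_i(u)g_j(u)\frac{\mathrm{d}u}{2\pi\mathrm{i}}\right]_{i,j=1}^n=\det(\mathrm{I}+K),$$ where $K$ is the integral kernel acting on $L^2(\Gamma,\mathrm{d}u/2\pi\mathrm{i})$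 given by $$K(u_1,u_2)=\sum_{\ell=1}^n q_\ell(u_2)\oint_{\mathrm{C}_1}\frac{\mathrm{d}v_1}{2\pi\mathrm{i}}\cdots\oint_{\mathrm{C}_\ell}\frac{\mathrm{d}v_\ell}{2\pi\mathrm{i}}\frac{H(v_1,u_1)}{\left[\prod_{i=1}^{\ell-1}(v_i-v_{i+1})\right]\cdot\left[\prod_{i=1}^{\ell}(v_i-\beta_i)P_i(v_i)\right]},$$ with $P_1(v):=p_1(v)$ and $P_i(v):=p_i(v)/p_{i-1}(v)$ for $2\le i\le n$, and where $\mathrm{C}_1,\ldots,\mathrm{C}_n$ are nested simple closed contours in $\Omega$ enclosing the points $\beta_1,\ldots,\beta_n$, ordered from outermost ($\mathrm{C}_1$) to innermost ($\mathrm{C}_n$).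
   Context: Closed contours are positively (counterclockwise) oriented and are disjoint from the points they enclose; nested contours are pairwise disjoint. Empty products equal $1$. The operator $K$ on $L^2(\Gamma,\mathrm{d}u/2\pi\mathrm{i})$ means the integral operator on $L^2(\Gamma,|\mathrm{d}u|)$ given by $(Kh)(u_1)=\int_\Gamma K(u_1,u_2)h(u_2)\frac{\mathrm{d}u_2}{2\pi\mathrm{i}}$, and $\det(\mathrm{I}+K)$ is its Fredholm determinant, $\det(\mathrm{I}+K)=\sum_{k\ge0}\frac{1}{k!}\int_{\Gamma^k}\det[K(u_a,u_b)]_{a,b=1}^k\prod_{a=1}^k\frac{\mathrm{d}u_a}{2\pi\mathrm{i}}$ ($K$ has finite rank). *)

(* Defs.v *)
From HB Require Import structures.
From mathcomp Require Import all_boot all_order all_algebra.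
From mathcomp Require Import complex.
From mathcomp Require Import all_classical all_reals all_analysis.
Set Implicit Arguments.
Unset Strict Implicit.
Unset Printing Implicit Defensive.
Import Order.TTheory GRing.Theory Num.Theory.
Import numFieldNormedType.Exports.
Local Open Scope classical_set_scope.
Local Open Scope complex_scope.
Local Open Scope ring_scope.

(* The library declares no topology on R[i]: give it the one of the normed
   space over itself, so that [derivable f z 1] is complex differentiability. *)
#[export, non_forgetful_inheritance]
HB.instance Definition _ (R : realType) := NormedModule.copy R[i] R[i]^o.

Definition C1 (R : realType) (x : R -> R) :=
  (forall t, derivable x t 1) /\ continuous (derive1 x).

(* [c] is piecewise C1 on the interval [I]: every compact [a, b] in [I] has a
   finite partition on whose closed pieces [c] coincides with a C1 map. *)
Definition piecewise_C1 (R : realType) (I : interval R) (c : R -> R[i]) :=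
  forall a b, a \in I -> b \in I -> a < b ->
  exists2 s : seq R, itv_partition a b s &
    forall k, (k < size s)%N ->
    exists x y : R -> R, [/\ C1 x, C1 y &
      forall t, nth b (a :: s) k <= t <= nth b s k -> c t = x t +i* y t].

(* The parameter interval is arbitrary, so a contour may be unbounded; closed
   contours are those satisfying [simple_closed] below. *)
Record contour (R : realType) := Contour {
  contour_dom : interval R;
  contour_path :> R -> R[i];
  contour_piecewise_C1 : piecewise_C1 contour_dom contour_path }.

Definition contour_image (R : realType) (c : contour R) : set R[i] :=
  c @` [set` contour_dom c].

Definition simple_closed (R : realType) (c : contour R) :=
  exists a b : R, [/\ a < b, contour_dom c = `[a, b], c a = c b &
    {in `[a, b[ &, injective c}].

Definition simple_contour (R : realType) (c : contour R) :=
  {in contour_dom c &, injective c} \/ simple_closed c.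

(* Meaningless at the break points, a countable and hence null set. *)
Definition velocity (R : realType) (c : contour R) (t : R) : R[i] :=
  derive1 (fun s => complex.Re (c s)) t +i* derive1 (fun s => complex.Im (c s)) t.

(* Integral of [f] over [c] with respect to dz / (2 pi i). *)
Definition cint (R : realType) (c : contour R) (f : R[i] -> R[i]) : R[i] :=
  let g t := f (c t) * velocity c t in
  (Rintegral lebesgue_measure [set` contour_dom c] (fun t => complex.Re (g t)) +i*
   Rintegral lebesgue_measure [set` contour_dom c] (fun t => complex.Im (g t)))
  / ((2 * pi)%:C * 'i).

(* cint over [c_1] of cint over [c_2] ... of [F [:: z_1; z_2; ...]] *)
Fixpoint iter_cint (R : realType) (cs : seq (contour R))
    (F : seq R[i] -> R[i]) : R[i] :=
  if cs is c :: cs' then cint c (fun z => iter_cint cs' (fun zs => F (z :: zs)))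
  else F [::].

Definition encloses (R : realType) (c : contour R) (z : R[i]) :=
  ~ contour_image c z /\ bounded_set (connected_component (~` contour_image c) z).

(* winding number 1 around every enclosed point *)
Definition positively_oriented (R : realType) (c : contour R) :=
  forall z, encloses c z -> cint c (fun v => (v - z)^-1) = 1.

Definition closed_contour_in (R : realType) (Omega : set R[i])
    (c : contour R) :=
  [/\ simple_closed c, positively_oriented c & contour_image c `<=` Omega].

(* Meant for open Omega, where connected and path-connected agree; homotopies
   fix the base point. *)
Definition simply_connected (R : realType) (Omega : set R[i]) :=
  connected Omega /\
  forall c : R -> R[i],
    {within `[0, 1], continuous c} -> c @` `[0, 1] `<=` Omega -> c 0 = c 1 ->
  exists h : R * R -> R[i],
    [/\ {within `[0, 1] `*` `[0, 1], continuous h},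
        h @` (`[0, 1] `*` `[0, 1]) `<=` Omega,
        (forall t : R, t \in `[0, 1] -> h (t, 0) = c t),
        (forall t : R, t \in `[0, 1] -> h (t, 1) = c 0) &
        (forall s : R, s \in `[0, 1] -> h (0, s) = c 0 /\ h (1, s) = c 0)].

Definition analytic_on (R : realType) (Omega : set R[i]) (f : R[i] -> R[i]) :=
  forall z, Omega z -> derivable f z 1.

Definition square_integrable (R : realType) (c : contour R)
    (q : R[i] -> R[i]) :=
  (\int[lebesgue_measure]_(t in [set` contour_dom c])
     (complex.Re (`|q (c t)| ^+ 2 * `|velocity c t|))%:E < +oo)%E.

Definition fredholm_series (R : realType) (c : contour R)
    (K : R[i] -> R[i] -> R[i]) : nat -> R[i] :=
  series (fun k => (k`!%:R)^-1 *
    iter_cint (nseq k c)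
      (fun us => \det (\matrix_(a < k, b < k) K us`_a us`_b))).

(* det (I + K) on L^2(c, du / (2 pi i)) *)
Definition fredholm_det (R : realType) (c : contour R)
    (K : R[i] -> R[i] -> R[i]) : R[i] :=
  limn (fredholm_series c K).

(* P_1 = p_1 and P_i = p_i / p_(i-1), with indices starting from 0. *)
Definition pratio (R : realType) (n : nat) (p : 'I_n -> R[i] -> R[i])
    (i : 'I_n) (v : R[i]) : R[i] :=
  if i == 0%N :> nat then p i v else p i v / p (ord_pred i) v.

(* Indices start from 0: the list [vs] is v_1, ..., v_(l+1). *)
Definition nested_kernel (R : realType) (n : nat) (beta : 'I_n -> R[i])
    (p : 'I_n -> R[i] -> R[i]) (q : 'I_n -> R[i] -> R[i])
    (H : R[i] -> R[i] -> R[i]) (Cs : 'I_n -> contour R) (u1 u2 : R[i]) : R[i] :=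
  \sum_(l < n) q l u2 *
    iter_cint [seq Cs i | i : 'I_n <- enum 'I_n & (i <= l)%N]
      (fun vs => H vs`_0 u1 /
         ((\prod_(i < n | (i < l)%N) (vs`_i - vs`_i.+1)) *
          (\prod_(i < n | (i <= l)%N)
             ((vs`_i - beta i) * pratio p i vs`_i)))).

(* Main.v *)
Require Import Defs.
From HB Require Import structures.
From mathcomp Require Import all_boot all_order all_algebra.
From mathcomp Require Import complex.
From mathcomp Require Import all_classical all_reals all_analysis.
From mathcomp Require Import measurable_realfun ring lra.
Set Implicit Arguments.
Unset Strict Implicit.
Unset Printing Implicit Defensive.
Import Order.TTheory GRing.Theory Num.Theory.
Import numFieldNormedType.Exports.
Local Open Scope classical_set_scope.
Local Open Scope complex_scope.
Local Open Scope ring_scope.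

(** The kernel has finite rank: [K u1 u2] is the sum over [l] of [q l u2 * G l u1],
where [G l u] is the nested contour integral of [H ^~ u]. Let [A] be the matrix
of the integrals over [C] alone and let [M l m] be the integral of [q l * G m]
along [Gamma]. The theorem is the combination of two facts.

- [g j] is the sum over [i] of [G i * A i j] ([kernel_factor_system]). So the
  matrix of the theorem is [A + M *m A], and as [A] is upper unitriangular
  ([det_residue_matrix]) its determinant is that of [1%:M + M].
- The determinant of [1%:M + M] is the Fredholm determinant of [K]
  ([fredholm_det_finite_rank]). By Andreief's identity the [k]-th term of the
  Fredholm series is the sum of the principal minors of size [k] of [M], and
  these add up to the determinant of [1%:M + M].

Why the triangular system holds: [g j u] is the integral over [C] of [h * f j]
divided by the node factors [v - b_0], ..., [v - b_j], with [h = H ^~ u]. Write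
[h = (a + (v - b_0) * h1) * P_0], where [a] is the value at [b_0] of [h / P_0]
and [h1] is its difference quotient. The constant [a] multiplies an integral
that contains [P_0 * f j] and all the nodes, while the factor [v - b_0] removes
the first node in front of [h1]. Repeating this for [h1] at [b_1], and so on
([residue_expansion]), gives a sum in which the [i]-th coefficient depends on
[h] only, and is multiplied by the integral of [p_i * f j] over the nodes from
[i] to [j], since [P_0 * ... * P_i = p_i]; this integral is [A i j].

It remains to see that the coefficients are the nested integrals
([iter_cint_outer]). Integrate from the innermost contour outwards. A point of
[C_i] has winding number [0] about [C_(i+1)] ([nested_winding]), and for such
points the Cauchy kernel keeps the rational part of the integrand only
([cint_cauchy_kernel]); so each inner integral is, on the next contour, a
polynomial over the product of the node factors ([chain_rational]), and this
polynomial is a Hermite interpolant of an analytic function.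

The complex analysis behind this is developed from the fundamental theorem of
calculus along piecewise C1 paths: Goursat's theorem on triangles, primitives on
discs, Cauchy's formula on a circle, removable singularities of difference
quotients ([divided_difference]) and Cauchy's theorem by subdivision of a
homotopy ([cauchy_simply_connected]). On [Gamma], which may be unbounded, the
products [q l * g j] are integrable because both factors are square integrable
([square_integrable_mul]); the products [q l * G m] follow because [A] is
invertible. *)

(** * Complex differentiability *)

Lemma within_comp (S T U : topologicalType) (A : set S) (B : set T)
    (phi : S -> T) (f : T -> U) :
  {within A, continuous phi} -> (forall s, A s -> B (phi s)) ->
  {within B, continuous f} -> {within A, continuous (fun s => f (phi s))}.
Proof.
move=> /subspace_continuousP cphi AB /subspace_continuousP cf.
apply/subspace_continuousP => s As N /(cf _ (AB _ As)) fN.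
have H : \forall y \near phi s, B y -> N (f y) := fN.
have H' : \forall s' \near s, A s' -> B (phi s') -> N (f (phi s')) := cphi _ As _ H.
by apply: filterS H' => s' H' As'; exact: H' As' (AB _ As').
Qed.

Section ComplexTopology.
Variable R : realType.
Implicit Types (T : topologicalType) (z w : R[i]) (r : R).

Lemma ReD (z w : R[i]) : complex.Re (z + w) = complex.Re z + complex.Re w.
Proof. by case: z w => [a b] [c d]. Qed.
Lemma ImD (z w : R[i]) : complex.Im (z + w) = complex.Im z + complex.Im w.
Proof. by case: z w => [a b] [c d]. Qed.
Lemma ReN (z : R[i]) : complex.Re (- z) = - complex.Re z.
Proof. by case: z => [a b]. Qed.
Lemma ImN (z : R[i]) : complex.Im (- z) = - complex.Im z.
Proof. by case: z => [a b]. Qed.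
Lemma ReM (z w : R[i]) :
  complex.Re (z * w) = complex.Re z * complex.Re w - complex.Im z * complex.Im w.
Proof. by case: z w => [a b] [c d]. Qed.
Lemma ImM (z w : R[i]) :
  complex.Im (z * w) = complex.Re z * complex.Im w + complex.Im z * complex.Re w.
Proof. by case: z w => [a b] [c d]. Qed.

Definition ReImE := (ReD, ImD, ReN, ImN, ReM, ImM).

Lemma complex_eqP (z w : R[i]) :
  complex.Re z = complex.Re w -> complex.Im z = complex.Im w -> z = w.
Proof. by case: z w => [a b] [c d] /= -> ->. Qed.

Lemma complex_norm_real z : (complex.Re `|z|)%:C = `|z|.
Proof. by rewrite normc_def. Qed.

Lemma norm_real (a : R) : `|a%:C| = `|a|%:C.
Proof. by rewrite normc_def /= expr0n addr0 sqrtr_sqr. Qed.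

Lemma norm_Re_le z : `|complex.Re z|%:C <= `|z|.
Proof. exact: normc_ge_Re. Qed.

Lemma norm_Im_le z : `|complex.Im z|%:C <= `|z|.
Proof.
by have := norm_Re_le (z * 'i%C); rewrite ReiNIm normrN normrM complexiE normCi mulr1.
Qed.

Lemma norm_le_ReIm z : `|z| <= (`|complex.Re z| + `|complex.Im z|)%:C.
Proof.
rewrite {1}[z]complexE (le_trans (ler_normD _ _))// normrM complexiE normCi mul1r.
by rewrite !norm_real -rmorphD.
Qed.

Lemma gt0_complex (e : R[i]) : 0 < e -> exists2 r : R, 0 < r & e = r%:C.
Proof.
case: e => a b; rewrite ltcE /= => /andP[/eqP -> a0].
by exists a.
Qed.

Lemma continuous_complexP T (f : T -> R[i]) x :
  {for x, continuous f} <->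
  forall r, 0 < r -> \forall y \near x, `|f x - f y| < r%:C.
Proof.
split=> [cf r r0|cf].
  by move/cvgrPdist_lt : cf; apply; rewrite ltcR.
apply/(@cvgrPdist_lt R[i] R[i] T (nbhs x)) => e /gt0_complex[r r0 ->].
exact: cf.
Qed.

Lemma Re_continuous : continuous (@complex.Re R).
Proof.
move=> z; apply/(@cvgrPdist_lt R R R[i] (nbhs z)) => e e0.
have /continuous_complexP/(_ _ e0) : {for z, continuous (@idfun R[i])} by move=> ?.
apply: filterS => w; rewrite -ltcR; apply: le_lt_trans.
by rewrite -ReN -ReD; exact: norm_Re_le.
Qed.

Lemma Im_continuous : continuous (@complex.Im R).
Proof.
move=> z; apply/(@cvgrPdist_lt R R R[i] (nbhs z)) => e e0.
have /continuous_complexP/(_ _ e0) : {for z, continuous (@idfun R[i])} by move=> ?.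
apply: filterS => w; rewrite -ltcR; apply: le_lt_trans.
by rewrite -ImN -ImD; exact: norm_Im_le.
Qed.

Lemma real_complex_continuous : continuous (fun r : R => r%:C).
Proof.
move=> r; apply/continuous_complexP => e e0.
have : {for r, continuous (@idfun R)} by move=> ?.
move=> /cvgrPdist_lt/(_ _ e0); apply: filterS => s /=.
by rewrite -rmorphB norm_real ltcR.
Qed.

Lemma continuous_ReIm T (f : T -> R[i]) x :
  {for x, continuous (fun y => complex.Re (f y))} ->
  {for x, continuous (fun y => complex.Im (f y))} ->
  {for x, continuous f}.
Proof.
move=> cr ci.
have -> : f = fun y => (complex.Re (f y))%:C + 'i%C * (complex.Im (f y))%:C.
  by apply/funext => y; rewrite -complexE.
apply: (@continuousD R[i] R[i]).
  apply: (@continuous_comp _ _ _ (fun y => complex.Re (f y))) => //.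
  exact: real_complex_continuous.
apply: (@continuousM R[i] T); first exact: cst_continuous.
apply: (@continuous_comp _ _ _ (fun y => complex.Im (f y))) => //.
exact: real_complex_continuous.
Qed.

Lemma continuous_Re T (f : T -> R[i]) x :
  {for x, continuous f} -> {for x, continuous (fun y => complex.Re (f y))}.
Proof. by move=> cf; apply: continuous_comp => //; exact: Re_continuous. Qed.

Lemma continuous_Im T (f : T -> R[i]) x :
  {for x, continuous f} -> {for x, continuous (fun y => complex.Im (f y))}.
Proof. by move=> cf; apply: continuous_comp => //; exact: Im_continuous. Qed.

(** Caratheodory's form of differentiability: the difference quotient extends
continuously to [z], with value [d]. *)
Definition has_cderiv (f : R[i] -> R[i]) z d :=
  exists psi : R[i] -> R[i], [/\ {for z, continuous psi}, psi z = d &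
    forall w, f w = f z + (w - z) * psi w].

Lemma derivable_has_cderiv f z : derivable f z 1 ->
  exists d, has_cderiv f z d.
Proof.
move=> df; pose D : R[i] := derive f z 1; exists D.
pose psi (w : R[i]) : R[i] := if w == z then D else (f w - f z) / (w - z).
have psiz : psi z = D by rewrite /psi eqxx.
exists psi; split; [|exact: psiz|]; last first.
  move=> w; rewrite /psi; case: eqP => [->|/eqP wz]; first by rewrite subrr mul0r addr0.
  by rewrite mulrCA divff ?subr_eq0// mulr1 addrC subrK.
apply/continuous_complexP => r r0; rewrite psiz.
have {}df : \forall t \near (0 : R[i]), t != 0 ->
    `|D - t^-1 * (f (t * 1 + z) - f z)| < r%:C.
  move: df => /(@cvgrPdist_lt R[i] R[i] R[i] _ _)/(_ r%:C); rewrite ltcR.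
  by move/(_ r0).
have zero : {for z, continuous (fun w : R[i] => - z + w)}.
  apply: (@continuousD R[i] R[i] R[i]); first exact: cst_continuous.
  by move=> ?.
rewrite /prop_for /continuous_at addNr in zero.
have {zero}df : \forall w \near z, - z + w != 0 ->
    `|D - (- z + w)^-1 * (f ((- z + w) * 1 + z) - f z)| < r%:C.
  exact: (zero _ df).
apply: filterS df => w; rewrite /psi.
have [->|wz] := eqVneq w z; first by move=> _; rewrite subrr normr0 ltcR.
by rewrite addrC subr_eq0 => /(_ wz); rewrite mulr1 subrK mulrC.
Qed.

Lemma has_cderiv_is_derive f z d : has_cderiv f z d -> is_derive z 1 f d.
Proof.
move=> [psi [cpsi psiz fE]].
have H : h^-1 *: ((f \o shift z) (h *: 1) - f z) @[h --> (0 : R[i])^'] --> d.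
  have : psi (h + z) @[h --> (0 : R[i])^'] --> d.
    have : {for 0, continuous (fun h : R[i] => psi (h + z))}.
      apply: (@continuous_comp _ _ _ (fun h : R[i] => h + z) psi).
        apply: (@continuousD R[i] R[i] R[i]); [by move=> ?|exact: cst_continuous].
      by rewrite add0r.
    by move=> /continuous_withinNx; rewrite add0r psiz.
  apply: cvg_trans; apply: near_eq_cvg; near=> h.
  rewrite /= fE /GRing.scale /= mulr1 addrK [f z + _]addrC addrK mulrA mulVf ?mul1r//.
  by near: h; exact: nbhs_dnbhs_neq.
split; first by apply/cvg_ex; exists d.
exact: (cvg_lim (@norm_hausdorff _ R[i]) H).
Unshelve. all: end_near. Qed.

Lemma has_cderiv_derivable f z d : has_cderiv f z d -> derivable f z 1.
Proof. by move=> /has_cderiv_is_derive[]. Qed.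

Lemma is_derive_has_cderiv f z d : is_derive z 1 f d -> has_cderiv f z d.
Proof.
move=> [/derivable_has_cderiv[e fe] fd].
by have [_ fe'] := has_cderiv_is_derive fe; rewrite -fd fe'.
Qed.

End ComplexTopology.

(** * Integrals of complex functions of a real variable *)

Section ComplexIntegral.
Variable R : realType.
Implicit Types (D : set (measurableTypeR R)) (g h : R -> R[i]) (a b c : R).
Notation mu := (@lebesgue_measure R).

Definition cintegrable D g :=
  mu.-integrable D (EFin \o (fun t => complex.Re (g t))) /\
  mu.-integrable D (EFin \o (fun t => complex.Im (g t))).

Definition cintegral D g : R[i] :=
  (Rintegral mu D (fun t => complex.Re (g t)) +i*
   Rintegral mu D (fun t => complex.Im (g t))).

Lemma eq_cintegrable D g h : measurable D -> (forall t, D t -> g t = h t) ->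
  cintegrable D g -> cintegrable D h.
Proof.
move=> mD gh [gr gi]; split; [move: gr|move: gi]; apply: eq_integrable => // t;
  by rewrite inE => Dt /=; rewrite gh.
Qed.

Lemma eq_cintegral D g h : (forall t, D t -> g t = h t) ->
  cintegral D g = cintegral D h.
Proof.
move=> gh; rewrite /cintegral; congr (_ +i* _); apply: eq_Rintegral => t;
  by rewrite inE => Dt /=; rewrite gh.
Qed.

Lemma cintegrableD D g h : measurable D -> cintegrable D g -> cintegrable D h ->
  cintegrable D (fun t => g t + h t).
Proof.
move=> mD [gr gi] [hr hi]; split.
- move: (integrableD mD gr hr); apply: eq_integrable => // t _ /=.
  by rewrite ReD.
- move: (integrableD mD gi hi); apply: eq_integrable => // t _ /=.
  by rewrite ImD.
Qed.

Lemma cintegralD D g h : measurable D -> cintegrable D g -> cintegrable D h ->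
  cintegral D (fun t => g t + h t) = cintegral D g + cintegral D h.
Proof.
move=> mD [gr gi] [hr hi]; rewrite /cintegral /GRing.add /= /cintegral.
congr (_ +i* _).
- rewrite -(RintegralD mD gr hr); apply: eq_Rintegral => t _; exact: ReD.
- rewrite -(RintegralD mD gi hi); apply: eq_Rintegral => t _; exact: ImD.
Qed.

Lemma integrable_lin D (u v : R -> R) (k l : R) : measurable D ->
  mu.-integrable D (EFin \o u) -> mu.-integrable D (EFin \o v) ->
  mu.-integrable D (EFin \o (fun t => k * u t + l * v t)) /\
  Rintegral mu D (fun t => k * u t + l * v t) =
    k * Rintegral mu D u + l * Rintegral mu D v.
Proof.
move=> mD iu iv.
have iku : mu.-integrable D (EFin \o (fun t => k * u t)) by exact: (integrableZl mD k iu).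
have ilv : mu.-integrable D (EFin \o (fun t => l * v t)) by exact: (integrableZl mD l iv).
split; first exact: (integrableD mD iku ilv).
by rewrite RintegralD// RintegralZl// RintegralZl.
Qed.

Lemma cintegrableZ D g (z : R[i]) : measurable D -> cintegrable D g ->
  cintegrable D (fun t => z * g t).
Proof.
move=> mD [gr gi]; split.
- apply: (eq_integrable mD _ _ _ (integrable_lin (complex.Re z) (- complex.Im z) mD gr gi).1) => t _ /=; by rewrite ReM mulNr.
- apply: (eq_integrable mD _ _ _ (integrable_lin (complex.Re z) (complex.Im z) mD gi gr).1) => t _ /=; by rewrite ImM.
Qed.

Lemma cintegralZ D g (z : R[i]) : measurable D -> cintegrable D g ->
  cintegral D (fun t => z * g t) = z * cintegral D g.
Proof.
move=> mD [gr gi]; apply: complex_eqP; rewrite /cintegral /=.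
- rewrite ReM /= -mulNr -(integrable_lin _ _ mD gr gi).2.
  by apply: eq_Rintegral => t _; rewrite ReM mulNr.
- rewrite ImM /= -(integrable_lin _ _ mD gi gr).2.
  by apply: eq_Rintegral => t _; rewrite ImM.
Qed.

(** Bounding the real and the imaginary parts separately costs the factor 2. *)
Lemma norm_cintegral_le D g (h : R -> R) : measurable D -> cintegrable D g ->
  mu.-integrable D (EFin \o h) -> (forall t, D t -> `|g t| <= (h t)%:C) ->
  `|cintegral D g| <= (2 * Rintegral mu D h)%:C.
Proof.
move=> mD [gr gi] ih gh.
apply: (le_trans (norm_le_ReIm _)); rewrite lecR mulr_natl mulr2n /=.
have aux (u : R -> R) : mu.-integrable D (EFin \o u) ->
    (forall t, D t -> `|u t| <= h t) ->
    `|Rintegral mu D u| <= Rintegral mu D h.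
  move=> iu uh; apply: (le_trans (le_normr_Rintegral mD iu)).
  apply: le_Rintegral => //.
  exact: (integrable_norm iu).
by apply: lerD; apply: aux => // t Dt; rewrite -lecR; apply: le_trans (gh _ Dt);
  [exact: norm_Re_le|exact: norm_Im_le].
Qed.

(** End points are negligible. The velocity of a contour is meaningless at the
break points, so integrands are compared on open pieces. *)
Lemma integrable_itvoo a b (u v : R -> R) :
  (forall t, a < t < b -> u t = v t) ->
  mu.-integrable `[a, b] (EFin \o u) -> mu.-integrable `[a, b] (EFin \o v) /\
  Rintegral mu `[a, b] u = Rintegral mu `[a, b] v.
Proof.
move=> uv iu.
have [/measurable_EFinP mu1 fu] := elimT (integrableP _ _ _) iu.
have muo : measurable_fun `]a, b[ u.
  apply: measurable_funS mu1 => //; exact: subset_itv_oo_cc.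
have mvo : measurable_fun `]a, b[ v.
  apply: eq_measurable_fun muo => t; rewrite inE /= in_itv /= => ab; exact: uv.
have mv : measurable_fun `[a, b] v by exact: measurable_fun_itv_cc mvo.
have E : (\int[mu]_(t in `[a, b]) `|(v t)%:E| = \int[mu]_(t in `[a, b]) `|(u t)%:E|)%E.
  rewrite integral_itv_bndoo; last first.
    by apply: measurableT_comp => //; apply/measurable_EFinP.
  rewrite [RHS]integral_itv_bndoo; last first.
    by apply: measurableT_comp => //; apply/measurable_EFinP.
  by apply: eq_integral => t; rewrite inE /= in_itv /= => ab; rewrite uv.
split.
  apply/integrableP; split; first exact/measurable_EFinP.
  by rewrite E.
by rewrite /Rintegral (@eq_integral_itv_bounded _ _ _ v u).
Qed.

Lemma cintegrable_itvoo a b g h : (forall t, a < t < b -> g t = h t) ->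
  cintegrable `[a, b] g -> cintegrable `[a, b] h /\
  cintegral `[a, b] g = cintegral `[a, b] h.
Proof.
move=> gh [gr gi].
have [t tab|hr er] := integrable_itvoo (v := fun t => complex.Re (h t)) _ gr.
  by rewrite gh.
have [t tab|hi ei] := integrable_itvoo (v := fun t => complex.Im (h t)) _ gi.
  by rewrite gh.
by split; [split|rewrite /cintegral er ei].
Qed.

Lemma integrable_cat a b c (u : R -> R) : a <= b -> b <= c ->
  mu.-integrable `[a, b] (EFin \o u) -> mu.-integrable `[b, c] (EFin \o u) ->
  mu.-integrable `[a, c] (EFin \o u) /\
  Rintegral mu `[a, c] u = Rintegral mu `[a, b] u + Rintegral mu `[b, c] u.
Proof.
move=> ab bc iab ibc.
have sub : `]b, c]%classic `<=` `[b, c].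
  by apply: subset_itvr; rewrite bnd_simp.
have ibc' : mu.-integrable `]b, c] (EFin \o u).
  by apply: integrableS ibc.
have U : `[a, c]%classic = `[a, b] `|` `]b, c].
  by rewrite -itv_bndbnd_setU// ?bnd_simp.
have iac : mu.-integrable `[a, c] (EFin \o u).
  have [m1 f1] := elimT (integrableP _ _ _) iab.
  have [m2 f2] := elimT (integrableP _ _ _) ibc'.
  have m12 : measurable_fun (`[a, b] `|` `]b, c]) (EFin \o u).
    by apply/measurable_funU.
  apply/integrableP; rewrite U; split => //.
  rewrite ge0_integral_setU//; first exact: lte_add_pinfty.
    by apply: measurableT_comp m12.
  by apply/disj_setPS => t [] /=; rewrite !in_itv/= => /andP[_ tb] /andP[/lt_le_trans/(_ tb)]; rewrite ltxx.
split => //.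
rewrite -(Rintegral_itv_obnd_cbnd ibc') -(@Rintegral_itvB _ u (BLeft a) (BRight c) b)//.
by rewrite addrC subrK.
Qed.

Lemma cintegrable_cat a b c g : a <= b -> b <= c ->
  cintegrable `[a, b] g -> cintegrable `[b, c] g ->
  cintegrable `[a, c] g /\
  cintegral `[a, c] g = cintegral `[a, b] g + cintegral `[b, c] g.
Proof.
move=> ab bc [r1 i1] [r2 i2].
have [ri re] := integrable_cat ab bc r1 r2.
have [ii ie] := integrable_cat ab bc i1 i2.
by split=> //; rewrite /cintegral re ie.
Qed.

Lemma within_cintegrable a b g : {within `[a, b], continuous g} ->
  cintegrable `[a, b] g.
Proof.
move=> cg; split; apply: continuous_compact_integrable => //.
- exact: segment_compact.
- by move=> t; apply: continuous_Re; exact: cg.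
- exact: segment_compact.
- by move=> t; apply: continuous_Im; exact: cg.
Qed.

(** The chain rule along a path, obtained by composing Caratheodory factors. *)
Lemma is_derive_comp (x y : R -> R) (F : R[i] -> R[i]) t (x' y' : R) d :
  is_derive t (1 : R) x x' -> is_derive t (1 : R) y y' ->
  has_cderiv F (x t +i* y t) d ->
  is_derive t (1 : R) (fun s => complex.Re (F (x s +i* y s)))
    (complex.Re (d * (x' +i* y'))) /\
  is_derive t (1 : R) (fun s => complex.Im (F (x s +i* y s)))
    (complex.Im (d * (x' +i* y'))).
Proof.
move=> /is_derive1_caratheodory[gx [gxE cgx gxt]].
move=> /is_derive1_caratheodory[gy [gyE cgy gyt]] [psi [cpsi psit FE]].
pose c s := x s +i* y s; pose q s := psi (c s) * (gx s +i* gy s).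
have cc : {for t, continuous c}.
  have ct (u gu : R -> R) : (forall z, u z - u t = gu z * (z - t)) ->
      {for t, continuous gu} -> {for t, continuous u}.
    move=> uE cgu; have -> : u = fun z => u t + gu z * (z - t).
      by apply/funext => z; rewrite -uE addrC subrK.
    apply: continuousD; first exact: cst_continuous.
    apply: continuousM; first exact: cgu.
    by apply: continuousB; [by move=> ?|exact: cst_continuous].
  by apply: continuous_ReIm; [exact: ct gxE cgx|exact: ct gyE cgy].
have cq : {for t, continuous q}.
  apply: continuousM.
    by apply: continuous_comp; [exact: cc|exact: cpsi].
  by apply: continuous_ReIm.
have qt : q t = d * (x' +i* y') by rewrite /q psit gxt gyt.
have E s : F (c s) - F (c t) = q s * (s - t)%:C.
  rewrite FE addrC addKr; have -> : c s - c t = (gx s +i* gy s) * (s - t)%:C.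
    apply: complex_eqP; rewrite !ReImE /= mulr0 ?subr0 ?addr0 -?gxE -?gyE//.
    by rewrite add0r.
  by rewrite /q mulrC mulrA.
split; apply/is_derive1_caratheodory.
- exists (fun s => complex.Re (q s)); split; [|exact: continuous_Re|by rewrite qt].
  move=> s; have := congr1 (@complex.Re R) (E s).
  by rewrite !ReImE /= mulr0 subr0.
- exists (fun s => complex.Im (q s)); split; [|exact: continuous_Im|by rewrite qt].
  move=> s; have := congr1 (@complex.Im R) (E s).
  by rewrite !ReImE /= mulr0 add0r.
Qed.

Lemma Rintegral_FTC a b (u G : R -> R) : a < b ->
  {within `[a, b], continuous u} ->
  (forall t, a <= t <= b -> is_derive t (1 : R) G (u t)) ->
  Rintegral mu `[a, b] u = G b - G a.
Proof.
move=> ab cu dG.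
have cG t : a <= t <= b -> {for t, continuous G}.
  by move=> tab; have [dG1 _] := dG _ tab; apply/differentiable_continuous/derivable1_diffP.
rewrite /Rintegral (@continuous_FTC2 _ u G)//.
- split.
  + move=> t; rewrite in_itv /= => /andP[at1 tb].
    by have [] := dG t; rewrite ?(ltW at1) ?(ltW tb).
  + by apply: cvg_at_right_filter; apply: cG; rewrite lexx ltW.
  + by apply: cvg_at_left_filter; apply: cG; rewrite lexx ltW.
- move=> t; rewrite in_itv /= => /andP[at1 tb]; rewrite derive1E.
  have tab : a <= t <= b by rewrite (ltW at1) (ltW tb).
  by have [_ ->] := dG _ tab.
Qed.

Lemma cintegral_FTC a b g G : a < b ->
  {within `[a, b], continuous g} ->
  (forall t, a <= t <= b ->
     is_derive t (1 : R) (fun s => complex.Re (G s)) (complex.Re (g t)) /\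
     is_derive t (1 : R) (fun s => complex.Im (G s)) (complex.Im (g t))) ->
  cintegral `[a, b] g = G b - G a.
Proof.
move=> ab cg dG; apply: complex_eqP; rewrite /cintegral ?ReD ?ReN ?ImD ?ImN /=.
- apply: (Rintegral_FTC (G := fun s => complex.Re (G s))) => //.
    by move=> t; apply: continuous_Re; exact: cg.
  by move=> t /dG[].
- apply: (Rintegral_FTC (G := fun s => complex.Im (G s))) => //.
    by move=> t; apply: continuous_Im; exact: cg.
  by move=> t /dG[].
Qed.

End ComplexIntegral.

(** * Contour integrals *)

Section Contours.
Variable R : realType.
Implicit Types (c : contour R) (f g : R[i] -> R[i]) (a b : R).
Notation mu := (@lebesgue_measure R).

Definition two_pi_i : R[i] := (2 * pi)%:C * 'i.

Lemma two_pi_i_neq0 : two_pi_i != 0.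
Proof.
rewrite mulf_neq0 ?neq0Ci// -[0]/(0%:C).
by rewrite (inj_eq (@complexI R)) gt_eqF// mulr_gt0// pi_gt0.
Qed.

Definition cintegrand c f (t : R) : R[i] := f (c t) * velocity c t.

Lemma contour_dom_measurable c :
  measurable ([set` contour_dom c] : set (measurableTypeR R)).
Proof. exact: measurable_itv. Qed.

Lemma cintE c f :
  cint c f = cintegral [set` contour_dom c] (cintegrand c f) / two_pi_i.
Proof. by []. Qed.

Definition contour_integrable c f :=
  cintegrable [set` contour_dom c] (cintegrand c f).

Lemma eq_cint c f g : (forall z, contour_image c z -> f z = g z) ->
  cint c f = cint c g.
Proof.
move=> fg; rewrite !cintE; congr (_ / _); apply: eq_cintegral => t ct.
by rewrite /cintegrand fg//; exists t.
Qed.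

Lemma eq_contour_integrable c f g :
  (forall z, contour_image c z -> f z = g z) ->
  contour_integrable c f -> contour_integrable c g.
Proof.
move=> fg; apply: eq_cintegrable => [|t ct]; first exact: measurable_itv.
by rewrite /cintegrand fg//; exists t.
Qed.

Lemma contour_integrableD c f g : contour_integrable c f ->
  contour_integrable c g -> contour_integrable c (fun z => f z + g z).
Proof.
move=> cf cg; apply: (eq_cintegrable (contour_dom_measurable c)) (cintegrableD (contour_dom_measurable c) cf cg).
by move=> t _; rewrite /cintegrand mulrDl.
Qed.

Lemma contour_integrableZ c (k : R[i]) f : contour_integrable c f ->
  contour_integrable c (fun z => k * f z).
Proof.
move=> cf; apply: (eq_cintegrable (contour_dom_measurable c)) (cintegrableZ k (contour_dom_measurable c) cf).
by move=> t _; rewrite /cintegrand mulrA.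
Qed.

Lemma cintD c f g : contour_integrable c f -> contour_integrable c g ->
  cint c (fun z => f z + g z) = cint c f + cint c g.
Proof.
move=> cf cg; rewrite !cintE -mulrDl; congr (_ / _).
rewrite -(cintegralD (contour_dom_measurable c))//.
by apply: eq_cintegral => t _; rewrite /cintegrand mulrDl.
Qed.

Lemma cintZ c (k : R[i]) f : contour_integrable c f ->
  cint c (fun z => k * f z) = k * cint c f.
Proof.
move=> cf; rewrite !cintE mulrA; congr (_ / _).
rewrite -(cintegralZ _ (contour_dom_measurable c))//.
by apply: eq_cintegral => t _; rewrite /cintegrand mulrA.
Qed.

Lemma contour_integrable0 c : contour_integrable c (fun=> 0).
Proof.
have mD := contour_dom_measurable c.
have E t : cintegrand c (fun=> 0) t = 0 by rewrite /cintegrand mul0r.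
split; move: (integrable0 mu [set` contour_dom c]);
  by apply: eq_integrable => // t _; rewrite [RHS]/comp E.
Qed.

Lemma cint0 c : cint c (fun=> 0) = 0.
Proof.
rewrite -[RHS](mul0r (cint c (fun=> 0))) -(cintZ _ (contour_integrable0 c)).
by apply: eq_cint => z _; rewrite mul0r.
Qed.

Lemma contour_integrable_sum (I : Type) (r : seq I) (P : pred I) c
    (F : I -> R[i] -> R[i]) :
  (forall i, contour_integrable c (F i)) ->
  contour_integrable c (fun z => \sum_(i <- r | P i) F i z).
Proof.
move=> cF; elim: r => [|i r IH].
  by apply: eq_contour_integrable (contour_integrable0 c) => z _; rewrite big_nil.
have [Pi|Pi] := boolP (P i).
  apply: eq_contour_integrable (contour_integrableD (cF i) IH) => z _.
  by rewrite big_cons Pi.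
apply: eq_contour_integrable IH => z _.
by rewrite big_cons (negbTE Pi).
Qed.

Lemma cint_sum (I : Type) (r : seq I) (P : pred I) c
    (F : I -> R[i] -> R[i]) :
  (forall i, contour_integrable c (F i)) ->
  cint c (fun z => \sum_(i <- r | P i) F i z) = \sum_(i <- r | P i) cint c (F i).
Proof.
move=> cF; elim: r => [|i r IH].
  rewrite big_nil -[RHS](cint0 c); apply: eq_cint => z _; by rewrite big_nil.
rewrite big_cons; case: ifPn => Pi.
  rewrite -IH -cintD//; last exact: contour_integrable_sum.
  by apply: eq_cint => z _; rewrite big_cons Pi.
by rewrite -IH; apply: eq_cint => z _; rewrite big_cons (negbTE Pi).
Qed.

Definition C1_on c a b := exists x y : R -> R, [/\ C1 x, C1 y &
  forall t, a <= t <= b -> c t = x t +i* y t].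

(** Induction along the partition of a compact parameter interval into C1 pieces.
Every statement below on the integrand of a contour is reduced to C1 paths by it. *)
Lemma contour_piece_ind c (P : R -> R -> Prop) a b :
  a \in contour_dom c -> b \in contour_dom c -> a < b ->
  (forall a' b', a <= a' -> a' < b' -> b' <= b -> C1_on c a' b' -> P a' b') ->
  (forall a' m b', a <= a' -> a' < m -> m < b' -> b' <= b ->
     P a' m -> P m b' -> P a' b') ->
  P a b.
Proof.
move=> adom bdom ab pc pcat.
suff gen s : forall a', a <= a' -> a' < b -> itv_partition a' b s ->
    (forall k, (k < size s)%N -> exists x y : R -> R, [/\ C1 x, C1 y &
      forall t, nth b (a' :: s) k <= t <= nth b s k -> c t = x t +i* y t]) ->
    P a' b.
  have [s ps H] := contour_piecewise_C1 adom bdom ab.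
  exact: gen (lexx a) ab ps H.
elim: s => [|x s IH] a' aa' a'b [/= + /eqP lb].
  by move=> _; move: a'b; rewrite lb ltxx.
move=> /andP[a'x xs] H.
have C1x : C1_on c a' x.
  by have [//|x0 [y0 [? ? E]]] := H 0%N; exists x0, y0.
have [s0|s0] := eqVneq s [::].
  move: lb; rewrite s0 /= => xb; rewrite -xb; apply: pc => //.
  by rewrite xb.
have xb : x < b.
  have : itv_partition x b s by split=> //; rewrite lb.
  by apply: itv_partition_size_neq0; case: s s0 {IH xs lb H}.
apply: (pcat _ x) => //; first by apply: pc => //; exact: ltW.
apply: IH => //; first by rewrite (le_trans aa')// ltW.
  by split=> //; rewrite lb.
by move=> k ks; have [//|x0 [y0 [? ? E]]] := H k.+1; exists x0, y0.
Qed.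

(** Inside a piece the coordinates of [c] agree with [x] and [y] near [t]. *)
Lemma velocityE c a b x y t :
  (forall t, a <= t <= b -> c t = x t +i* y t) -> a < t < b ->
  velocity c t = derive1 x t +i* derive1 y t.
Proof.
move=> cE /andP[at1 tb].
have N : \forall s \near t, a <= s <= b.
  near=> s; apply/andP; split.
    by apply: ltW; near: s; exact: lt_nbhsr.
  by apply: ltW; near: s; exact: lt_nbhsl.
rewrite /velocity !derive1E; congr (_ +i* _).
  by apply: near_eq_derive; apply: filterS N => s /cE ->.
by apply: near_eq_derive; apply: filterS N => s /cE ->.
Unshelve. all: end_near. Qed.

Lemma C1_continuous (x : R -> R) : C1 x -> continuous x.
Proof.
by move=> [dx _] t; apply/differentiable_continuous/derivable1_diffP.
Qed.

Lemma C1_on_continuous c a b : C1_on c a b -> {within `[a, b], continuous c}.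
Proof.
move=> [x [y [C1x C1y cE]]].
have xyc : {within `[a, b], continuous (fun t => x t +i* y t)}.
  apply: continuous_subspaceT => t.
  by apply: continuous_ReIm; exact: C1_continuous.
apply: subspace_eq_continuous xyc => t.
by rewrite inE /= in_itv /= => /cE/esym.
Qed.

Lemma contour_continuous c a b : a \in contour_dom c -> b \in contour_dom c ->
  a < b -> {within `[a, b], continuous c}.
Proof.
move=> ad bd ab; apply: (contour_piece_ind (P := fun a b => {within `[a, b], continuous c}) ad bd ab).
  by move=> a' b' _ _ _; exact: C1_on_continuous.
move=> a' m b' _ am mb _ c1 c2.
have -> : `[a', b']%classic = `[a', m] `|` `[m, b'].
  apply/seteqP; split=> t /=; rewrite !in_itv /=.
    by move=> /andP[-> ->]; rewrite andbT; apply/orP; exact: le_total.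
  move=> [] /andP[h1 h2]; first by rewrite h1 (le_trans h2 (ltW mb)).
  by rewrite h2 (le_trans (ltW am) h1).
by apply: withinU_continuous => //; exact: itv_closed.
Qed.

Lemma within_subset_itv (T : topologicalType) (f : R -> T) a b a' b' :
  a <= a' -> b' <= b ->
  {within `[a, b], continuous f} -> {within `[a', b'], continuous f}.
Proof.
move=> aa bb; apply: continuous_subspaceW => t /=; rewrite !in_itv /=.
by move=> /andP[h1 h2]; rewrite (le_trans aa h1) (le_trans h2 bb).
Qed.

Lemma C1_on_integrand c f a b : C1_on c a b ->
  {within `[a, b], continuous (fun t => f (c t))} ->
  exists x y, [/\ C1 x, C1 y,
    (forall t, a <= t <= b -> c t = x t +i* y t),
    {within `[a, b], continuous (fun t => f (c t) * (derive1 x t +i* derive1 y t))} &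
    forall t, a < t < b -> f (c t) * (derive1 x t +i* derive1 y t) = cintegrand c f t].
Proof.
move=> [x [y [C1x C1y cE]]] cf; exists x, y.
split; [exact: C1x|exact: C1y|exact: cE| |].
  have cd : {within `[a, b], continuous (fun t => derive1 x t +i* derive1 y t)}.
    apply: continuous_subspaceT => t.
    by apply: continuous_ReIm; [exact: (proj2 C1x)|exact: (proj2 C1y)].
  move=> t; apply: (@continuousM R[i] (subspace `[a, b])); [exact: cf|exact: cd].
by move=> t tab; rewrite /cintegrand (velocityE cE tab).
Qed.

(** On each piece the integrand agrees, off the end points, with a continuous
function. *)
Lemma within_contour_integrable c f a b : a \in contour_dom c ->
  b \in contour_dom c -> a < b ->
  {within `[a, b], continuous (fun t => f (c t))} ->
  cintegrable `[a, b] (cintegrand c f).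
Proof.
move=> ad bd ab cf.
apply: (contour_piece_ind (P := fun a b => cintegrable `[a, b] (cintegrand c f)) ad bd ab).
  move=> a' b' aa' a'b' b'b c1.
  have [x [y [_ _ _ cg gE]]] := C1_on_integrand c1 (within_subset_itv aa' b'b cf).
  by have [] := cintegrable_itvoo gE (within_cintegrable cg).
move=> a' m b' _ am mb _ i1 i2.
by have [] := cintegrable_cat (ltW am) (ltW mb) i1 i2.
Qed.

(** The fundamental theorem of calculus on each piece, and a telescoping sum. *)
Lemma contour_FTC c f (F : R[i] -> R[i]) a b : a \in contour_dom c ->
  b \in contour_dom c -> a < b ->
  {within `[a, b], continuous (fun t => f (c t))} ->
  (forall t, a <= t <= b -> has_cderiv F (c t) (f (c t))) ->
  cintegral `[a, b] (cintegrand c f) = F (c b) - F (c a).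
Proof.
move=> ad bd ab cf dF.
suff [] : cintegrable `[a, b] (cintegrand c f) /\
  cintegral `[a, b] (cintegrand c f) = F (c b) - F (c a) by [].
apply: (contour_piece_ind (P := fun a b => cintegrable `[a, b] (cintegrand c f) /\
  cintegral `[a, b] (cintegrand c f) = F (c b) - F (c a)) ad bd ab).
  move=> a' b' aa' a'b' b'b c1.
  have [x [y [C1x C1y cE cg gE]]] := C1_on_integrand c1 (within_subset_itv aa' b'b cf).
  have [gi <-] := cintegrable_itvoo gE (within_cintegrable cg).
  split=> //; rewrite !cE ?lexx ?(ltW a'b')//.
  rewrite (cintegral_FTC (G := fun s => F (x s +i* y s)) a'b' cg)// => t tab.
  apply: is_derive_comp.
  - by rewrite derive1E; apply/derivableP; case: C1x.
  - by rewrite derive1E; apply/derivableP; case: C1y.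
  - rewrite -cE//; apply: dF; case/andP: tab => h1 h2.
    by rewrite (le_trans aa')// (le_trans h2).
move=> a' m b' _ am mb _ [i1 e1] [i2 e2].
have [i12 ->] := cintegrable_cat (ltW am) (ltW mb) i1 i2.
by split=> //; rewrite e1 e2 addrC addrA subrK.
Qed.

End Contours.

(** * Moduli and length bounds *)

Section Segments.
Variable R : realType.
Implicit Types (c : contour R) (f g : R[i] -> R[i]) (a b r s t : R) (z w : R[i]).
Notation mu := (@lebesgue_measure R).

(** The modulus as an element of [R]: the norm of [R[i]] takes its values in [R[i]]. *)
Definition cabs z : R := complex.Re `|z|.

Lemma cabsE z : `|z| = (cabs z)%:C.
Proof. by rewrite /cabs complex_norm_real. Qed.

Lemma cabs_le z r : (`|z| <= r%:C) = (cabs z <= r).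
Proof. by rewrite cabsE lecR. Qed.

Lemma cabs_ge0 z : 0 <= cabs z.
Proof. by rewrite -lecR -cabsE; exact: normr_ge0. Qed.

Lemma cabsD z w : cabs (z + w) <= cabs z + cabs w.
Proof. by rewrite -lecR -cabsE (le_trans (ler_normD _ _))// !cabsE -rmorphD. Qed.

Lemma cabsM z w : cabs (z * w) = cabs z * cabs w.
Proof. by apply: (@complexI R); rewrite -cabsE normrM !cabsE -rmorphM. Qed.

Lemma cabsV z : cabs z^-1 = (cabs z)^-1.
Proof. by apply: (@complexI R); rewrite -cabsE normfV !cabsE fmorphV. Qed.

Lemma cabsN z : cabs (- z) = cabs z.
Proof. by rewrite /cabs normrN. Qed.

Lemma cabs_distC z w : cabs (z - w) = cabs (w - z).
Proof. by rewrite /cabs distrC. Qed.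

Lemma cabs0 : cabs 0 = 0.
Proof. by rewrite /cabs normr0. Qed.

Lemma cabs_eq0 z : (cabs z == 0) = (z == 0).
Proof. by rewrite -(inj_eq (@complexI R)) -cabsE; exact: normr_eq0. Qed.

Lemma cabs_gt0 z : (0 < cabs z) = (z != 0).
Proof. by rewrite lt_neqAle cabs_ge0 eq_sym cabs_eq0 andbT. Qed.

Lemma cabs_real r : cabs r%:C = `|r|.
Proof. by rewrite /cabs norm_real. Qed.

Lemma continuous_cabsP (T : topologicalType) (f : T -> R[i]) x :
  {for x, continuous f} <->
  forall r, 0 < r -> \forall y \near x, cabs (f x - f y) < r.
Proof.
by split => [/continuous_complexP cf r r0|cf]; [|apply/continuous_complexP => r r0];
  have := cf _ r0; apply: filterS => y; rewrite cabsE ltcR.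
Qed.

(** Continuity in the plane, not only along the image: the integrands on closed
contours are of this kind, and algebraic operations preserve it. *)
Definition contour_cont c f :=
  forall z, contour_image c z -> {for z, continuous f}.

Definition compact_contour c :=
  exists a b, a < b /\ contour_dom c = `[a, b].

Lemma contour_cont_within c f a b : a \in contour_dom c -> b \in contour_dom c ->
  a < b -> contour_cont c f -> {within `[a, b], continuous (fun t => f (c t))}.
Proof.
move=> ad bd ab cf.
apply: (@within_continuous_comp _ _ _ `[a, b]%classic c f).
  move=> z; rewrite inE => -[t tab <-]; apply: cf; exists t => //.
  have := interval_is_interval (i := contour_dom c) ad bd.
  by apply; move: tab; rewrite /= in_itv.
exact: contour_continuous.
Qed.

Lemma contour_cont_integrable c f : compact_contour c -> contour_cont c f ->
  contour_integrable c f.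
Proof.
move=> [a [b [ab cE]]] cf; rewrite /contour_integrable cE.
have ad : a \in contour_dom c by rewrite cE in_itv /= lexx ltW.
have bd : b \in contour_dom c by rewrite cE in_itv /= lexx ltW.
exact: within_contour_integrable ad bd ab (contour_cont_within ad bd ab cf).
Qed.

Lemma contour_contD c f g : contour_cont c f -> contour_cont c g ->
  contour_cont c (fun z => f z + g z).
Proof.
move=> cf cg z cz; apply: (@continuousD R[i] R[i] R[i]); [exact: cf|exact: cg].
Qed.

Lemma contour_contM c f g : contour_cont c f -> contour_cont c g ->
  contour_cont c (fun z => f z * g z).
Proof.
move=> cf cg z cz; apply: (@continuousM R[i] R[i]); [exact: cf|exact: cg].
Qed.

Lemma contour_contV c f : (forall z, contour_image c z -> f z != 0) ->
  contour_cont c f -> contour_cont c (fun z => (f z)^-1).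
Proof.
move=> f0 cf z cz; apply: (@continuousV R[i] R[i] f); [exact: f0|exact: cf].
Qed.

Lemma contour_cont_cst c (k : R[i]) : contour_cont c (fun=> k).
Proof. by move=> z _; exact: cst_continuous. Qed.

Lemma contour_cont_id c : contour_cont c id.
Proof. by move=> z _ ?. Qed.

Lemma contour_contB c f g : contour_cont c f -> contour_cont c g ->
  contour_cont c (fun z => f z - g z).
Proof.
move=> cf cg z cz; apply: (@continuousB R[i] R[i] R[i]); [exact: cf|exact: cg].
Qed.

Lemma eq_contour_cont c f g : f =1 g -> contour_cont c f -> contour_cont c g.
Proof. by move=> /funext ->. Qed.

Lemma cint_primitive c f (F : R[i] -> R[i]) a b : a < b ->
  contour_dom c = `[a, b] -> contour_cont c f ->
  (forall z, contour_image c z -> has_cderiv F z (f z)) ->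
  cint c f = (F (c b) - F (c a)) / two_pi_i R.
Proof.
move=> ab cE cf dF; rewrite cintE cE; congr (_ / _).
have ad : a \in contour_dom c by rewrite cE in_itv /= lexx ltW.
have bd : b \in contour_dom c by rewrite cE in_itv /= lexx ltW.
apply: contour_FTC => //; first exact: contour_cont_within.
by move=> t tab; apply: dF; exists t => //; rewrite /= cE in_itv.
Qed.

(** The length for the norm [`|x| + `|y|], which bounds the Euclidean length. *)
Definition contour_length c : R :=
  Rintegral mu [set` contour_dom c]
    (fun t => `|complex.Re (velocity c t)| + `|complex.Im (velocity c t)|).

Lemma cabs_two_pi_i : cabs (two_pi_i R) = 2 * pi.
Proof.
rewrite /two_pi_i cabsM cabs_real ger0_norm ?mulr_ge0 ?pi_ge0//.
by rewrite /cabs normCi mulr1.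
Qed.

Lemma pi_gt1 : 1 < pi :> R.
Proof. by rewrite (lt_le_trans _ (pi_ge2 R))// ltr1n. Qed.

(** The normalization by [2 * pi] absorbs the factor 2 of [norm_cintegral_le]. *)
Lemma cint_bound c f (M : R) : compact_contour c -> contour_cont c f ->
  (forall z, contour_image c z -> cabs (f z) <= M) ->
  cabs (cint c f) <= M * contour_length c.
Proof.
move=> cc cf fM.
have mD := contour_dom_measurable c.
have [v1 v2] : cintegrable [set` contour_dom c] (velocity c).
  have := contour_cont_integrable cc (@contour_cont_cst c 1).
  by apply: eq_cintegrable => // t _; rewrite /cintegrand mul1r.
have iv : mu.-integrable [set` contour_dom c]
    (EFin \o (fun t => `|complex.Re (velocity c t)| + `|complex.Im (velocity c t)|)).
  move: (integrableD mD (integrable_norm v1) (integrable_norm v2)).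
  by apply: eq_integrable.
have iMv : mu.-integrable [set` contour_dom c]
    (EFin \o (fun t => M * (`|complex.Re (velocity c t)| + `|complex.Im (velocity c t)|))).
  exact: (integrableZl mD M iv).
have B : cabs (cintegral [set` contour_dom c] (cintegrand c f)) <=
    2 * (M * contour_length c).
  rewrite -cabs_le /contour_length -RintegralZl//.
  apply: norm_cintegral_le => //; first exact: contour_cont_integrable.
  move=> t ct; rewrite cabs_le /cintegrand cabsM ler_pM ?cabs_ge0//.
    by apply: fM; exists t.
  by rewrite -cabs_le; exact: norm_le_ReIm.
have M0 : 0 <= M * contour_length c.
  by have := le_trans (cabs_ge0 _) B; rewrite pmulr_rge0.
rewrite cintE cabsM cabsV cabs_two_pi_i ler_pdivrMr ?mulr_gt0 ?pi_gt0//.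
apply: (le_trans B); rewrite [leRHS]mulrA [X in _ <= X * _]mulrC ler_peMr//.
  by rewrite mulr_ge0.
by rewrite ltW// pi_gt1.
Qed.

(** * Segments *)

Definition seg_point z w t : R[i] := z + t%:C * (w - z).

Lemma is_derive_affine (a b t : R) :
  is_derive t (1 : R) (fun t => a + t * b) b.
Proof.
apply/is_derive1_caratheodory; exists (cst b).
by split; [move=> z /=; ring|exact: cst_continuous|].
Qed.

Lemma derive1_affine (a b t : R) : derive1 (fun t => a + t * b) t = b.
Proof. by rewrite derive1E; have [_ ->] := is_derive_affine a b t. Qed.

Lemma C1_affine (a b : R) : C1 (fun t => a + t * b).
Proof.
split; first by move=> t; have [] := is_derive_affine a b t.
have -> : derive1 (fun t => a + t * b) = cst b.
  by apply/funext => t; exact: derive1_affine.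
exact: cst_continuous.
Qed.

Lemma seg_pointE z w t : seg_point z w t =
  (complex.Re z + t * complex.Re (w - z)) +i* (complex.Im z + t * complex.Im (w - z)).
Proof.
apply: complex_eqP; rewrite /seg_point.
- by rewrite [LHS]ReD [X in _ + X]ReM /= mul0r subr0.
- by rewrite [LHS]ImD [X in _ + X]ImM /= mul0r addr0.
Qed.

Fact seg_piecewise_C1 z w : piecewise_C1 `[0%R, 1%R] (seg_point z w).
Proof.
move=> a b _ _ ab; exists [:: b]; first exact: itv_partition1.
move=> k _; exists (fun t => complex.Re z + t * complex.Re (w - z)),
  (fun t => complex.Im z + t * complex.Im (w - z)).
by split; [exact: C1_affine|exact: C1_affine|move=> t _; exact: seg_pointE].
Qed.

Definition segment z w : contour R := Contour (@seg_piecewise_C1 z w).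

Lemma segment_compact_contour z w : compact_contour (segment z w).
Proof. by exists 0, 1; split. Qed.

Lemma segment_imageP z w v : contour_image (segment z w) v <->
  exists2 t, 0 <= t <= 1 & v = seg_point z w t.
Proof.
by split => [[t /= t01 <-]|[t t01 ->]]; exists t => //; move: t01; rewrite /= in_itv.
Qed.

Lemma segment_velocity z w t : velocity (segment z w) t = w - z.
Proof.
rewrite /velocity; apply: complex_eqP => /=.
- rewrite (_ : (fun s => _) = (fun s => complex.Re z + s * complex.Re (w - z))).
    exact: derive1_affine.
  by apply/funext => s; rewrite seg_pointE.
- rewrite (_ : (fun s => _) = (fun s => complex.Im z + s * complex.Im (w - z))).
    exact: derive1_affine.
  by apply/funext => s; rewrite seg_pointE.
Qed.

Lemma segment_length_le z w : contour_length (segment z w) <= 2 * cabs (w - z).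
Proof.
rewrite /contour_length.
rewrite (@eq_Rintegral _ _ _ mu _ (fun=> `|complex.Re (w - z)| + `|complex.Im (w - z)|)); last first.
  by move=> t _; rewrite segment_velocity.
rewrite Rintegral_cst; last exact: contour_dom_measurable.
rewrite /= lebesgue_measure_itv /= lte_fin ltr01 oppr0 adde0 /= mulr1.
rewrite mulr_natl mulr2n lerD// -lecR -cabsE; [exact: norm_Re_le|exact: norm_Im_le].
Qed.

Lemma cint_segment_bound z w f (M : R) : 0 <= M -> contour_cont (segment z w) f ->
  (forall t, 0 <= t <= 1 -> cabs (f (seg_point z w t)) <= M) ->
  cabs (cint (segment z w) f) <= M * (2 * cabs (w - z)).
Proof.
move=> M0 cf fM; apply: (le_trans (cint_bound (M := M) (segment_compact_contour z w) cf _)).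
  by move=> v /segment_imageP[t t01 ->]; exact: fM.
by rewrite ler_wpM2l// segment_length_le.
Qed.

Lemma segment_primitive z w f F : contour_cont (segment z w) f ->
  (forall t, 0 <= t <= 1 ->
    has_cderiv F (seg_point z w t) (f (seg_point z w t))) ->
  cint (segment z w) f = (F w - F z) / two_pi_i R.
Proof.
move=> cf dF; rewrite (cint_primitive (F := F) ltr01 _ cf)//.
  congr ((F _ - F _) / _); rewrite /= /seg_point.
    by rewrite mul1r addrC subrK.
  by rewrite mul0r addr0.
by move=> v /segment_imageP[t t01 ->]; exact: dF.
Qed.

End Segments.

(** * Integrals over triangles *)

Section Triangles.
Variable R : realType.
Implicit Types (f g : R[i] -> R[i]) (r s t x y : R) (a u v z w : R[i]).
Notation mu := (@lebesgue_measure R).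

(** The retraction of the line onto the unit interval; it extends a function that
is continuous along a segment to the line of the segment. *)
Definition clamp01 t : R := (`|t| - `|t - 1| + 1) / 2.

Lemma clamp01_id t : 0 <= t <= 1 -> clamp01 t = t.
Proof.
move=> /andP[t0 t1]; rewrite /clamp01 ger0_norm// ler0_norm ?subr_le0//.
by field.
Qed.

Lemma clamp01_in t : 0 <= clamp01 t <= 1.
Proof.
rewrite /clamp01; have [t0|t0] := leP 0 t; have [t1|t1] := leP 0 (t - 1);
  rewrite ?(ger0_norm t0) ?(ltr0_norm t0) ?(ger0_norm t1) ?(ltr0_norm t1);
  apply/andP; split; lra.
Qed.

Lemma clamp01_continuous : continuous clamp01.
Proof.
move=> t.
apply: (@continuousM R R (fun s => `|s| - `|s - 1| + 1) (cst 2^-1)); last exact: cst_continuous.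
apply: (@continuousD R R R (fun s => `|s| - `|s - 1|)); last exact: cst_continuous.
apply: (@continuousB R R R Num.norm (fun s => `|s - 1|)); first exact: norm_continuous.
apply: (@continuous_comp _ _ _ (fun s : R => s - 1) Num.norm).
  by apply: continuousB; [by move=> ?|exact: cst_continuous].
exact: norm_continuous.
Qed.

Lemma antiderivative01 (h : R -> R) : continuous h ->
  exists G, forall t, 0 <= t <= 1 -> is_derive t (1 : R) G (h t).
Proof.
move=> ch; exists (fun x => Rintegral mu `[-1, x] h) => t /andP[t0 t1].
have ih : mu.-integrable `[-1, 2] (EFin \o h).
  by apply: continuous_compact_integrable;
    [exact: segment_compact|exact: continuous_subspaceT].
have [] := @continuous_FTC1_closed R h (-1) t 2 _ ih _ (ch t).
- by rewrite (le_lt_trans t1)// ltr1n.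
- by rewrite (lt_le_trans _ t0)// ltrN10.
- by move=> d1 d2; split; [exact: d1|rewrite -derive1E; exact: d2].
Qed.

Lemma seg_point0 z w : seg_point z w 0 = z.
Proof. by rewrite /seg_point mul0r addr0. Qed.

Lemma seg_point1 z w : seg_point z w 1 = w.
Proof. by rewrite /seg_point mul1r addrC subrK. Qed.

Lemma seg_point_seg_point z w s t x :
  seg_point (seg_point z w s) (seg_point z w t) x =
  seg_point z w (s + x * (t - s)).
Proof.
rewrite /seg_point rmorphD rmorphM rmorphB /=.
by ring.
Qed.

(** Antidifferentiation along the line through [z] and [w] turns the integral over
a subsegment into a difference, whatever its orientation. Reversal and
bisection of segments follow. *)
Lemma segment_additive z w f : contour_cont (segment z w) f ->
  exists Phi : R -> R[i], forall s t, 0 <= s <= 1 -> 0 <= t <= 1 ->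
    cint (segment (seg_point z w s) (seg_point z w t)) f = Phi t - Phi s.
Proof.
move=> cf; pose g t := f (seg_point z w (clamp01 t)).
have cg : continuous g.
  move=> t; apply: (@continuous_comp _ _ _ (fun t => seg_point z w (clamp01 t)) f).
    apply: (@continuous_comp _ _ _ clamp01 (seg_point z w)).
      exact: clamp01_continuous.
    apply: (@continuousD R[i] R[i] R); first exact: cst_continuous.
    apply: (@continuousM R[i] R); last exact: cst_continuous.
    exact: real_complex_continuous.
  by apply: cf; apply/segment_imageP; exists (clamp01 t) => //; exact: clamp01_in.
have [Gr dGr] := antiderivative01 (fun t => continuous_Re (cg t)).
have [Gi dGi] := antiderivative01 (fun t => continuous_Im (cg t)).
exists (fun t => (w - z) * (Gr t +i* Gi t) / two_pi_i R) => s t s01 t01.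
rewrite cintE -mulrBl; congr (_ / _); rewrite -mulrBr.
pose q x := (t - s)%:C * g (s + x * (t - s)).
have st01 x : 0 <= x <= 1 -> 0 <= s + x * (t - s) <= 1.
  by move: s01 t01 => /andP[? ?] /andP[? ?] /andP[? ?]; apply/andP; split; nra.
have cq : {within `[0, 1], continuous q}.
  apply: continuous_subspaceT => x.
  apply: (@continuousM R[i] R (cst (t - s)%:C) (fun x => g (s + x * (t - s)))); first exact: cst_continuous.
  apply: (@continuous_comp _ _ _ (fun x => s + x * (t - s)) g); last exact: cg.
  exact: C1_continuous (C1_affine _ _) _.
have qE : cintegral `[0, 1] q = (Gr t +i* Gi t) - (Gr s +i* Gi s).
  rewrite (cintegral_FTC (G := fun x => Gr (s + x * (t - s)) +i* Gi (s + x * (t - s))) ltr01 cq).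
    by rewrite mul0r mul1r addr0 (_ : s + (t - s) = t)//; ring.
  move=> x /st01 x01; rewrite /q /=; split.
    rewrite ReM /= mul0r subr0 mulrC.
    exact: (@is_derive1_comp R Gr (fun x => s + x * (t - s)) x _ _ (dGr _ x01)
      (is_derive_affine _ _ _)).
  rewrite ImM /= mul0r addr0 mulrC.
  exact: (@is_derive1_comp R Gi (fun x => s + x * (t - s)) x _ _ (dGi _ x01)
      (is_derive_affine _ _ _)).
rewrite -qE -cintegralZ; [|exact: measurable_itv|exact: within_cintegrable].
apply: eq_cintegral => x /=; rewrite in_itv /= => x01.
rewrite /cintegrand segment_velocity /= seg_point_seg_point /q /g clamp01_id; last exact: st01.
rewrite mulrC /seg_point rmorphB /=.
by ring.
Qed.

Lemma segment_rev z w f : contour_cont (segment z w) f ->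
  cint (segment w z) f = - cint (segment z w) f.
Proof.
move=> /segment_additive[Phi H].
have := H 0 1; have := H 1 0; rewrite seg_point0 seg_point1 !lexx !ler01 /=.
by move=> -> // -> //; rewrite opprB.
Qed.

Lemma segment_mid z w f : contour_cont (segment z (w + w - z)) f ->
  cint (segment z (w + w - z)) f =
  cint (segment z w) f + cint (segment w (w + w - z)) f.
Proof.
move=> /segment_additive[Phi H].
have E : seg_point z (w + w - z) (1/2) = w.
  rewrite /seg_point; have -> : w + w - z - z = 2 * (w - z) by ring.
  rewrite mulrA (_ : (1/2)%:C * 2 = 1 :> R[i]); first by ring.
  by rewrite div1r -(rmorph_nat (@real_complex R)) -rmorphM mulVf ?pnatr_eq0.
have h01 : 0 <= (1/2 : R) <= 1 by apply/andP; split; lra.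
have := H 0 1; have := H (1/2) 1; have := H 0 (1/2).
rewrite E seg_point0 seg_point1 !lexx !ler01 /=.
by move=> -> // -> // -> //; ring.
Qed.

Definition triangle_int f a u v : R[i] :=
  cint (segment a (a + u)) f + cint (segment (a + u) (a + v)) f +
  cint (segment (a + v) a) f.

Definition hull a u v : set R[i] :=
  [set z | exists x y, [/\ 0 <= x, 0 <= y, x + y <= 1 & z = a + x%:C * u + y%:C * v]].

Lemma interpol_ge0 (p q t : R) : 0 <= t -> t <= 1 -> 0 <= p -> 0 <= q ->
  0 <= p + t * (q - p).
Proof.
move=> t0 t1 p0 q0; have -> : p + t * (q - p) = (1 - t) * p + t * q by ring.
by rewrite addr_ge0 ?mulr_ge0 ?subr_ge0.
Qed.

Lemma hull_segment a u v z w : hull a u v z -> hull a u v w ->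
  contour_image (segment z w) `<=` hull a u v.
Proof.
move=> [x1 [y1 [x10 y10 xy1 ->]]] [x2 [y2 [x20 y20 xy2 ->]]] _ /segment_imageP[t /andP[t0 t1] ->].
exists (x1 + t * (x2 - x1)), (y1 + t * (y2 - y1)); split.
- exact: interpol_ge0.
- exact: interpol_ge0.
- rewrite -subr_ge0; set e := (X in 0 <= X).
  have -> : e = (1 - (x1 + y1)) + t * ((1 - (x2 + y2)) - (1 - (x1 + y1))).
    by rewrite /e; ring.
  by rewrite interpol_ge0// subr_ge0.
- rewrite /seg_point !rmorphD !rmorphM !rmorphB /=.
  by ring.
Qed.

(** Joining the midpoints of the sides gives four triangles whose inner sides are
traversed twice, in opposite directions. The central triangle is the image of
the others by a homothety of ratio [- 1]. *)
Lemma triangle_split f a u v :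
  (forall z, hull a (u + u) (v + v) z -> {for z, continuous f}) ->
  triangle_int f a (u + u) (v + v) =
  triangle_int f a u v + triangle_int f (a + u) u v +
  triangle_int f (a + v) u v + triangle_int f (a + u + v) (- u) (- v).
Proof.
move=> cf.
pose H x y := a + x%:C * (u + u) + y%:C * (v + v).
have half : (1/2)%:C + (1/2)%:C = 1 :> R[i].
  by rewrite -rmorphD -splitr.
have hH x y : 0 <= x -> 0 <= y -> x + y <= 1 -> hull a (u + u) (v + v) (H x y).
  by move=> x0 y0 xy; exists x, y.
have EA : H 0 0 = a by rewrite /H !mul0r !addr0.
have EB : H 1 0 = a + (u + u) by rewrite /H mul0r mul1r addr0.
have EC : H 0 1 = a + (v + v) by rewrite /H mul0r mul1r addr0.
have ED : H (1/2) 0 = a + u.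
  by rewrite /H mul0r addr0 mulrDr -mulrDl half mul1r.
have EE : H 0 (1/2) = a + v.
  by rewrite /H mul0r addr0 mulrDr -mulrDl half mul1r.
have EM : H (1/2) (1/2) = a + u + v.
  by rewrite /H !mulrDr -!mulrDl half !mul1r.
have seg x y x' y' : 0 <= x -> 0 <= y -> x + y <= 1 ->
    0 <= x' -> 0 <= y' -> x' + y' <= 1 ->
    contour_cont (segment (H x y) (H x' y')) f.
  move=> x0 y0 xy x0' y0' xy' z /hull_segment hz.
  by apply: cf; apply: hz; exact: hH.
rewrite /triangle_int.
rewrite (_ : a + u + u = a + (u + u)); last by rewrite addrA.
rewrite (_ : a + v + v = a + (v + v)); last by rewrite addrA.
rewrite (_ : a + v + u = a + u + v); last by rewrite addrAC.
rewrite (_ : a + u + v - u = a + v); last by ring.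
rewrite (_ : a + u + v - v = a + u); last by ring.
have m1 : cint (segment a (a + (u + u))) f =
    cint (segment a (a + u)) f + cint (segment (a + u) (a + (u + u))) f.
  have E : a + u + (a + u) - a = a + (u + u) by ring.
  have := @segment_mid a (a + u) f; rewrite E; apply.
  by rewrite -EB -{1}EA; apply: seg; lra.
have m2 : cint (segment (a + (u + u)) (a + (v + v))) f =
    cint (segment (a + (u + u)) (a + u + v)) f +
    cint (segment (a + u + v) (a + (v + v))) f.
  have E : (a + u + v) + (a + u + v) - (a + (u + u)) = a + (v + v) by ring.
  have := @segment_mid (a + (u + u)) (a + u + v) f; rewrite E; apply.
  by rewrite -EB -EC; apply: seg; lra.
have m3 : cint (segment (a + (v + v)) a) f =
    cint (segment (a + (v + v)) (a + v)) f + cint (segment (a + v) a) f.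
  have E : (a + v) + (a + v) - (a + (v + v)) = a by ring.
  have := @segment_mid (a + (v + v)) (a + v) f; rewrite E; apply.
  by rewrite -EC -{1}EA; apply: seg; lra.
have r1 : cint (segment (a + v) (a + u)) f = - cint (segment (a + u) (a + v)) f.
  by apply: segment_rev; rewrite -ED -EE; apply: seg; lra.
have r2 : cint (segment (a + u + v) (a + u)) f = - cint (segment (a + u) (a + u + v)) f.
  by apply: segment_rev; rewrite -EM -ED; apply: seg; lra.
have r3 : cint (segment (a + u + v) (a + v)) f = - cint (segment (a + v) (a + u + v)) f.
  by apply: segment_rev; rewrite -EM -EE; apply: seg; lra.
rewrite m1 m2 m3 r1 r2 r3.
do 9 ?[move: (cint (segment _ _) f) => ?].
by ring.
Qed.

End Triangles.

(** * Goursat's theorem *)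

Section Goursat.
Variable R : realType.
Implicit Types (f g k : R[i] -> R[i]) (r s t x y : R) (a b u v z w : R[i]).

Lemma near_cabsP z (P : R[i] -> Prop) : (\forall w \near z, P w) <->
  exists2 r, 0 < r & forall w, cabs (w - z) < r -> P w.
Proof.
split=> [/nbhs_ballP[_ /gt0_complex[r r0 ->] H]|[r r0 H]].
  exists r => // w wz; apply: H.
  by rewrite /ball /= distrC cabsE ltcR.
apply/nbhs_ballP; exists r%:C; first by rewrite /= ltcR.
by move=> w; rewrite /ball /= distrC cabsE ltcR; exact: H.
Qed.

Lemma has_cderiv_continuous f z d : has_cderiv f z d -> {for z, continuous f}.
Proof.
move=> [psi [cpsi _ fE]]; have -> : f = fun w => f z + (w - z) * psi w.
  by apply/funext => w; exact: fE.
apply: (@continuousD R[i] R[i] R[i]); first exact: cst_continuous.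
apply: (@continuousM R[i] R[i]); last exact: cpsi.
by apply: (@continuousB R[i] R[i] R[i]); [move=> ?|exact: cst_continuous].
Qed.

Lemma derivable_continuous f z : derivable f z 1 -> {for z, continuous f}.
Proof. by move=> /derivable_has_cderiv[d]; exact: has_cderiv_continuous. Qed.

Lemma has_cderiv_estimate f z d :
  (forall e : R, 0 < e -> \forall w \near z,
     cabs (f w - f z - (w - z) * d) <= e * cabs (w - z)) ->
  has_cderiv f z d.
Proof.
move=> H; exists (fun w => if w == z then d else (f w - f z) / (w - z)).
split; [|by rewrite eqxx|]; last first.
  move=> w; have [->|wz] := eqVneq w z; first by rewrite subrr mul0r addr0.
  by rewrite mulrC divfK ?subr_eq0// addrC subrK.
apply/continuous_cabsP => e e0; rewrite eqxx.
have e20 : 0 < e / 2 by rewrite divr_gt0.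
apply: filterS (H _ e20) => w.
have [->|wz] := eqVneq w z; first by move=> _; rewrite subrr cabs0.
have wz0 : 0 < cabs (w - z) by rewrite cabs_gt0 subr_eq0.
have -> : f w - f z - (w - z) * d = (w - z) * ((f w - f z) / (w - z) - d).
  by rewrite mulrBr mulrCA divff ?mulr1// subr_eq0.
rewrite cabsM mulrC ler_pM2r// cabs_distC => /le_lt_trans; apply.
by rewrite ltr_pdivrMr// ltr_pMr// ltr1n.
Qed.

Lemma triangle_int_primitive f F a u v :
  (forall z, hull a u v z -> {for z, continuous f}) ->
  (forall z, hull a u v z -> has_cderiv F z (f z)) ->
  triangle_int f a u v = 0.
Proof.
move=> cf dF.
have h0 : hull a u v a by exists 0, 0; rewrite !mul0r !addr0; split.
have h1 : hull a u v (a + u).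
  by exists 1, 0; rewrite mul0r mul1r !addr0; split.
have h2 : hull a u v (a + v).
  by exists 0, 1; rewrite mul0r mul1r !addr0 add0r; split.
have seg z w : hull a u v z -> hull a u v w ->
    cint (segment z w) f = (F w - F z) / two_pi_i R.
  move=> hz hw; have hs := hull_segment hz hw.
  apply: segment_primitive; first by move=> ? /hs; exact: cf.
  by move=> t t01; apply: dF; apply: hs; apply/segment_imageP; exists t.
rewrite /triangle_int !seg// -!mulrDl.
rewrite (_ : _ + _ = 0) ?mul0r//.
by move: (F _) (F _) (F _) => A B C; ring.
Qed.

Lemma triangle_int_bound f a u v (M : R) : 0 <= M ->
  (forall z, hull a u v z -> {for z, continuous f}) ->
  (forall z, hull a u v z -> cabs (f z) <= M) ->
  cabs (triangle_int f a u v) <= M * (4 * (cabs u + cabs v)).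
Proof.
move=> M0 cf fM.
have h0 : hull a u v a by exists 0, 0; rewrite !mul0r !addr0; split.
have h1 : hull a u v (a + u).
  by exists 1, 0; rewrite mul0r mul1r !addr0; split.
have h2 : hull a u v (a + v).
  by exists 0, 1; rewrite mul0r mul1r !addr0 add0r; split.
have seg z w : hull a u v z -> hull a u v w ->
    cabs (cint (segment z w) f) <= M * (2 * cabs (w - z)).
  move=> hz hw; have hs := hull_segment hz hw.
  apply: cint_segment_bound => //; first by move=> ? /hs; exact: cf.
  by move=> t t01; apply: fM; apply: hs; apply/segment_imageP; exists t.
have E1 : cabs (a + u - a) = cabs u by congr cabs; ring.
have E2 : cabs (a + v - (a + u)) <= cabs u + cabs v.
  have -> : a + v - (a + u) = v - u by ring.
  by rewrite (le_trans (cabsD _ _))// cabsN addrC.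
have E3 : cabs (a - (a + v)) = cabs v.
  by rewrite -cabsN; congr cabs; ring.
have S1 := seg _ _ h0 h1; have S2 := seg _ _ h1 h2; have S3 := seg _ _ h2 h0.
rewrite E1 in S1; rewrite E3 in S3.
have {}S2 := le_trans S2 (ler_wpM2l M0 (ler_wpM2l (ler0n _ 2) E2)).
rewrite (le_trans (cabsD _ _))// (le_trans (lerD (cabsD _ _) (lexx _)))//.
rewrite (le_trans (lerD (lerD S1 S2) S3))//.
by rewrite le_eqVlt; apply/orP; left; apply/eqP; ring.
Qed.

Lemma triangle_intD f g a u v :
  (forall z, hull a u v z -> {for z, continuous f}) ->
  (forall z, hull a u v z -> {for z, continuous g}) ->
  triangle_int (fun z => f z + g z) a u v =
  triangle_int f a u v + triangle_int g a u v.
Proof.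
move=> cf cg.
have h0 : hull a u v a by exists 0, 0; rewrite !mul0r !addr0; split.
have h1 : hull a u v (a + u).
  by exists 1, 0; rewrite mul0r mul1r !addr0; split.
have h2 : hull a u v (a + v).
  by exists 0, 1; rewrite mul0r mul1r !addr0 add0r; split.
have seg z w : hull a u v z -> hull a u v w ->
    cint (segment z w) (fun z => f z + g z) =
    cint (segment z w) f + cint (segment z w) g.
  move=> hz hw; have hs := hull_segment hz hw.
  apply: cintD; apply: contour_cont_integrable;
    try exact: segment_compact_contour; move=> ? /hs; [exact: cf|exact: cg].
rewrite /triangle_int !seg//.
do 6 ?[move: (cint (segment _ _) _) => ?].
by ring.
Qed.

(** Coordinates in the frame [(a, u, v)] of the points of a homothetic triangle;
the ratio [s] is negative for the central triangle of a subdivision. *)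
Lemma hull_sub a u v x y s : 0 <= x -> 0 <= y -> x + y <= 1 ->
  0 <= x + s -> 0 <= y + s -> x + y + s <= 1 ->
  forall z, hull (a + x%:C * u + y%:C * v) (s%:C * u) (s%:C * v) z ->
  exists p q, [/\ 0 <= p, 0 <= q, p + q <= 1,
     hull a u v z & z = a + (x + s * p)%:C * u + (y + s * q)%:C * v].
Proof.
move=> x0 y0 xy xs ys xys z [p [q [p0 q0 pq ->]]]; exists p, q.
have E : a + x%:C * u + y%:C * v + p%:C * (s%:C * u) + q%:C * (s%:C * v) =
    a + (x + s * p)%:C * u + (y + s * q)%:C * v.
  by rewrite !rmorphD !rmorphM /=; ring.
split=> //; exists (x + s * p), (y + s * q); split=> //.
- have -> : x + s * p = x + p * ((x + s) - x) by ring.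
  by rewrite interpol_ge0//; lra.
- have -> : y + s * q = y + q * ((y + s) - y) by ring.
  by rewrite interpol_ge0//; lra.
- rewrite -subr_ge0.
  have -> : 1 - (x + s * p + (y + s * q)) =
    (1 - (x + y)) + (p + q) * ((1 - (x + y + s)) - (1 - (x + y))) by ring.
  by rewrite interpol_ge0 ?subr_ge0// addr_ge0.
Qed.

Lemma expr_half_lt r : 0 < r -> exists n, (2^-1 : R) ^+ n < r.
Proof.
move=> r0; have [n _ /(_ n (leqnn n))] := near_infty_natSinv_expn_lt (PosNum r0).
by rewrite /= div1r -exprVn => H; exists n.
Qed.

(** The intervals of radius [2^-n] about [x n] are nested, and the supremum of
their left end points lies in all of them. *)
Lemma dyadic_limit (x : nat -> R) :
  (forall n, `|x n.+1 - x n| <= (2^-1) ^+ n.+1) ->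
  exists l, forall n, `|x n - l| <= (2^-1) ^+ n.
Proof.
move=> H.
have E n : (2^-1 : R) ^+ n = (2^-1) ^+ n.+1 + (2^-1) ^+ n.+1.
  by rewrite exprSr [RHS]addrC -splitr.
have p n : 0 <= (2^-1 : R) ^+ n by rewrite exprn_ge0.
have dec n m : (n <= m)%N -> `|x m - x n| <= (2^-1) ^+ n - (2^-1) ^+ m.
  elim: m => [|m IH]; first by rewrite leqn0 => /eqP->; rewrite !subrr normr0.
  rewrite leq_eqVlt => /predU1P[->|]; first by rewrite !subrr normr0.
  rewrite ltnS => /IH {}IH; have -> : x m.+1 - x n = (x m.+1 - x m) + (x m - x n) by ring.
  rewrite (le_trans (ler_normD _ _))// (le_trans (lerD (H m) IH))//.
  by rewrite (E m); lra.
have up n m : x n - (2^-1) ^+ n <= x m + (2^-1) ^+ m.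
  have [/dec|/ltnW/dec] := leqP n m; rewrite ler_norml => /andP[h1 h2];
    have := p n; have := p m; lra.
pose S := range (fun n => x n - (2^-1) ^+ n).
have hS : has_sup S.
  split; first by exists (x 0%N - (2^-1) ^+ 0), 0%N.
  by exists (x 0%N + (2^-1) ^+ 0) => _ [n _ <-]; exact: up.
exists (sup S) => n.
have h1 : x n - (2^-1) ^+ n <= sup S.
  by apply: (ub_le_sup hS.2); exists n.
have h2 : sup S <= x n + (2^-1) ^+ n.
  by apply: ge_sup; [exact: hS.1|move=> _ [m _ <-]; exact: up].
by rewrite ler_norml; apply/andP; split; lra.
Qed.

End Goursat.

Section GoursatTheorem.
Variable R : realType.
Implicit Types (f g k : R[i] -> R[i]) (r s t x y : R) (a b u v z w : R[i]).

Let half_pow n : R := 2^-1 ^+ n.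

(** A triple [(x, y, s)] stands for the triangle with vertex [a + x u + y v] and
sides [s u] and [s v]. The inequalities place its three vertices in the large
triangle; [s] is negative when the orientation of the sides is reversed. *)
Definition subtriangle (q : R * R * R) :=
  [/\ 0 <= q.1.1, 0 <= q.1.2 & q.1.1 + q.1.2 <= 1] /\
  [/\ 0 <= q.1.1 + q.2, 0 <= q.1.2 + q.2 & q.1.1 + q.1.2 + q.2 <= 1].

Definition subtriangle_int f a u v (q : R * R * R) : R[i] :=
  triangle_int f (a + q.1.1%:C * u + q.1.2%:C * v) (q.2%:C * u) (q.2%:C * v).

(** The pigeonhole step of Goursat's argument, for an arbitrary [T] so that only
real inequalities are involved. *)
Lemma quarter_selection (T : R * R * R -> R) x y s h :
  `|h| = `|s| / 2 -> s = h + h ->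
  0 <= x -> 0 <= y -> x + y <= 1 -> 0 <= x + s -> 0 <= y + s -> x + y + s <= 1 ->
  T (x, y, s) <= T (x, y, h) + T (x + h, y, h) + T (x, y + h, h) +
    T (x + h, y + h, - h) ->
  exists q', [/\ subtriangle q', `|q'.2| = `|s| / 2,
    `|q'.1.1 - x| <= `|s| / 2, `|q'.1.2 - y| <= `|s| / 2 &
    T (x, y, s) / 4 <= T q'].
Proof.
move=> <- hh x0 y0 xy xs ys xys.
have xh : x + h - x = h by ring.
have yh : y + h - y = h by ring.
have h0 : 0 <= `|h| by [].
have [c1 _|c1] := leP (T (x, y, s) / 4) (T (x, y, h)).
  exists (x, y, h); rewrite /= !subrr normr0; split => //.
  by split; split => /=; lra.
have [c2 _|c2] := leP (T (x, y, s) / 4) (T (x + h, y, h)).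
  exists (x + h, y, h); rewrite /= xh subrr normr0; split => //.
  by split; split => /=; lra.
have [c3 _|c3] := leP (T (x, y, s) / 4) (T (x, y + h, h)).
  exists (x, y + h, h); rewrite /= yh subrr normr0; split => //.
  by split; split => /=; lra.
have [c4 _|c4] := leP (T (x, y, s) / 4) (T (x + h, y + h, - h)).
  exists (x + h, y + h, - h); rewrite /= xh yh normrN; split => //.
  by split; split => /=; lra.
move=> split4; exfalso; move: c1 c2 c3 c4 split4.
by move: (T _) (T _) (T _) (T _) (T _) => *; lra.
Qed.

Lemma subtriangle_step f a u v q :
  (forall z, hull a u v z -> {for z, continuous f}) ->
  subtriangle q -> exists q', [/\ subtriangle q', `|q'.2| = `|q.2| / 2,
    `|q'.1.1 - q.1.1| <= `|q.2| / 2, `|q'.1.2 - q.1.2| <= `|q.2| / 2 &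
    cabs (subtriangle_int f a u v q) / 4 <= cabs (subtriangle_int f a u v q')].
Proof.
case: q => [[x y] s] cf [[/= x0 y0 xy] [/= xs ys xys]].
pose h := s / 2.
have hh : s = h + h by exact: splitr.
have hC : s%:C = h%:C + h%:C :> R[i] by rewrite hh rmorphD.
have nh : `|h| = `|s| / 2 by rewrite normrM [`|2^-1|]ger0_norm.
pose T q := cabs (subtriangle_int f a u v q).
have split4 : T (x, y, s) <= T (x, y, h) + T (x + h, y, h) + T (x, y + h, h) +
    T (x + h, y + h, - h).
  rewrite /T /subtriangle_int /= hC !mulrDl triangle_split; last first.
    move=> z; rewrite -!mulrDl -hC => /(hull_sub x0 y0 xy xs ys xys).
    by move=> [p [q [_ _ _ hz _]]]; exact: cf.
  have E1 : a + x%:C * u + y%:C * v + h%:C * u = a + (x + h)%:C * u + y%:C * v.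
    by rewrite !rmorphD /=; ring.
  have E2 : a + x%:C * u + y%:C * v + h%:C * v = a + x%:C * u + (y + h)%:C * v.
    by rewrite !rmorphD /=; ring.
  have E3 : a + (x + h)%:C * u + y%:C * v + h%:C * v =
      a + (x + h)%:C * u + (y + h)%:C * v.
    by rewrite !rmorphD /=; ring.
  rewrite E1 E2 E3 rmorphN /= !mulNr.
  have cabs4 A B C D : cabs (A + B + C + D) <= cabs A + cabs B + cabs C + cabs D :> R.
    apply: (le_trans (cabsD _ _)); rewrite lerD2r.
    apply: (le_trans (cabsD _ _)); rewrite lerD2r.
    exact: cabsD.
  exact: cabs4.
exact: (quarter_selection (T := T) nh hh) x0 y0 xy xs ys xys split4.
Qed.

(** Each subdivision halves the triangle and keeps at least a quarter of the modulus
of the integral. *)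
Lemma subtriangle_sequence f a u v :
  (forall z, hull a u v z -> {for z, continuous f}) ->
  exists q : nat -> R * R * R, forall n, [/\ subtriangle (q n),
    `|(q n).2| = half_pow n,
    `|(q n.+1).1.1 - (q n).1.1| <= half_pow n.+1,
    `|(q n.+1).1.2 - (q n).1.2| <= half_pow n.+1 &
    cabs (triangle_int f a u v) * (half_pow n * half_pow n) <=
      cabs (subtriangle_int f a u v (q n))].
Proof.
move=> cf.
have [next nextP] := @choice _ _ (fun q q' => subtriangle q ->
    [/\ subtriangle q', `|q'.2| = `|q.2| / 2,
    `|q'.1.1 - q.1.1| <= `|q.2| / 2, `|q'.1.2 - q.1.2| <= `|q.2| / 2 &
    cabs (subtriangle_int f a u v q) / 4 <= cabs (subtriangle_int f a u v q')])
  (fun q => match pselect (subtriangle q) with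
    | left sq => let: ex_intro q' P := subtriangle_step cf sq in
                 ex_intro _ q' (fun=> P)
    | right nsq => ex_intro _ q (fun sq => False_ind _ (nsq sq)) end).
pose q n := iter n next (0, 0, 1).
have qS n : q n.+1 = next (q n) by [].
have Q n : [/\ subtriangle (q n), `|(q n).2| = half_pow n &
    cabs (triangle_int f a u v) * (half_pow n * half_pow n) <=
      cabs (subtriangle_int f a u v (q n))].
  elim: n => [|n [sq q2 le]].
    split; first by split; split => //=; lra.
      by rewrite /half_pow expr0 normr1.
    by rewrite /subtriangle_int /half_pow expr0 !mulr1 !mul0r !addr0 !mul1r.
  have [sq' q2' _ _ le'] := nextP _ sq; split; first exact: sq'.
    by rewrite qS q2' q2 /half_pow exprSr.
  rewrite qS; apply: le_trans le'; rewrite ler_pdivlMr//; apply: le_trans le.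
  rewrite le_eqVlt; apply/orP; left; apply/eqP; rewrite /half_pow exprSr.
  by field.
exists q => n; have [sq q2 le] := Q n; have [_ _ h1 h2 _] := nextP _ sq.
have E : half_pow n.+1 = `|(q n).2| / 2 by rewrite q2 /half_pow exprSr.
by rewrite qS; split; [exact: sq|exact: q2|rewrite E; exact: h1|rewrite E; exact: h2|exact: le].
Qed.

Lemma no_self_bound (e X : R) : 0 < e -> 0 <= X -> e <= X * (e / (X + 1)) -> False.
Proof.
move=> e0 X0; rewrite mulrCA ler_pMr// ler_pdivlMr ?ltr_wpDl// mul1r.
by rewrite gerDl ler10.
Qed.

(** The triangles shrink to a point [l] of the hull. Near [l] the function is affine
up to [o(`|z - l|)], and the affine part has a primitive; so the integral over
the [n]-th triangle is [o(4^-n)], whereas it is at least [4^-n] times the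
integral over the whole triangle. *)
Theorem goursat f a u v :
  (forall z, hull a u v z -> derivable f z 1) -> triangle_int f a u v = 0.
Proof.
move=> df.
have cf z : hull a u v z -> {for z, continuous f}.
  by move=> /df; exact: derivable_continuous.
have [q Q] := subtriangle_sequence cf.
have [lx lxP] := @dyadic_limit R (fun n => (q n).1.1) (fun n =>
  let: And5 _ _ h _ _ := Q n in h).
have [ly lyP] := @dyadic_limit R (fun n => (q n).1.2) (fun n =>
  let: And5 _ _ _ h _ := Q n in h).
pose l := a + lx%:C * u + ly%:C * v.
have small r : (forall n, - (half_pow n + half_pow n) <= r) -> 0 <= r.
  move=> H; rewrite leNgt; apply/negP => r0.
  have [|n] := @expr_half_lt R (- r / 2); first by lra.
  by have := H n; rewrite /half_pow; lra.
have hp n : 0 < half_pow n by rewrite exprn_gt0.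
have hl : hull a u v l.
  exists lx, ly; split=> //.
  - apply: small => n; have [[[h _ _] _] _ _ _ _] := Q n.
    by have := lxP n; rewrite ler_norml => /andP[]; have := hp n; rewrite /half_pow; lra.
  - apply: small => n; have [[[_ h _] _] _ _ _ _] := Q n.
    by have := lyP n; rewrite ler_norml => /andP[]; have := hp n; rewrite /half_pow; lra.
  - rewrite -subr_ge0; apply: small => n; have [[[_ _ h] _] _ _ _ _] := Q n.
    have := lxP n; have := lyP n; rewrite !ler_norml => /andP[? ?] /andP[? ?].
    by have := hp n; rewrite /half_pow; lra.
have [d [psi [cpsi psil fE]]] := derivable_has_cderiv (df _ hl).
pose D := cabs u + cabs v.
have D0 : 0 <= D by rewrite addr_ge0// cabs_ge0.
apply/eqP; rewrite -cabs_eq0; apply/negPn/negP => e0.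
pose e := cabs (triangle_int f a u v).
have {}e0 : 0 < e by rewrite lt_neqAle cabs_ge0 eq_sym e0.
pose eta := e / (8 * D * D + 1).
have D1 : 0 < 2 * D + 1 by lra.
have DD0 : 0 < 8 * D * D + 1 by have := mulr_ge0 D0 D0; lra.
have eta0 : 0 < eta by rewrite divr_gt0.
have [del del0 delP] := (near_cabsP _ _).1 ((continuous_cabsP _ _).1 cpsi _ eta0).
have [|n nP] := @expr_half_lt R (del / (2 * D + 1)).
  by rewrite divr_gt0.
have nP' : 2^-1 ^+ n * (2 * D + 1) < del by rewrite -ltr_pdivlMr.
have [[[x0 y0 xy] [xs ys xys]] q2 _ _ le] := Q n.
set x := (q n).1.1 in x0 y0 xy xs ys xys; set y := (q n).1.2 in y0 xy ys xys.
set s := (q n).2 in xs ys xys q2.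
pose A z := f l + (z - l) * d.
pose rem z := (z - l) * (psi z - d).
have fAr z : f z = A z + rem z by rewrite fE /A /rem; ring.
have cA z : {for z, continuous A}.
  apply: (@continuousD R[i] R[i] R[i]); first exact: cst_continuous.
  apply: (@continuousM R[i] R[i]); last exact: cst_continuous.
  by apply: (@continuousB R[i] R[i] R[i]); [move=> ?|exact: cst_continuous].
pose H := hull (a + x%:C * u + y%:C * v) (s%:C * u) (s%:C * v).
have Hsub z : H z -> hull a u v z.
  by move=> /(hull_sub x0 y0 xy xs ys xys)[p [p' []]].
have crem z : H z -> {for z, continuous rem}.
  have -> : rem = fun z => f z - A z by apply/funext => w; rewrite fAr addrC addKr.
  move=> /Hsub hz; apply: (@continuousB R[i] R[i] R[i]); [exact: cf|exact: cA].
have dist z : H z -> cabs (z - l) <= 2 * half_pow n * D.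
  move=> /(hull_sub x0 y0 xy xs ys xys)[p [p' [p0 p'0 pp' _ ->]]].
  have -> : a + (x + s * p)%:C * u + (y + s * p')%:C * v - l =
      (x - lx + s * p)%:C * u + (y - ly + s * p')%:C * v.
    by rewrite /l !rmorphD !rmorphN /=; ring.
  have p1 : p <= 1 by apply: le_trans pp'; rewrite lerDl.
  have p'1 : p' <= 1 by apply: le_trans pp'; rewrite lerDr.
  have B (t r : R) : `|t| <= half_pow n -> 0 <= r -> r <= 1 ->
      `|t + s * r| <= 2 * half_pow n.
    move=> t1 r0 r1; rewrite (le_trans (ler_normD _ _))//.
    rewrite mulr_natl mulr2n lerD// normrM q2 (ger0_norm r0).
    by rewrite ler_piMr// ltW.
  apply: (le_trans (cabsD _ _)); rewrite /D mulrDr; apply: lerD.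
    rewrite cabsM cabs_real; apply: ler_wpM2r; first exact: cabs_ge0.
    by apply: B; [exact: lxP|exact: p0|exact: p1].
  rewrite cabsM cabs_real; apply: ler_wpM2r; first exact: cabs_ge0.
    by apply: B; [exact: lyP|exact: p'0|exact: p'1].
have rem_small z : H z -> cabs (rem z) <= 2 * half_pow n * D * eta.
  move=> Hz; rewrite /rem cabsM ler_pM ?cabs_ge0//; first exact: dist.
  rewrite cabs_distC -psil; apply/ltW; apply: delP.
  apply: (le_lt_trans (dist _ Hz)).
  apply: le_lt_trans nP'; rewrite -/(half_pow n).
  rewrite (_ : half_pow n * (2 * D + 1) = 2 * half_pow n * D + half_pow n); last by ring.
  by rewrite lerDl ltW.
(* The affine function [A] has a quadratic primitive. *)
have EA : triangle_int A (a + x%:C * u + y%:C * v) (s%:C * u) (s%:C * v) = 0.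
  apply: (@triangle_int_primitive R A (fun z => f l * z + (z - l) * (z - l) * (d / 2))).
    by move=> z _; exact: cA.
  move=> z _; exists (fun w => f l + ((w - l) + (z - l)) * (d / 2)); split.
  - apply: (@continuousD R[i] R[i] R[i]); first exact: cst_continuous.
    apply: (@continuousM R[i] R[i]); last exact: cst_continuous.
    apply: (@continuousD R[i] R[i] R[i]); last exact: cst_continuous.
    by apply: (@continuousB R[i] R[i] R[i]); [move=> ?|exact: cst_continuous].
  - by rewrite /A; field.
  - by move=> w; ring.
have := triangle_int_bound _ crem rem_small.
have -> : triangle_int rem (a + x%:C * u + y%:C * v) (s%:C * u) (s%:C * v) =
    subtriangle_int f a u v (q n).
  rewrite /subtriangle_int -/x -/y -/s.
  have {1}-> : f = fun z => A z + rem z by apply/funext => z; exact: fAr.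
  rewrite triangle_intD; [|by move=> z _; exact: cA|exact: crem].
  by rewrite EA add0r.
rewrite !cabsM !cabs_real q2 -mulrDr -/D => /(_ _) bound.
have {}bound : e * (half_pow n * half_pow n) <=
    2 * half_pow n * D * eta * (4 * (half_pow n * D)).
  apply: (le_trans le); apply: bound.
  exact: (mulr_ge0 (mulr_ge0 (mulr_ge0 (ler0n _ 2) (ltW (hp n))) D0) (ltW eta0)).
have {bound} : e <= 8 * D * D * eta.
  rewrite -(ler_pM2r (mulr_gt0 (hp n) (hp n))).
  by rewrite (_ : 8 * D * D * eta * _ = 2 * half_pow n * D * eta * (4 * (half_pow n * D)))//; ring.
exact: no_self_bound e0 (mulr_ge0 (mulr_ge0 (ler0n _ 8) D0) D0).
Qed.

End GoursatTheorem.

(** * Primitives on discs *)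

Section LocalPrimitive.
Variable R : realType.
Implicit Types (f g k : R[i] -> R[i]) (r s t x y : R) (a b u v z w : R[i]).

Lemma hull_scale b u v c : 0 <= c -> c <= 1 ->
  hull b (c%:C * u) (c%:C * v) `<=` hull b u v.
Proof.
move=> c0 c1 z [x [y [x0 y0 xy ->]]]; exists (x * c), (y * c); split.
- exact: mulr_ge0.
- exact: mulr_ge0.
- by rewrite -mulrDl mulr_ile1// addr_ge0.
- by rewrite !rmorphM /= !mulrA.
Qed.

(** Differentiability may fail at the vertex [b]: halving cuts off three triangles
which avoid [b], so the integral equals that over an arbitrarily small triangle
at [b], near which [k] is bounded. The first hypothesis says that [b] is met by
the triangle at its vertex only. *)
Lemma goursat_vertex k b u v :
  (forall x y, 0 <= x -> 0 <= y -> 0 < x + y -> x%:C * u + y%:C * v != 0) ->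
  (forall z, hull b u v z -> {for z, continuous k}) ->
  (forall z, hull b u v z -> z != b -> derivable k z 1) ->
  triangle_int k b u v = 0.
Proof.
move=> uv0 ck dk.
pose h n : R := 2^-1 ^+ n.
have h0 n : 0 < h n by rewrite exprn_gt0.
have h1 n : h n <= 1 by rewrite exprn_ile1 ?invf_le1// ler1n.
have hS n : h n = h n.+1 + h n.+1 by rewrite /h exprSr [RHS]addrC -splitr.
pose T n := triangle_int k b ((h n)%:C * u) ((h n)%:C * v).
have off x y : 0 <= x -> 0 <= y -> 0 < x + y -> x + y <= 1 ->
    derivable k (b + x%:C * u + y%:C * v) 1.
  move=> x0 y0 xy xy1; apply: dk; first by exists x, y.
  rewrite -subr_eq0 (_ : _ - b = x%:C * u + y%:C * v); last by ring.
  exact: uv0.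
have TS n : T n = T n.+1.
  rewrite {1}/T {1 2}hS rmorphD /= !mulrDl triangle_split; last first.
    move=> z; rewrite -!mulrDl -rmorphD -hS => /(hull_scale (ltW (h0 n)) (h1 n)).
    exact: ck.
  set c := h n.+1; have c0 : 0 < c by exact: h0.
  have cc : c + c <= 1 by rewrite -hS.
  have E p : 0 <= p -> p <= 1 -> 0 <= c * p <= c.
    by move=> p0 p1; rewrite mulr_ge0 ?(ltW c0)// ler_piMr// ltW.
  rewrite (goursat (a := b + c%:C * u)); last first.
    move=> z [p [q [p0 q0 pq ->]]].
    rewrite (_ : _ + _ = b + (c + c * p)%:C * u + (c * q)%:C * v); last first.
      by rewrite !rmorphD !rmorphM /=; ring.
    have pc0 : 0 <= c * p by rewrite mulr_ge0 ?(ltW c0).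
    have qc0 : 0 <= c * q by rewrite mulr_ge0 ?(ltW c0).
    have pqc : c * p + c * q <= c by rewrite -mulrDr ler_piMr// ltW.
    by apply: off; lra.
  rewrite (goursat (a := b + c%:C * v)); last first.
    move=> z [p [q [p0 q0 pq ->]]].
    rewrite (_ : _ + _ = b + (c * p)%:C * u + (c + c * q)%:C * v); last first.
      by rewrite !rmorphD !rmorphM /=; ring.
    have pc0 : 0 <= c * p by rewrite mulr_ge0 ?(ltW c0).
    have qc0 : 0 <= c * q by rewrite mulr_ge0 ?(ltW c0).
    have pqc : c * p + c * q <= c by rewrite -mulrDr ler_piMr// ltW.
    by apply: off; lra.
  rewrite (goursat (a := b + c%:C * u + c%:C * v)); last first.
    move=> z [p [q [p0 q0 pq ->]]].
    rewrite (_ : _ + _ = b + (c - c * p)%:C * u + (c - c * q)%:C * v); last first.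
      by rewrite !rmorphD !rmorphN !rmorphM /=; ring.
    have pc0 : 0 <= c * p by rewrite mulr_ge0 ?(ltW c0).
    have qc0 : 0 <= c * q by rewrite mulr_ge0 ?(ltW c0).
    have pqc : c * p + c * q <= c by rewrite -mulrDr ler_piMr// ltW.
    by apply: off; lra.
  by rewrite !addr0.
have T0 n : T n = triangle_int k b u v.
  elim: n => [|n <-]; last exact: esym (TS n).
  have h00 : h 0%N = 1 by exact: expr0.
  have m1 w : (1 : R)%:C * w = w by rewrite mul1r.
  rewrite /T h00 2!m1; exact: erefl.
have hb : hull b u v b by exists 0, 0; rewrite !mul0r !addr0; split.
have [del del0 delP] := (near_cabsP _ _).1 ((continuous_cabsP _ _).1 (ck _ hb) 1 ltr01).
pose M := cabs (k b) + 1; pose D := cabs u + cabs v.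
have M0 : 0 <= M by rewrite addr_ge0// cabs_ge0.
have D0 : 0 <= D by rewrite addr_ge0// cabs_ge0.
have D1 : 0 < D + 1 by rewrite ltr_wpDl.
have bound n : h n * (D + 1) < del ->
    cabs (triangle_int k b u v) <= M * (4 * (h n * D)).
  move=> nd; rewrite -(T0 n) /T.
  have -> : h n * D = cabs ((h n)%:C * u) + cabs ((h n)%:C * v).
    by rewrite !cabsM cabs_real (ger0_norm (ltW (h0 n))) -mulrDr.
  apply: triangle_int_bound; first exact: M0.
    by move=> z /(hull_scale (ltW (h0 n)) (h1 n)); exact: ck.
  move=> z [p [q [p0 q0 pq ->]]].
  set z' := _ + _.
  have dz : cabs (z' - b) < del.
    apply: le_lt_trans nd.
    have -> : z' - b = (h n * p)%:C * u + (h n * q)%:C * v.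
      by rewrite /z' !rmorphM /=; ring.
    apply: (le_trans (cabsD _ _)); rewrite !cabsM !cabs_real.
    have p1 : p <= 1 by apply: le_trans pq; rewrite lerDl.
    have q1 : q <= 1 by apply: le_trans pq; rewrite lerDr.
    rewrite !ger0_norm; [|by rewrite mulr_ge0 ?(ltW (h0 n))..].
    rewrite mulrDr -[leLHS]addr0 lerD ?mulr1 ?(ltW (h0 n))// mulrDr lerD//;
      rewrite ler_wpM2r ?cabs_ge0// ler_piMr ?(ltW (h0 n))//.
  have -> : k z' = k b + (k z' - k b) by rewrite addrC subrK.
  apply: (le_trans (cabsD _ _)); rewrite lerD2l cabs_distC ltW//.
  exact: delP.
apply/eqP; rewrite -cabs_eq0; apply/negPn/negP => e0.
have {}e0 : 0 < cabs (triangle_int k b u v) by rewrite lt_neqAle cabs_ge0 eq_sym e0.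
move: (cabs (triangle_int _ _ _ _)) e0 bound => e e0 bound.
have Q0 : 0 < e / (4 * M * D + 1) by rewrite divr_gt0// ltr_wpDl// !mulr_ge0.
have [n1 H1] := expr_half_lt (divr_gt0 del0 D1).
have [n2 H2] := expr_half_lt Q0.
have hdec n m : h (n + m)%N <= h n.
  by rewrite /h exprD ler_piMr ?exprn_ge0// h1.
have B : h (n1 + n2)%N * (D + 1) < del.
  by rewrite -ltr_pdivlMr//; apply: le_lt_trans H1; exact: hdec.
have := bound _ B; apply/negP; rewrite -ltNge.
have : h (n1 + n2)%N < e / (4 * M * D + 1).
  by apply: le_lt_trans H2; rewrite addnC; exact: hdec.
rewrite ltr_pdivlMr ?ltr_wpDl ?mulr_ge0//; apply: le_lt_trans.
have := ltW (h0 (n1 + n2)%N); move: (h _) => c c0.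
rewrite [leRHS]mulrDr [c * 1]mulr1 (_ : M * (4 * (c * D)) = c * (4 * M * D)); last by ring.
by rewrite lerDl.
Qed.

(** The integral along the radius from [b] is a primitive, because by
[goursat_vertex] its increment from [z] to [w] is the integral over the segment
from [z] to [w]. The exceptional point [b] is there for difference quotients at
[b], whose differentiability at [b] comes later. *)
Lemma ball_primitive k b r :
  (forall z, cabs (z - b) < r -> {for z, continuous k}) ->
  (forall z, cabs (z - b) < r -> z != b -> derivable k z 1) ->
  exists F, forall z, cabs (z - b) < r -> has_cderiv F z (k z).
Proof.
move=> ck dk; exists (fun z => two_pi_i R * cint (segment b z) k) => z zr.
have r0 : 0 < r by apply: le_lt_trans zr; exact: cabs_ge0.
have hullr u v w : cabs u < r -> cabs v < r -> hull b u v w -> cabs (w - b) < r.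
  move=> ur vr [x [y [x0 y0 xy ->]]].
  have -> : b + x%:C * u + y%:C * v - b = x%:C * u + y%:C * v by ring.
  apply: (le_lt_trans (cabsD _ _)); rewrite !cabsM !cabs_real !ger0_norm//.
  have := cabs_ge0 u; have := cabs_ge0 v.
  move: (cabs u) (cabs v) ur vr => U V ur vr V0 U0.
  pose m := Num.max U V.
  have mr : m < r by rewrite /m gt_max ur vr.
  have m0 : 0 <= m by rewrite /m le_max U0.
  apply: (@le_lt_trans _ _ ((x + y) * m)).
    by rewrite mulrDl lerD// ler_wpM2l// /m le_max lexx ?orbT.
  by apply: le_lt_trans mr; rewrite ler_piMl.
have segc w w' : cabs (w - b) < r -> cabs (w' - b) < r ->
    forall p, contour_image (segment w w') p -> cabs (p - b) < r.
  move=> wr wr' p; have hw : hull b (w - b) (w' - b) w.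
    by exists 1, 0; rewrite mul0r mul1r !addr0 [RHS]addrC subrK; split.
  have hw' : hull b (w - b) (w' - b) w'.
    by exists 0, 1; rewrite mul0r mul1r addr0 add0r [RHS]addrC subrK; split.
  by move=> /(hull_segment hw hw'); exact: hullr.
(* If [w] is closer to [z] than [b] is, the side from [z] to [w] avoids [b]. *)
have diff w : cabs (w - b) < r -> (z != b -> cabs (w - z) < cabs (z - b)) ->
    cint (segment b w) k = cint (segment b z) k + cint (segment z w) k.
  move=> wr; have [zb _|zb /(_ isT) wz] := eqVneq z b.
    have b0 : cint (segment b b) k = 0.
      have sc : contour_cont (segment b b) k.
        move=> p /(segc b b) pb; apply: ck; apply: pb; by rewrite subrr cabs0.
      have := segment_rev sc; move: (cint (segment b b) k) => c /eqP.
      by rewrite -subr_eq0 opprK -mulr2n mulrn_eq0 /= => /eqP.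
    by rewrite zb b0 add0r.
  have : triangle_int k b (z - b) (w - b) = 0.
    apply: goursat_vertex.
    - move=> x y x0 y0 xy; apply/eqP => E.
      have : (x + y)%:C * (z - b) = - (y%:C * (w - z)).
        rewrite -[RHS]add0r -E rmorphD /=; ring.
      move=> /(congr1 (@cabs R)); rewrite cabsN !cabsM !cabs_real !ger0_norm// ?ltW//.
      have zb0 : 0 < cabs (z - b) by rewrite cabs_gt0 subr_eq0.
      apply/eqP; rewrite gt_eqF//.
      have [y00|yn0] := eqVneq y 0.
        by move: xy; rewrite y00 => xy; rewrite mul0r mulr_gt0.
      apply: (@lt_le_trans _ _ (y * cabs (z - b))).
        by rewrite ltr_pM2l// lt_neqAle eq_sym yn0.
      by rewrite ler_pM2r// lerDr.
    - by move=> p /hullr pr; apply: ck; exact: pr.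
    - by move=> p /hullr pr; apply: dk; exact: pr.
  have bz : b + (z - b) = z by rewrite addrC subrK.
  have bw : b + (w - b) = w by rewrite addrC subrK.
  rewrite /triangle_int bz bw (@segment_rev _ b w).
    by move=> /eqP; rewrite subr_eq0 => /eqP.
  by move=> p /(segc b w) pb; apply: ck; apply: pb => //; rewrite subrr cabs0.
apply: has_cderiv_estimate => e e0.
have e80 : 0 < e / (4 * pi) by rewrite divr_gt0// mulr_gt0// pi_gt0.
have N1 : \forall w \near z, cabs (k z - k w) < e / (4 * pi).
  exact: ((continuous_cabsP _ _).1 (ck _ zr)).
have [d1 d10 d1P] := (near_cabsP _ _).1 N1.
apply/near_cabsP.
pose d2 := Num.min d1 (Num.min (r - cabs (z - b)) (if z == b then 1 else cabs (z - b))).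
have d20 : 0 < d2.
  rewrite /d2 !lt_min d10 subr_gt0 zr /=; case: eqVneq => // zb.
  by rewrite cabs_gt0 subr_eq0.
exists d2 => // w; rewrite /d2 !lt_min => /and3P[wd1 wd2 wd3].
have wr : cabs (w - b) < r.
  have -> : w - b = (w - z) + (z - b) by ring.
  by rewrite (le_lt_trans (cabsD _ _))// -ltrBrDr.
have zw : z != b -> cabs (w - z) < cabs (z - b).
  by move=> /negbTE zb; move: wd3; rewrite zb.
rewrite (diff _ wr zw).
have sc : contour_cont (segment z w) k.
  by move=> p /(segc z w zr wr); exact: ck.
have kc : cint (segment z w) (fun=> k z) = (w - z) * k z / two_pi_i R.
  rewrite (segment_primitive (F := fun p => p * k z)); last 2 first.
  - exact: contour_cont_cst.
  - move=> t _; exists (cst (k z)); split; [exact: cst_continuous|exact: erefl|].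
    by move=> p /=; ring.
  by rewrite -mulrBl.
have kd : cint (segment z w) (fun p => k p - k z) =
    cint (segment z w) k - (w - z) * k z / two_pi_i R.
  rewrite -kc -[X in _ = _ + X]mulN1r -cintZ -?cintD.
  - by apply: eq_cint => p _; rewrite mulN1r.
  - apply: contour_cont_integrable sc; exact: segment_compact_contour.
  - apply: contour_integrableZ; apply: contour_cont_integrable.
      exact: segment_compact_contour.
    exact: contour_cont_cst.
  - apply: contour_cont_integrable; first exact: segment_compact_contour.
    exact: contour_cont_cst.
have -> : two_pi_i R * (cint (segment b z) k + cint (segment z w) k) -
    two_pi_i R * cint (segment b z) k - (w - z) * k z =
    two_pi_i R * cint (segment z w) (fun p => k p - k z).
  rewrite kd mulrBr [X in _ = _ - X]mulrC divfK ?two_pi_i_neq0//.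
  by move: (cint _ _) (cint _ _) => A B; ring.
rewrite cabsM cabs_two_pi_i.
have := @cint_segment_bound R z w (fun p => k p - k z) (e / (4 * pi)) (ltW e80).
have cd : contour_cont (segment z w) (fun p => k p - k z).
  by apply: contour_contB sc _; exact: contour_cont_cst.
move=> /(_ cd) B.
have {}B : cabs (cint (segment z w) (fun p => k p - k z)) <= e / (4 * pi) * (2 * cabs (w - z)).
  apply: B => t /andP[t0 t1]; rewrite cabs_distC ltW//; apply: d1P.
  rewrite /seg_point addrC addKr cabsM cabs_real ger0_norm//.
  by apply: le_lt_trans wd1; rewrite ler_piMl// cabs_ge0.
have pi0 : 0 < pi :> R by exact: pi_gt0.
apply: (le_trans (ler_wpM2l _ B)); first by rewrite mulr_ge0// ltW.
rewrite le_eqVlt; apply/orP; left; apply/eqP.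
have aux (P c : R) : 0 < P -> 2 * P * (e / (4 * P) * (2 * c)) = e * c.
  by move=> P0; field; rewrite gt_eqF.
exact: aux.
Qed.

End LocalPrimitive.

(** * Cauchy transforms *)

Section CauchyIntegral.
Variable R : realType.
Implicit Types (c : contour R) (f g k phi : R[i] -> R[i]) (r s t x y : R) (a b u v z w : R[i]).

Lemma has_cderiv_near f z d (psi : R[i] -> R[i]) :
  {for z, continuous psi} -> psi z = d ->
  (\forall w \near z, f w = f z + (w - z) * psi w) -> has_cderiv f z d.
Proof.
move=> cpsi psiz H.
exists (fun w => if w == z then d else (f w - f z) / (w - z)).
split; [|by rewrite eqxx|]; last first.
  move=> w; have [->|wz] := eqVneq w z; first by rewrite subrr mul0r addr0.
  by rewrite mulrC divfK ?subr_eq0// addrC subrK.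
apply/continuous_cabsP => e e0; rewrite eqxx.
have := (continuous_cabsP _ _).1 cpsi _ e0; rewrite psiz => H2.
apply: filterS2 H H2 => w fw.
have [->|wz] := eqVneq w z; first by rewrite subrr cabs0.
by rewrite fw [f z + _]addrC addrK mulrC mulKf ?subr_eq0.
Qed.

Lemma continuous_sub z w : {for z, continuous (fun v : R[i] => v - w)}.
Proof. by apply: (@continuousB R[i] R[i] R[i]); [move=> ?|exact: cst_continuous]. Qed.

Lemma continuous_sub_inv z w : z != w -> {for z, continuous (fun v : R[i] => (v - w)^-1)}.
Proof.
move=> zw; apply: (@continuousV R[i] R[i] (fun v => v - w)); last exact: continuous_sub.
by rewrite subr_eq0.
Qed.

Lemma near_neq z w : z != w -> \forall v \near z, v != w.
Proof.
move=> zw; apply/near_cabsP; exists (cabs (w - z)).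
  by rewrite cabs_gt0 subr_eq0 eq_sym.
by move=> v; apply: contraTneq => ->; rewrite ltxx.
Qed.

Lemma has_cderiv_inv_sub z w : z != w ->
  has_cderiv (fun v : R[i] => (v - w)^-1) z (- (z - w)^-2).
Proof.
move=> zw; apply: (@has_cderiv_near _ _ _ (fun v => - (z - w)^-1 * (v - w)^-1)).
- apply: (@continuousM R[i] R[i]); first exact: cst_continuous.
  exact: continuous_sub_inv.
- by rewrite mulNr -invfM expr2.
- apply: filterS (near_neq zw) => v vw.
  have zw0 : z - w != 0 by rewrite subr_eq0.
  have vw0 : v - w != 0 by rewrite subr_eq0.
  by field; rewrite zw0 vw0.
Qed.

Lemma has_cderiv_pow_inv_sub z w n : z != w ->
  has_cderiv (fun v : R[i] => (v - w)^-1 ^+ n.+1) z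
    (- n.+1%:R * (z - w)^-1 ^+ n.+2).
Proof.
move=> zw; apply: is_derive_has_cderiv.
have := has_cderiv_is_derive (has_cderiv_inv_sub zw).
move=> /(@is_deriveX _ _ (fun v => (v - w)^-1) n.+1 z 1 _).
have -> : (fun v : R[i] => (v - w)^-1 ^+ n.+1) = (fun v => (v - w)^-1) ^+ n.+1.
  by apply/funext => v; rewrite exprfctE.
have -> : - n.+1%:R * (z - w)^-1 ^+ n.+2 =
    (n.+1%:R * (z - w)^-1 ^+ n) * - (z - w)^-2 :> R[i].
  by rewrite -exprVn -[in LHS]addn2 exprD mulrN mulNr mulrA.
exact: id.
Qed.

Lemma cabs_continuous (T : topologicalType) (f : T -> R[i]) (x : T) :
  {for x, continuous f} -> {for x, continuous (fun p => cabs (f p))}.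
Proof.
move=> cf; apply: (@continuous_comp _ _ _ (fun p => `|f p|) (@complex.Re R)); last exact: Re_continuous.
by apply: (@continuous_comp _ _ _ f Num.norm); [exact: cf|exact: norm_continuous].
Qed.

Lemma contour_max c (h : R[i] -> R) : compact_contour c ->
  (forall z, contour_image c z -> {for z, continuous h}) ->
  exists2 z, contour_image c z & forall w, contour_image c w -> h w <= h z.
Proof.
move=> [a [b [ab cE]]] ch.
have ad : a \in contour_dom c by rewrite cE in_itv /= lexx ltW.
have bd : b \in contour_dom c by rewrite cE in_itv /= lexx ltW.
have cd : {within `[a, b], continuous (h \o c)}.
  apply: within_continuous_comp; last exact: contour_continuous.
  move=> z; rewrite inE => -[t tab <-]; apply: ch; exists t => //.
  by move: tab; rewrite /= cE.
have [t tab tmax] := EVT_max (ltW ab) cd.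
exists (c t); first by exists t => //; rewrite /= cE.
by move=> _ [s /= sd <-]; apply: tmax; rewrite -cE.
Qed.

Lemma contour_distance c w : compact_contour c -> ~ contour_image c w ->
  exists2 r, 0 < r & forall z, contour_image c z -> r <= cabs (z - w).
Proof.
move=> cc cw.
have cd z : contour_image c z -> {for z, continuous (fun z => - cabs (z - w))}.
  move=> _; apply: (@continuousN R R R[i] (fun z => cabs (z - w))).
  by apply: cabs_continuous; exact: continuous_sub.
have [z cz zmin] := contour_max cc cd.
exists (cabs (z - w)).
  by rewrite cabs_gt0 subr_eq0; apply: contra_notN cw => /eqP <-.
by move=> v /zmin; rewrite lerN2.
Qed.

Lemma contour_cont_bounded c f : compact_contour c -> contour_cont c f ->
  exists2 M, 0 <= M & forall z, contour_image c z -> cabs (f z) <= M.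
Proof.
move=> cc cf.
have cd z : contour_image c z -> {for z, continuous (fun z => cabs (f z))}.
  by move=> cz; apply: cabs_continuous; exact: cf.
have [z _ zmax] := contour_max cc cd.
by exists (cabs (f z)); [exact: cabs_ge0|exact: zmax].
Qed.

Lemma contour_length_ge0 c : 0 <= contour_length c.
Proof. by apply: Rintegral_ge0 => t _; rewrite addr_ge0. Qed.

Definition cauchy_transform c phi w := cint c (fun z => phi z / (z - w)).

Lemma contour_cont_sub_inv c w : ~ contour_image c w ->
  contour_cont c (fun z => (z - w)^-1).
Proof. by move=> cw z cz; apply: continuous_sub_inv; apply: contra_notN cw => /eqP <-. Qed.

(** Expand [(z - v)^-1 = (z - w)^-1 + (v - w) (z - w)^-2 +
(v - w)^2 (z - v)^-1 (z - w)^-2]. For [v] near [w] the last term is at most a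
constant times [`|v - w|^2], uniformly on the contour. *)
Lemma cauchy_transform_deriv c phi w : compact_contour c -> contour_cont c phi ->
  ~ contour_image c w ->
  has_cderiv (cauchy_transform c phi) w (cint c (fun z => phi z * (z - w)^-1 ^+ 2)).
Proof.
move=> cc cphi cw; apply: has_cderiv_estimate => e e0.
have [del del0 delP] := contour_distance cc cw.
have [M M0 phiM] := contour_cont_bounded cc cphi.
pose B := M * ((2 / del) * (del^-1 * del^-1)).
have B0 : 0 <= B by rewrite mulr_ge0// mulr_ge0 ?divr_ge0 ?mulr_ge0 ?invr_ge0 ?(ltW del0).
have L0 := contour_length_ge0 c.
have BL0 : 0 < B * contour_length c + 1 by rewrite ltr_wpDl// mulr_ge0.
pose d := Num.min (del / 2) (e / (B * contour_length c + 1)).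
apply/near_cabsP; exists d; first by rewrite /d lt_min !divr_gt0.
move=> v; rewrite /d lt_min => /andP[vd ve].
have dist z : contour_image c z -> del / 2 <= cabs (z - v).
  move=> /delP dz; have := cabsD (z - v) (v - w).
  have -> : z - v + (v - w) = z - w by ring.
  by move: (cabs (z - v)) (cabs (z - w)) (cabs (v - w)) dz vd => *; lra.
have cv : ~ contour_image c v.
  by move=> /dist; rewrite subrr cabs0 leNgt divr_gt0.
pose f0 z := phi z / (z - w).
pose f1 z := phi z * (z - w)^-1 ^+ 2.
pose f2 z := phi z * ((z - v)^-1 * ((z - w)^-1 * (z - w)^-1)).
have iw := contour_cont_sub_inv cw; have iv := contour_cont_sub_inv cv.
have cf2 : contour_cont c f2.
  exact: contour_contM cphi (contour_contM iv (contour_contM iw iw)).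
have if0 : contour_integrable c f0 := contour_cont_integrable cc (contour_contM cphi iw).
have if1 : contour_integrable c f1 := contour_cont_integrable cc
  (contour_contM cphi (contour_contM iw iw)).
have if2 : contour_integrable c f2 := contour_cont_integrable cc cf2.
have E : cauchy_transform c phi v = cint c f0 +
    ((v - w) * cint c f1 + (v - w) * (v - w) * cint c f2).
  have i1 := contour_integrableZ (v - w) if1.
  have i2 := contour_integrableZ ((v - w) * (v - w)) if2.
  rewrite -cintZ; last exact: if1.
  rewrite -cintZ; last exact: if2.
  rewrite -(cintD i1 i2) -(cintD if0 (contour_integrableD i1 i2)).
  apply: eq_cint => z cz; rewrite /f0 /f1 /f2.
  have zw0 : z - w != 0 by rewrite subr_eq0; apply: contra_notN cw => /eqP <-.
  have zv0 : z - v != 0 by rewrite subr_eq0; apply: contra_notN cv => /eqP <-.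
  by field; rewrite zw0 zv0.
have -> : cauchy_transform c phi v - cauchy_transform c phi w - (v - w) * cint c f1 =
    (v - w) * (v - w) * cint c f2.
  have E0 : cauchy_transform c phi w = cint c f0 := erefl.
  by rewrite E E0; move: (cint c f0) (cint c f1) (cint c f2) => I0 I1 I2; ring.
rewrite 2!cabsM mulrAC ler_wpM2r ?cabs_ge0//.
have f2B z : contour_image c z -> cabs (f2 z) <= B.
  move=> cz; rewrite /f2 /B !cabsM !cabsV.
  have d1 := delP _ cz; have d2 := dist _ cz.
  have del20 : 0 < del / 2 by rewrite divr_gt0.
  apply: ler_pM; [exact: cabs_ge0| |exact: phiM|].
    by rewrite !mulr_ge0 ?invr_ge0 ?cabs_ge0.
  apply: ler_pM; [by rewrite invr_ge0 cabs_ge0|by rewrite mulr_ge0 ?invr_ge0 ?cabs_ge0| |].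
    by rewrite -[2 / del]invrK invf_div lef_pV2 ?posrE// (lt_le_trans del20).
  by apply: ler_pM; rewrite ?invr_ge0 ?cabs_ge0// lef_pV2 ?posrE// (lt_le_trans del0).
have Bf2 := cint_bound cc cf2 f2B.
move: Bf2 ve (cabs_ge0 (v - w)) (cabs_ge0 (cint c f2)).
move: (cabs (cint c f2)) (cabs (v - w)) => I V IB.
rewrite ltr_pdivlMr// => Ve V0 I0.
apply: (le_trans (ler_wpM2l V0 IB)); apply: ltW; apply: le_lt_trans Ve.
by rewrite mulrDr mulr1 lerDl.
Qed.

Lemma cauchy_transform_derivable c phi w : compact_contour c -> contour_cont c phi ->
  ~ contour_image c w -> derivable (cauchy_transform c phi) w 1.
Proof.
by move=> cc cp cw; apply: has_cderiv_derivable (cauchy_transform_deriv cc cp cw).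
Qed.

End CauchyIntegral.

(** * Winding numbers *)

Section DividedDifference.
Variable R : realType.
Implicit Types (c : contour R) (f g k phi : R[i] -> R[i]) (r s t x y : R) (a b u v z w : R[i]).

Lemma zero_derivative_segment f z w :
  (forall p, contour_image (segment z w) p -> has_cderiv f p 0) -> f z = f w.
Proof.
move=> df; have := @segment_primitive R z w (fun=> 0) f (@contour_cont_cst R _ 0).
rewrite cint0 => /(_ _)/esym H.
have {}H : (f w - f z) / two_pi_i R = 0.
  by apply: H => t t01; apply: df; apply/segment_imageP; exists t.
move/eqP: H; rewrite mulf_eq0 invr_eq0 (negbTE (two_pi_i_neq0 R)) orbF subr_eq0.
by move=> /eqP.
Qed.

Lemma cint_closed_primitive c f F (a b : R) : a < b -> contour_dom c = `[a, b] ->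
  c a = c b -> contour_cont c f ->
  (forall z, contour_image c z -> has_cderiv F z (f z)) -> cint c f = 0.
Proof.
move=> ab cE cab cf dF; rewrite (cint_primitive ab cE cf dF) cab subrr mul0r.
exact: erefl.
Qed.

Definition winding c w := cint c (fun z => (z - w)^-1).

Definition loop c := exists a b : R, [/\ a < b, contour_dom c = `[a, b] & c a = c b].

Lemma loop_compact c : loop c -> compact_contour c.
Proof. by move=> [a [b [ab cE _]]]; exists a, b. Qed.

Lemma simple_closed_loop c : simple_closed c -> loop c.
Proof. by move=> [a [b [ab cE cab _]]]; exists a, b. Qed.

(** Powers of [(z - w)^-1] other than the first have a primitive. *)
Lemma cint_pow_inv_sub c w n : loop c -> ~ contour_image c w ->
  cint c (fun z => (z - w)^-1 ^+ n.+2) = 0.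
Proof.
move=> [a [b [ab cE cab]]] cw.
have n0 : - n.+1%:R != 0 :> R[i] by rewrite oppr_eq0 pnatr_eq0.
have iw := contour_cont_sub_inv cw.
have cpow m : contour_cont c (fun z => (z - w)^-1 ^+ m).
  elim: m => [|m IH]; first exact: contour_cont_cst.
  by apply: eq_contour_cont (contour_contM iw IH) => z; rewrite exprS.
have cl : loop c by exists a, b.
have := contour_integrableZ (- n.+1%:R) (contour_cont_integrable (loop_compact cl) (cpow n.+2)).
move=> ?; have H : cint c (fun z => - n.+1%:R * (z - w)^-1 ^+ n.+2) = 0.
  apply: (cint_closed_primitive (F := fun z => (z - w)^-1 ^+ n.+1) ab cE cab).
    exact: contour_contM (@contour_cont_cst R c _) (cpow n.+2).
  move=> z cz; apply: has_cderiv_pow_inv_sub.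
  by apply: contra_notN cw => /eqP <-.
have := cintZ (- n.+1%:R) (contour_cont_integrable (loop_compact cl) (cpow n.+2)).
by rewrite H => /esym/eqP; rewrite mulf_eq0 (negbTE n0) => /eqP.
Qed.

(** Winding numbers are locally constant: their derivative is the integral of
[(z - w)^-2]. *)
Lemma winding_cderiv c w : loop c -> ~ contour_image c w ->
  has_cderiv (winding c) w 0.
Proof.
move=> lc cw; have cc := loop_compact lc.
have := cauchy_transform_deriv cc (@contour_cont_cst R c 1) cw.
have -> : cauchy_transform c (fun=> 1) = winding c.
  by apply/funext => v; apply: eq_cint => z _; rewrite mul1r.
have -> // : cint c (fun z => 1 * (z - w)^-1 ^+ 2) = 0.
rewrite -[RHS](cint_pow_inv_sub 0 lc cw).
by apply: eq_cint => z _; rewrite mul1r.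
Qed.

Lemma winding_segment c z w : loop c ->
  (forall p, contour_image (segment z w) p -> ~ contour_image c p) ->
  winding c z = winding c w.
Proof. by move=> lc H; apply: zero_derivative_segment => p /H; exact: winding_cderiv. Qed.

(** * Circles *)

Definition circle_point b r t : R[i] :=
  (complex.Re b + cos t * r) +i* (complex.Im b + sin t * r).

Lemma is_derive_cos_affine (a r t : R) :
  is_derive t (1 : R) (fun t => a + cos t * r) (- (r * sin t)).
Proof.
rewrite -mulrN; exact: (@is_derive1_comp R (fun s => a + s * r) (@cos R) t _ _
  (is_derive_affine _ _ _) (is_derive_cos t)).
Qed.

Lemma is_derive_sin_affine (a r t : R) :
  is_derive t (1 : R) (fun t => a + sin t * r) (r * cos t).
Proof.
exact: (@is_derive1_comp R (fun s => a + s * r) (@sin R) t _ _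
  (is_derive_affine _ _ _) (is_derive_sin t)).
Qed.

Lemma C1_cos_affine (a r : R) : C1 (fun t => a + cos t * r).
Proof.
split; first by move=> t; have [] := is_derive_cos_affine a r t.
have -> : derive1 (fun t => a + cos t * r) = fun t => - (r * sin t).
  by apply/funext => t; rewrite derive1E; have [_ ->] := is_derive_cos_affine a r t.
move=> t; apply: (@continuousN R R R (fun t => r * sin t)).
apply: (@continuousM R R (cst r) (@sin R)); first exact: cst_continuous.
exact: continuous_sin.
Qed.

Lemma C1_sin_affine (a r : R) : C1 (fun t => a + sin t * r).
Proof.
split; first by move=> t; have [] := is_derive_sin_affine a r t.
have -> : derive1 (fun t => a + sin t * r) = fun t => r * cos t.
  by apply/funext => t; rewrite derive1E; have [_ ->] := is_derive_sin_affine a r t.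
move=> t; apply: (@continuousM R R (cst r) (@cos R)); first exact: cst_continuous.
exact: continuous_cos.
Qed.

Fact circle_piecewise_C1 b r : piecewise_C1 `[0%R, 2 * pi] (circle_point b r).
Proof.
move=> x y _ _ xy; exists [:: y]; first exact: itv_partition1.
move=> k _; exists (fun t => complex.Re b + cos t * r),
  (fun t => complex.Im b + sin t * r).
by split; [exact: C1_cos_affine|exact: C1_sin_affine|move=> t _; exact: erefl].
Qed.

Definition circle b r : contour R := Contour (@circle_piecewise_C1 b r).

Lemma circle_point_sub b r t : circle_point b r t - b = r%:C * (cos t +i* sin t).
Proof.
by apply: complex_eqP; rewrite ?ReD ?ImD ?ReM ?ImM ?ReN ?ImN /=; ring.
Qed.

Lemma cabs_circle b r t : 0 <= r -> cabs (circle_point b r t - b) = r.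
Proof.
move=> r0; rewrite circle_point_sub cabsM cabs_real ger0_norm//.
by rewrite /cabs normc_def /= cos2Dsin2 sqrtr1 mulr1.
Qed.

Lemma circle_velocity b r t :
  velocity (circle b r) t = (- (r * sin t)) +i* (r * cos t).
Proof.
rewrite /velocity /= !derive1E; congr (_ +i* _).
  by have [_ ->] := is_derive_cos_affine (complex.Re b) r t.
by have [_ ->] := is_derive_sin_affine (complex.Im b) r t.
Qed.

Lemma two_pi_gt0 : 0 < 2 * pi :> R.
Proof. by rewrite mulr_gt0// pi_gt0. Qed.

Lemma circle_loop b r : loop (circle b r).
Proof.
exists 0, (2 * pi); split; [exact: two_pi_gt0|exact: erefl|].
by rewrite /= /circle_point mulr_natl cos0 sin0 cos2pi sin2pi.
Qed.

Lemma winding_circle_center b r : 0 < r -> winding (circle b r) b = 1.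
Proof.
move=> r0; rewrite /winding cintE /=.
have E t : cintegrand (circle b r) (fun z => (z - b)^-1) t = 'i%C.
  rewrite /cintegrand circle_velocity /= circle_point_sub.
  have -> : (- (r * sin t)) +i* (r * cos t) = 'i%C * (r%:C * (cos t +i* sin t)).
    by apply: complex_eqP; rewrite ?ReM ?ImM /=; ring.
  rewrite mulrCA mulVf ?mulr1// mulf_neq0//.
    by rewrite -cabs_gt0 cabs_real normr_gt0 gt_eqF.
  by rewrite -cabs_gt0 /cabs normc_def /= cos2Dsin2 sqrtr1.
have -> : cintegral `[0, 2 * pi] (cintegrand (circle b r) (fun z => (z - b)^-1)) =
    two_pi_i R.
  rewrite (eq_cintegral (h := fun=> 'i%C)); last by move=> t _; exact: E.
  rewrite /cintegral /= !Rintegral_cst; try exact: measurable_itv.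
  rewrite /= lebesgue_measure_itv /= lte_fin two_pi_gt0 oppr0 adde0 /= mul0r mul1r.
  rewrite /two_pi_i -complexiE.
  by apply: complex_eqP; rewrite ?ReM ?ImM /=; ring.
by rewrite divff// two_pi_i_neq0.
Qed.

Lemma circle_imageP b r z : 0 <= r -> contour_image (circle b r) z -> cabs (z - b) = r.
Proof. by move=> r0 [t _ <-]; exact: cabs_circle. Qed.

Lemma winding_circle b r w : 0 < r -> cabs (w - b) < r -> winding (circle b r) w = 1.
Proof.
move=> r0 wr; rewrite -(winding_circle_center b r0).
apply/esym/winding_segment; first exact: circle_loop.
move=> _ /segment_imageP[t /andP[t0 t1] ->] /(circle_imageP (ltW r0)).
rewrite /seg_point addrC addKr cabsM cabs_real ger0_norm// => E.
by move: wr; rewrite -E ltNge ler_piMl// cabs_ge0.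
Qed.

(** The value [d] at [b] is left free: it is a derivative in
[cauchy_formula_circle] and a Cauchy integral in [divided_difference]. *)
Definition quotient_at f b d w : R[i] := if w == b then d else (f w - f b) / (w - b).

Lemma quotient_atE f b d w : f w = f b + (w - b) * quotient_at f b d w.
Proof.
rewrite /quotient_at; have [->|wb] := eqVneq w b; first by rewrite subrr mul0r addr0.
by rewrite mulrC divfK ?subr_eq0// addrC subrK.
Qed.

Lemma quotient_at_derivable f b d w : w != b -> derivable f w 1 ->
  derivable (quotient_at f b d) w 1.
Proof.
move=> wb df.
have H : derivable (fun w => (f w - f b) * (w - b)^-1) w 1.
  apply: (@derivableM R[i] R[i]).
    by apply: (@derivableB R[i] R[i] R[i]); [exact: df|exact: derivable_cst].
  exact: has_cderiv_derivable (has_cderiv_inv_sub wb).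
apply: near_eq_derivable H; apply: filterS (near_neq wb) => v vb.
by rewrite /quotient_at (negbTE vb).
Qed.

(** The quotient of [f] at [w] is continuous, and differentiable off [w], so
[ball_primitive] at [w] makes its integral vanish, and the integral of
[(z - w)^-1] is a winding number. The disc of radius [3 * r] about [w] contains
the circle and is contained in the disc of radius [4 * r] about [b]. *)
Lemma cauchy_formula_circle f b r w :
  (forall z, cabs (z - b) < 4 * r -> derivable f z 1) -> cabs (w - b) < r ->
  f w = cauchy_transform (circle b r) f w.
Proof.
move=> df wr; have r0 : 0 < r by apply: le_lt_trans wr; exact: cabs_ge0.
have wb4 : cabs (w - b) < 4 * r by apply: (lt_le_trans wr); lra.
have [d [psi [cpsi psiw fE]]] := derivable_has_cderiv (df _ wb4).
have ball4 z : cabs (z - w) < 3 * r -> cabs (z - b) < 4 * r.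
  move=> zw; have -> : z - b = (z - w) + (w - b) by ring.
  apply: (le_lt_trans (cabsD _ _)).
  by move: (cabs _) (cabs _) zw wr => p q p3 q1; lra.
pose k := quotient_at f w d.
have kd z : cabs (z - w) < 3 * r -> z != w -> derivable k z 1.
  by move=> /ball4 zb zw; apply: quotient_at_derivable zw (df _ zb).
have kc z : cabs (z - w) < 3 * r -> {for z, continuous k}.
  move=> zw; have [->|zw'] := eqVneq z w; last exact: derivable_continuous (kd _ zw zw').
  have -> : k = psi.
    apply/funext => v; rewrite /k /quotient_at; have [->//|vw] := eqVneq v w.
    by rewrite fE [f w + _]addrC addrK mulrC mulKf// subr_eq0.
  exact: cpsi.
have [F FP] := ball_primitive kc kd.
have [x [y [xy cE cxy]]] := circle_loop b r.
have img z : contour_image (circle b r) z -> cabs (z - w) < 3 * r.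
  move=> /(circle_imageP (ltW r0)) zr.
  have -> : z - w = (z - b) - (w - b) by ring.
  apply: (le_lt_trans (cabsD _ _)); rewrite cabsN zr.
  by move: (cabs _) wr => p p1; lra.
have notin : ~ contour_image (circle b r) w.
  by move=> /(circle_imageP (ltW r0)) E; move: wr; rewrite E ltxx.
have cc := loop_compact (circle_loop b r).
have ck : contour_cont (circle b r) k by move=> z /img; exact: kc.
have ci := contour_cont_sub_inv notin.
(* Splitting off [f w] leaves the quotient [k], which has a primitive. *)
have k0 : cint (circle b r) k = 0.
  by apply: (cint_closed_primitive (F := F) xy cE cxy ck) => z /img; exact: FP.
have E : cauchy_transform (circle b r) f w =
    cint (circle b r) k + f w * winding (circle b r) w.
  rewrite -cintZ; last exact: contour_cont_integrable cc ci.
  rewrite -cintD; last 2 first.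
  - exact: contour_cont_integrable cc ck.
  - exact: contour_integrableZ (contour_cont_integrable cc ci).
  apply: eq_cint => z cz.
  have zw : z != w by apply: contra_notN notin => /eqP <-.
  by rewrite /k /quotient_at (negbTE zw) -mulrDl subrK.
by rewrite E k0 add0r winding_circle// mulr1.
Qed.

(** Removable singularity: near [b], Cauchy's formula exhibits the quotient of [f]
at [b] as the Cauchy transform of [f z / (z - b)], which is differentiable
at [b] as well. *)
Lemma divided_difference (Omega : set R[i]) f b : open Omega -> Omega b ->
  analytic_on Omega f ->
  exists2 g, analytic_on Omega g & forall w, f w = f b + (w - b) * g w.
Proof.
move=> oO Ob fO.
have [r' r'0 r'P] := (near_cabsP _ _).1 (open_nbhs_nbhs (conj oO Ob)).
pose r := r' / 4; have r0 : 0 < r by rewrite divr_gt0.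
have rP z : cabs (z - b) < 4 * r -> Omega z.
  by rewrite /r mulrC divfK ?pnatr_eq0//; exact: r'P.
have df z : cabs (z - b) < 4 * r -> derivable f z 1 by move=> /rP; exact: fO.
pose phi z := f z / (z - b).
pose d := cauchy_transform (circle b r) phi b.
exists (quotient_at f b d); last by move=> w; exact: quotient_atE.
move=> w Ow; have [->|wb] := eqVneq w b; last exact: quotient_at_derivable wb (fO _ Ow).
have cc := loop_compact (circle_loop b r).
have img z : contour_image (circle b r) z -> cabs (z - b) < 4 * r.
  move=> /(circle_imageP (ltW r0)) ->.
  by rewrite ltr_pMl// ltr1n.
have cf : contour_cont (circle b r) f.
  by move=> z /img/df; exact: derivable_continuous.
have notin v : cabs (v - b) < r -> ~ contour_image (circle b r) v.
  by move=> vr /(circle_imageP (ltW r0)) E; move: vr; rewrite E ltxx.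
have bb : cabs (b - b) < r by rewrite subrr cabs0.
have ib := contour_cont_sub_inv (notin _ bb).
have cphi : contour_cont (circle b r) phi := contour_contM cf ib.
have := cauchy_transform_derivable cc cphi (notin _ bb).
apply: near_eq_derivable; apply/near_cabsP; exists r => // v vr.
rewrite /quotient_at; have [->//|vb] := eqVneq v b.
have iv := contour_cont_sub_inv (notin _ vr).
rewrite (cauchy_formula_circle df vr) (cauchy_formula_circle df bb).
apply: (mulIf (x := v - b)); first by rewrite subr_eq0.
rewrite divfK ?subr_eq0//.
have iphi := contour_cont_integrable cc (contour_contM cphi iv).
rewrite mulrC -(cintZ _ iphi).
have i1 := contour_cont_integrable cc (contour_contM cf ib).
rewrite -[X in _ = _ - X]opprK opprK -[X in _ = _ - X]mul1r -mulNr -(cintZ _ i1).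
rewrite -cintD; last 2 first.
- exact: contour_cont_integrable cc (contour_contM cf iv).
- exact: contour_integrableZ.
apply: eq_cint => z cz.
have zb0 : z - b != 0.
  by rewrite subr_eq0; apply/eqP => E; apply: (notin _ bb); rewrite -{2}E.
have zv0 : z - v != 0.
  by rewrite subr_eq0; apply/eqP => E; apply: (notin _ vr); rewrite -E.
by rewrite /phi; field; rewrite zb0 zv0.
Qed.

End DividedDifference.

(** * Winding numbers of nested loops *)

Section GlobalCauchy.
Variable R : realType.
Implicit Types (c : contour R) (f g k phi : R[i] -> R[i]) (r s t x y : R) (u v z w : R[i]).

(** Along [c'] the function [winding c] is a primitive of [0]. *)
Lemma winding_along c c' z w : loop c -> compact_contour c' ->
  (forall p, contour_image c' p -> ~ contour_image c p) ->
  contour_image c' z -> contour_image c' w -> winding c z = winding c w.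
Proof.
move=> lc [a [b [ab cE]]] dis.
have ad : a \in contour_dom c' by rewrite cE in_itv /= lexx ltW.
suff H t : t \in contour_dom c' -> winding c (c' t) = winding c (c' a).
  by move=> [t td <-] [s sd <-]; rewrite !H.
move=> td; have := td; rewrite cE in_itv /= => /andP[].
rewrite le_eqVlt => /predU1P[<-//|at0 tb].
have cf0 : contour_cont c' (fun=> 0) by exact: contour_cont_cst.
have cint0 : cintegral `[a, t] (cintegrand c' (fun=> 0)) = 0 - 0.
  apply: (contour_FTC (F := fun=> 0) ad td at0 (contour_cont_within ad td at0 cf0)) => s _.
  exists (fun=> 0); split; [exact: cst_continuous|exact: erefl|].
  by move=> w'; rewrite mulr0 addr0.
have := contour_FTC (F := winding c) ad td at0 (contour_cont_within ad td at0 cf0).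
rewrite cint0 subrr => H; apply/eqP; rewrite -subr_eq0 -H// => s sat.
apply: winding_cderiv lc (dis _ _); exists s => //=; rewrite cE in_itv /=.
by case/andP: sat => -> /le_trans ->.
Qed.

Lemma Re_le_cabs z : `|complex.Re z| <= cabs z.
Proof. by rewrite -lecR -cabsE; exact: norm_Re_le. Qed.

(** The horizontal ray from [z] to the right avoids [c]; the winding number is
constant on it and tends to [0] at infinity. *)
Lemma winding_ray c z : loop c ->
  (forall p, contour_image c p -> complex.Re p <= complex.Re z) ->
  ~ contour_image c z -> winding c z = 0.
Proof.
move=> lc cz nz.
have off t : 0 <= t -> ~ contour_image c (z + t%:C).
  rewrite le_eqVlt => /predU1P[<-|t0]; first by rewrite addr0.
  by move=> /cz; rewrite ReD /= gerDl leNgt t0.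
have E t : 0 <= t -> winding c z = winding c (z + t%:C).
  move=> t0; apply: winding_segment lc _ => _ /segment_imageP[s /andP[s0 s1] ->].
  have -> : seg_point z (z + t%:C) s = z + (s * t)%:C.
    by rewrite /seg_point rmorphM /=; ring.
  by apply: off; exact: mulr_ge0.
have cc := loop_compact lc.
have B t : 0 < t -> cabs (winding c z) <= t^-1 * contour_length c.
  move=> t0; rewrite (E t (ltW t0)); apply: cint_bound cc _ _.
    exact: contour_cont_sub_inv (off _ (ltW t0)).
  move=> p cp; have pt : t <= cabs (p - (z + t%:C)).
    rewrite (le_trans _ (Re_le_cabs _))// -normrN.
    rewrite (le_trans _ (ler_norm _))// -ReN opprB !ReD ReN /=.
    by have := cz _ cp; lra.
  by rewrite cabsV lef_pV2 ?posrE// (lt_le_trans t0).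
apply/eqP; rewrite -cabs_eq0; apply/negPn/negP => e0.
have {}e0 : 0 < cabs (winding c z) by rewrite lt_neqAle cabs_ge0 eq_sym e0.
move: (cabs (winding c z)) e0 B => e e0 B.
have L0 := contour_length_ge0 c.
have t0 : 0 < contour_length c / e + 1 by rewrite ltr_wpDl// divr_ge0// ltW.
have := B _ t0; rewrite mulrC ler_pdivlMr// mulrDr mulr1 mulrCA divff ?gt_eqF// mulr1.
by rewrite gerDl leNgt e0.
Qed.

(** The ray from [z] to the right is connected, unbounded, and avoids [c]. *)
Lemma ray_not_enclosed c z :
  (forall p, contour_image c p -> complex.Re p <= complex.Re z) ->
  ~ encloses c z.
Proof.
move=> cz [nz bd].
pose ray := (fun t : R => z + t%:C) @` [set t | 0 <= t].
have cr : connected ray.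
  apply: connected_continuous_connected.
    apply/connected_intervalP => x y x0 y0 t /andP[xt _].
    exact: le_trans xt.
  apply: continuous_subspaceT => t.
  apply: (@continuousD R[i] R[i] R); first exact: cst_continuous.
  exact: real_complex_continuous.
have sub : ray `<=` ~` contour_image c.
  move=> _ [t /= t0 <-]; move: t0; rewrite le_eqVlt => /predU1P[<-|t0].
    by rewrite addr0.
  by move=> /cz; rewrite ReD /= gerDl leNgt t0.
have rz : ray z by exists 0; rewrite /= ?addr0.
have := connected_component_max rz sub cr => rc.
have [M M0 /= MP] := ex_strict_bound_gt0 bd.
have [m m0 Mm] := gt0_complex M0.
have t0 : 0 <= m + cabs z by rewrite addr_ge0 ?cabs_ge0// ltW.
have /MP /= : connected_component (~` contour_image c) z (z + (m + cabs z)%:C).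
  by apply: rc; exists (m + cabs z).
rewrite Mm cabsE ltcR ltNge => /negP; apply.
have := cabsD (z + (m + cabs z)%:C) (- z); rewrite addrC addKr cabs_real cabsN.
by rewrite ger0_norm// lerD2r.
Qed.

(** The winding number about [c'] is the same at all points of [c]; take the point
[z] of [c] with the largest real part. No point of [c'] has a larger real part,
because the one with the largest real part would not be enclosed by [c]. Hence
a ray from [z] avoids [c']. *)
Lemma nested_winding c c' w : loop c -> loop c' ->
  contour_image c' `<=` encloses c -> contour_image c w ->
  ~ contour_image c' w /\ winding c' w = 0.
Proof.
move=> lc lc' sub cw.
have dis p : contour_image c p -> ~ contour_image c' p.
  by move=> cp /sub[].
split; first exact: dis.
have Rec z : contour_image c z -> {for z, continuous (@complex.Re R)} by move=> _; exact: Re_continuous.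
have Rec' z : contour_image c' z -> {for z, continuous (@complex.Re R)} by move=> _; exact: Re_continuous.
have [z cz zmax] := contour_max (loop_compact lc) Rec.
have [z' cz' zmax'] := contour_max (loop_compact lc') Rec'.
rewrite (winding_along lc' (loop_compact lc) dis cw cz).
apply: winding_ray lc' _ (dis _ cz) => p cp.
rewrite (le_trans (zmax' _ cp))// leNgt; apply/negP => zz'.
have := sub _ cz'; apply: ray_not_enclosed => q cq.
by rewrite (le_trans (zmax _ cq))// ltW.
Qed.

(** * Cauchy's theorem in a simply connected domain *)

(** A Lebesgue number for the covering of the square by the preimages of the discs
contained in [Omega]. *)
Lemma compact_ball_cover (Omega : set R[i]) (h : R * R -> R[i]) :
  open Omega -> {within `[0, 1] `*` `[0, 1], continuous h} ->
  h @` (`[0, 1] `*` `[0, 1]) `<=` Omega ->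
  exists N : nat, forall p, (`[0, 1] `*` `[0, 1]) p ->
    exists2 r, forall z, cabs (z - h p) < r -> Omega z &
      forall q, (`[0, 1] `*` `[0, 1]) q ->
      `|p.1 - q.1| <= N.+1%:R^-1 -> `|p.2 - q.2| <= N.+1%:R^-1 ->
      cabs (h q - h p) < r.
Proof.
move=> oO ch hO; set S := (X in {within X, continuous h}) in ch hO *.
have cS : compact S by apply: compact_setX; exact: segment_compact.
pose P (N : nat) (p : R * R) := S p ->
  exists2 r, forall z, cabs (z - h p) < r -> Omega z &
    forall q, S q ->
    `|p.1 - q.1| <= N.+1%:R^-1 -> `|p.2 - q.2| <= N.+1%:R^-1 ->
    cabs (h q - h p) < r.
suff [N _ NP] : \forall N \near \oo, S `<=` P N.
  by exists N => p Sp; apply: (NP N (leqnn N)).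
apply: ((compact_near_coveringP _).1 cS) => x Sx.
have [r r0 rP] := (near_cabsP _ _).1 (open_nbhs_nbhs (conj oO (hO _ (imageP _ Sx)))).
have r40 : 0 < r / 4 by rewrite divr_gt0.
have hx : \forall y \near x, S y -> `|h x - h y| < (r / 4)%:C.
  have := (subspace_continuousP _ h).1 ch _ Sx.
  move=> /(@cvgrPdist_lt R[i] R[i] (R * R)%type _ _)/(_ (r / 4)%:C).
  by rewrite ltcR => /(_ r40); rewrite near_withinE.
have [d d0 dP] := (@nbhs_ballP R (R * R)%type x _).1 hx.
have d20 : 0 < d / 2 by rewrite divr_gt0.
have close (m : R * R) : ball x d m -> S m -> cabs (h m - h x) < r / 4.
  by move=> /dP/[apply]; rewrite cabsE ltcR cabs_distC.
exists (ball x (d / 2), [set N | N.+1%:R^-1 < d / 2]) => /=.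
  split; first exact: (@nbhsx_ballx R (R * R)%type).
  exact: (near_infty_natSinv_lt (PosNum d20)).
move=> [y N] [/= yx Nd] Sy.
have yx' : ball x d y by apply: le_ball yx; rewrite ler_pdivrMr// ler_pMr// ler1n.
have hy := close _ yx' Sy.
exists (r / 2).
  move=> z zy; apply: rP; have -> : z - h x = (z - h y) + (h y - h x) by ring.
  apply: (le_lt_trans (cabsD _ _)).
  by move: (cabs _) (cabs _) zy hy => A B; lra.
move=> q Sq q1 q2.
have qx : ball x d q.
  have hd : d = d / 2 + d / 2 by exact: splitr.
  rewrite hd; apply: ball_triangle yx _; split; rewrite /ball /=.
    exact: le_lt_trans q1 Nd.
  exact: le_lt_trans q2 Nd.
have hq := close _ qx Sq.
have -> : h q - h y = (h q - h x) - (h y - h x) by ring.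
apply: (le_lt_trans (cabsD _ _)); rewrite cabsN.
by move: (cabs _) (cabs _) hq hy => A B; lra.
Qed.

(** Normalized so that a primitive [F] of [f] gives [F w - F z]. *)
Definition path_int f z w := two_pi_i R * cint (segment z w) f.

Lemma ball_path_int (Omega : set R[i]) f z r : analytic_on Omega f ->
  (forall w, cabs (w - z) < r -> Omega w) ->
  exists F, (forall w, cabs (w - z) < r -> has_cderiv F w (f w)) /\
    forall v w, cabs (v - z) < r -> cabs (w - z) < r ->
      path_int f v w = F w - F v.
Proof.
move=> fO zO.
have df w : cabs (w - z) < r -> derivable f w 1 by move=> /zO; exact: fO.
have [F FP] := @ball_primitive R f z r (fun w wr => derivable_continuous (df w wr))
  (fun w wr _ => df w wr).
exists F; split => // v w vr wr.
have seg t : 0 <= t <= 1 -> cabs (seg_point v w t - z) < r.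
  move=> /andP[t0 t1]; rewrite /seg_point.
  have -> : v + t%:C * (w - v) - z = (1 - t)%:C * (v - z) + t%:C * (w - z).
    by rewrite rmorphB /=; ring.
  apply: (le_lt_trans (cabsD _ _)); rewrite !cabsM !cabs_real !ger0_norm ?subr_ge0//.
  move: (cabs (v - z)) (cabs (w - z)) vr wr => V W Vr Wr.
  have [->|tn0] := eqVneq t 0; first by rewrite mul0r subr0 mul1r addr0.
  have tp : 0 < t by rewrite lt_neqAle eq_sym tn0.
  have h1 : (1 - t) * V <= (1 - t) * r by rewrite ler_wpM2l ?subr_ge0// ltW.
  have h2 : t * W < t * r by rewrite ltr_pM2l.
  by rewrite (lt_le_trans (ler_ltD h1 h2))// -mulrDl subrK mul1r.
rewrite /path_int (segment_primitive (F := F)).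
- by rewrite mulrC divfK// two_pi_i_neq0.
- move=> _ /segment_imageP[t t01 ->]; apply: derivable_continuous; apply: df; exact: seg.
- by move=> t t01; apply: FP; exact: seg.
Qed.

(** Subdivide the unit square so finely that the homotopy maps each cell into a disc
of [Omega], where [f] has a primitive. The sum over the [j]-th row of the
integrals of [f] along the segments between images of grid points does not
depend on [j], because the left and right sides of the square go to the base
point. The bottom row gives the integral over [c], and the top row is constant. *)
Theorem cauchy_simply_connected (Omega : set R[i]) f c : open Omega ->
  simply_connected Omega -> loop c -> contour_image c `<=` Omega ->
  analytic_on Omega f -> cint c f = 0.
Proof.
move=> oO [_ sc] [a [b [ab cE cab]]] cO fO.
have ad : a \in contour_dom c by rewrite cE in_itv /= lexx ltW.
have bd : b \in contour_dom c by rewrite cE in_itv /= lexx ltW.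
pose phi t := a + t * (b - a).
have phi_in t : 0 <= t <= 1 -> phi t \in contour_dom c.
  move=> /andP[t0 t1]; rewrite cE in_itv /= /phi.
  have ba : 0 <= b - a by rewrite subr_ge0 ltW.
  by rewrite lerDl mulr_ge0//= -lerBrDl ler_piMl.
have cphi : continuous phi by apply: C1_continuous; exact: C1_affine.
have ccont : {within `[0, 1], continuous (c \o phi)}.
  apply: within_comp (continuous_subspaceT cphi) _ (contour_continuous ad bd ab) => t.
  by rewrite -cE /= in_itv /=; exact: phi_in.
have cim t : 0 <= t <= 1 -> contour_image c (c (phi t)).
  by move=> /phi_in tb; exists (phi t).
have ba : 0 < b - a by rewrite subr_gt0.
have phi_lt s t : s < t -> phi s < phi t by rewrite /phi ltrD2l ltr_pM2r.
have phi_inv t : phi ((t - a) / (b - a)) = t.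
  by rewrite /phi divfK ?gt_eqF// addrC subrK.
have phi_le_inv s t s' : phi s <= t -> t <= phi s' ->
    s <= (t - a) / (b - a) /\ (t - a) / (b - a) <= s'.
  by rewrite /phi ler_pdivlMr// ler_pdivrMr// lerBrDl lerBlDl.
have phi0 : phi 0 = a by rewrite /phi mul0r addr0.
have phi1 : phi 1 = b by rewrite /phi mul1r addrC subrK.
have [||h [ch hO h0 h1 hs]] := sc (c \o phi) ccont.
- by move=> _ [t /= t01 <-]; apply: cO; apply: cim; move: t01; rewrite in_itv.
- by rewrite /= phi0 phi1.
have [N NP] := compact_ball_cover oO ch hO.
pose g (i : nat) : R := i%:R / N.+1%:R.
have g01 i : (i <= N.+1)%N -> 0 <= g i <= 1.
  by move=> iN; rewrite divr_ge0//= ler_pdivrMr// mul1r ler_nat.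
have gS i : g i.+1 = g i + N.+1%:R^-1 by rewrite /g -natr1 mulrDl mul1r.
have N0 : 0 < N.+1%:R^-1 :> R by rewrite invr_gt0.
have dist_le s i : g i <= s -> s <= g i.+1 -> `|g i - s| <= N.+1%:R^-1.
  by move=> s1 s2; rewrite distrC ger0_norm ?subr_ge0// lerBlDl -gS.
have g_lt i : g i < g i.+1 by rewrite gS ltrDl.
pose z i j := h (g i, g j).
have inS t s : 0 <= t <= 1 -> 0 <= s <= 1 -> (`[0, 1] `*` `[0, 1])%classic (t, s).
  by move=> t01 s01; split; rewrite /= in_itv.
have d1 i : `|g i - g i.+1| <= N.+1%:R^-1.
  by rewrite gS opprD addrA subrr sub0r normrN ger0_norm// ltW.
have d0 i : `|g i - g i| <= N.+1%:R^-1 by rewrite subrr normr0 ltW.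
(* Both paths around a cell compute the same increment of a primitive. *)
have cell i j : (i < N.+1)%N -> (j < N.+1)%N ->
  path_int f (z i j) (z i.+1 j) + path_int f (z i.+1 j) (z i.+1 j.+1) =
  path_int f (z i j.+1) (z i.+1 j.+1) + path_int f (z i j) (z i j.+1).
  move=> iN jN; have [i1 j1] := (ltnW iN, ltnW jN).
  have Sp := inS _ _ (g01 _ i1) (g01 _ j1).
  have [r B q] := NP _ Sp; have [F [_ FP]] := ball_path_int fO B.
  have p0 : cabs (z i j - z i j) < r := q _ Sp (d0 i) (d0 j).
  have p1 : cabs (z i.+1 j - z i j) < r := q _ (inS _ _ (g01 _ iN) (g01 _ j1)) (d1 i) (d0 j).
  have p2 : cabs (z i.+1 j.+1 - z i j) < r := q _ (inS _ _ (g01 _ iN) (g01 _ jN)) (d1 i) (d1 j).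
  have p3 : cabs (z i j.+1 - z i j) < r := q _ (inS _ _ (g01 _ i1) (g01 _ jN)) (d0 i) (d1 j).
  rewrite (FP _ _ p0 p1) (FP _ _ p1 p2) (FP _ _ p3 p2) (FP _ _ p0 p3).
  by move: (F _) (F _) (F _) (F _) => F0 F1 F2 F3; ring.
pose A j := \sum_(i < N.+1) path_int f (z i j) (z i.+1 j).
have gN : g N.+1 = 1 by rewrite /g divff// pnatr_eq0.
have g0 : g 0%N = 0 by rewrite /g mul0r.
have zl j : (j <= N.+1)%N -> z 0%N j = c a /\ z N.+1 j = c a.
  move=> jN; have gj : g j \in `[0, 1] by rewrite in_itv /= g01.
  by rewrite /z g0 gN; have [-> ->] := hs _ gj; rewrite /= phi0.
have row j : (j < N.+1)%N -> A j = A j.+1.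
  move=> jN; apply/eqP; rewrite -subr_eq0 /A -sumrB.
  rewrite (eq_bigr (fun i : 'I_N.+1 =>
    - (path_int f (z i.+1 j) (z i.+1 j.+1) - path_int f (z i j) (z i j.+1)))); last first.
    have aux (a1 a2 a3 a4 : R[i]) : a1 + a2 = a3 + a4 -> a1 - a3 = - (a2 - a4).
      move=> E; have -> : a1 = a3 + a4 - a2 by rewrite -E addrK.
      by ring.
    move=> i _; apply: aux; exact: cell.
  rewrite sumrN -(big_mkord xpredT (fun i => path_int f (z i.+1 j) (z i.+1 j.+1) -
    path_int f (z i j) (z i j.+1))) telescope_sumr//.
  have [-> ->] := zl _ (ltnW jN); have [-> ->] := zl _ jN.
  by rewrite subrr oppr0.
have A0 : A 0%N = A N.+1.
  suff H (m : nat) : (m <= N.+1)%N -> A 0%N = A m by exact: H.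
  elim: m => [_|m IH mN]; first exact: erefl.
  rewrite (IH (ltnW mN)); exact: row.
have AN : A N.+1 = 0.
  rewrite /A; apply: big1 => i _; have i1 : (i <= N.+1)%N by exact: ltnW.
  have e1 (n : nat) : (n <= N.+1)%N -> z n N.+1 = c a.
    move=> nN; have gn : g n \in `[0, 1] by rewrite in_itv /= g01.
    by rewrite /z gN (h1 _ gn) /= phi0.
  have Sp := inS _ _ (g01 _ i1) (g01 _ (leqnn N.+1)).
  have [r B q] := NP _ Sp; have [F [_ FP]] := ball_path_int fO B.
  have p0 : cabs (z i N.+1 - z i N.+1) < r := q _ Sp (d0 i) (d0 N.+1).
  by rewrite (e1 i.+1 (ltn_ord i)) -(e1 i i1) (FP _ _ p0 p0) subrr.
rewrite cintE cE.
have cf : contour_cont c f.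
  by move=> w cw; apply: derivable_continuous; apply: fO; exact: cO.
(* The arc of [c] between two grid points stays in the disc of a cell, so it can be
   replaced by the segment. *)
have piece (m : nat) : (m < N.+1)%N ->
    cintegrable `[phi (g m), phi (g m.+1)] (cintegrand c f) /\
    cintegral `[phi (g m), phi (g m.+1)] (cintegrand c f) =
    path_int f (z m 0%N) (z m.+1 0%N).
  move=> mN; have m1 : (m <= N.+1)%N by exact: ltnW.
  have md := phi_in _ (g01 _ m1); have mSd := phi_in _ (g01 _ mN).
  have lt : phi (g m) < phi (g m.+1).
    by apply: phi_lt; exact: g_lt.
  have cw := contour_cont_within md mSd lt cf.
  split; first exact: within_contour_integrable.
  have Sp := inS _ _ (g01 _ m1) (g01 0%N isT).
  have [r B q] := NP _ Sp; have [F [dF FP]] := ball_path_int fO B.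
  have hz t : phi (g m) <= t <= phi (g m.+1) -> cabs (c t - z m 0%N) < r.
    move=> /andP[t1 t2]; have [{}t1 {}t2] := phi_le_inv _ _ _ t1 t2.
    have /andP[gm0 _] := g01 _ m1; have /andP[_ gm1] := g01 _ mN.
    have s01 : 0 <= (t - a) / (b - a) <= 1.
      by rewrite (le_trans gm0 t1) (le_trans t2 gm1).
    have -> : c t = h ((t - a) / (b - a), g 0%N).
      have s01' : (t - a) / (b - a) \in `[0, 1] by rewrite in_itv.
      by rewrite g0 (h0 _ s01') /= phi_inv.
    apply: (q _ (inS _ _ s01 (g01 0%N isT)) _ (d0 0%N)) => /=.
    exact: dist_le t1 t2.
  have hc (n : nat) : (n <= N.+1)%N -> c (phi (g n)) = z n 0%N.
    move=> nN; have gn : g n \in `[0, 1] by rewrite in_itv /= g01.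
    by rewrite /z g0 (h0 _ gn).
  rewrite (contour_FTC (F := F) md mSd lt cw); last first.
    by move=> t /hz; exact: dF.
  have p0 : cabs (z m 0%N - z m 0%N) < r := q _ Sp (d0 m) (d0 0%N).
  have p1 : cabs (z m.+1 0%N - z m 0%N) < r :=
    q _ (inS _ _ (g01 _ mN) (g01 0%N isT)) (d1 m) (d0 0%N).
  rewrite (hc _ mN) (hc _ m1) (FP _ _ p0 p1); exact: erefl.
have total (m : nat) : (m < N.+1)%N ->
    cintegrable `[a, phi (g m.+1)] (cintegrand c f) /\
    cintegral `[a, phi (g m.+1)] (cintegrand c f) =
    \sum_(i < m.+1) path_int f (z i 0%N) (z i.+1 0%N).
  elim: m => [|m IH] mN.
    by rewrite big_ord1 -[X in `[X, _]]phi0 -g0; exact: piece.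
  have [i1 e1] := IH (ltnW mN); have [i2 e2] := piece _ mN.
  have le2 : phi (g m.+1) <= phi (g m.+2) by apply/ltW/phi_lt; exact: g_lt.
  have le1 : a <= phi (g m.+1).
    rewrite -phi0 -g0; apply/ltW/phi_lt; rewrite g0.
    have /andP[gm0 _] := g01 _ (ltnW (ltnW mN)); exact: le_lt_trans gm0 (g_lt m).
  have [i12 e12] := cintegrable_cat le1 le2 i1 i2.
  split; first exact: i12.
  have sumS (G : nat -> R[i]) (n : nat) : \sum_(i < n.+1) G i = \sum_(i < n) G i + G n.
    exact: big_ord_recr.
  rewrite (sumS (fun i => path_int f (z i 0%N) (z i.+1 0%N))) -e1 -e2; exact: e12.
have [_] := total N (leqnn _); rewrite gN phi1 => E.
have {}E : cintegral `[a, b] (cintegrand c f) = A 0%N := E.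
by rewrite E A0 AN mul0r.
Qed.

End GlobalCauchy.

(** * Residues at finitely many nodes *)

Section Residues.
Variable R : realType.
Implicit Types (c : contour R) (f g h : R[i] -> R[i]) (a b v w z : R[i])
  (s : seq R[i]) (N : {poly R[i]}).

Definition node_prod s v : R[i] := \prod_(x <- s) (v - x).

Definition node_poly s : {poly R[i]} := \prod_(x <- s) ('X - x%:P).

Lemma node_polyE s v : (node_poly s).[v] = node_prod s v.
Proof.
by rewrite /node_poly horner_prod; apply: eq_bigr => x _; rewrite hornerXsubC.
Qed.

Lemma node_prod_cons a s v : node_prod (a :: s) v = (v - a) * node_prod s v.
Proof. by rewrite /node_prod big_cons. Qed.

Lemma node_prod_nil v : node_prod [::] v = 1.
Proof. by rewrite /node_prod big_nil. Qed.

Definition surrounds c s :=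
  forall x, x \in s -> ~ contour_image c x /\ winding c x = 1.

Lemma surrounds_cons c a s : surrounds c (a :: s) -> surrounds c s.
Proof. by move=> H x xs; apply: H; rewrite inE xs orbT. Qed.

Lemma node_prod_neq0 c s v : surrounds c s -> contour_image c v ->
  node_prod s v != 0.
Proof.
move=> cs cv; rewrite /node_prod prodf_seq_neq0; apply/allP => x /cs[nx _] /=.
by rewrite subr_eq0; apply: contra_notN nx => /eqP <-.
Qed.

Lemma contour_cont_node_prod c s : contour_cont c (node_prod s).
Proof.
elim: s => [|a s IH].
  by apply: eq_contour_cont (@contour_cont_cst R c 1) => v; rewrite node_prod_nil.
apply: (eq_contour_cont (f := fun v => (v - a) * node_prod s v)).
  by move=> v; rewrite node_prod_cons.
by apply: contour_contM IH; move=> v _; exact: continuous_sub.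
Qed.

Lemma contour_cont_div c s h : surrounds c s -> contour_cont c h ->
  contour_cont c (fun v => h v / node_prod s v).
Proof.
move=> cs ch; apply: contour_contM ch _; apply: contour_contV (@contour_cont_node_prod c s).
by move=> z; exact: node_prod_neq0.
Qed.

Lemma contour_cont_horner c N : contour_cont c (fun v => N.[v]).
Proof.
elim/poly_ind: N => [|N k IH].
  by apply: eq_contour_cont (@contour_cont_cst R c 0) => v; rewrite horner0.
apply: (eq_contour_cont (f := fun v => N.[v] * v + k)).
  by move=> v; rewrite hornerMXaddC.
apply: contour_contD; last exact: contour_cont_cst.
by apply: contour_contM IH _; exact: contour_cont_id.
Qed.

Lemma node_prod_perm s s' v : perm_eq s s' -> node_prod s v = node_prod s' v.
Proof. by move=> ss'; rewrite /node_prod (perm_big _ ss'). Qed.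

(** If two nodes [a] and [b] differ, then [1 / ((v - a) (v - b))] is the difference
of [1 / (v - a)] and [1 / (v - b)] up to a constant: the integrals of the
two shorter products are equal and cancel. If all nodes coincide, there is a primitive. *)
Lemma cint_inv_node_prod c s : loop c -> surrounds c s -> (1 < size s)%N ->
  cint c (fun v => (node_prod s v)^-1) = 0.
Proof.
move=> lc; have [n] := ubnP (size s); elim: n s => // n IH [//|a s] sn cs s1.
have [alls|/allPn[b bs ba]] := boolP (all (pred1 a) s).
  have [a_out _] := cs a (mem_head _ _).
  case: s alls s1 {IH sn cs} => // b s alls _.
  rewrite -(cint_pow_inv_sub (size s) lc a_out); apply: eq_cint => v _.
  have -> : a :: b :: s = nseq (size s).+2 a.
    by apply/all_pred1P; rewrite /= eqxx.
  by rewrite /node_prod big_nseq -Monoid.iteropE exprVn.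
have /perm_to_rem ps := bs; set s' := rem b s in ps.
have E v : node_prod (a :: s) v = (v - a) * ((v - b) * node_prod s' v).
  by rewrite node_prod_cons (node_prod_perm v ps) node_prod_cons.
have cb : surrounds c (b :: s').
  by move=> x; rewrite -(perm_mem ps) => xs; apply: cs; rewrite inE xs orbT.
have ca : surrounds c (a :: s').
  move=> x; rewrite inE => /predU1P[->|xs]; first exact: cs (mem_head _ _).
  by apply: cb; rewrite inE xs orbT.
have szs : size s = (size s').+1 by rewrite (perm_size ps).
have int1 t : surrounds c (t :: s') -> cint c (fun v => (node_prod (t :: s') v)^-1) =
    (size s' == 0%N)%:R.
  move=> ct; case: eqP => [/size0nil s0|/eqP s0].
    rewrite -(ct t (mem_head _ _)).2; apply: eq_cint => v _.
    by rewrite node_prod_cons s0 node_prod_nil mulr1.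
  apply: IH ct _ => /=; last by rewrite ltnS lt0n.
  by move: sn; rewrite /= szs.
have int2 t : surrounds c (t :: s') -> contour_integrable c (fun v => (node_prod (t :: s') v)^-1).
  move=> ct; apply: contour_cont_integrable (loop_compact lc) _.
  by apply: contour_contV (@contour_cont_node_prod c _) => z; exact: node_prod_neq0.
have ab0 : a - b != 0 by rewrite subr_eq0 eq_sym.
have : cint c (fun v => (a - b)^-1 * ((node_prod (a :: s') v)^-1 +
    -1 * (node_prod (b :: s') v)^-1)) = 0.
  rewrite cintZ; last exact: contour_integrableD (int2 _ ca) (contour_integrableZ _ (int2 _ cb)).
  rewrite (cintD (int2 _ ca) (contour_integrableZ _ (int2 _ cb))).
  by rewrite cintZ ?(int1 _ ca) ?(int1 _ cb); [rewrite mulN1r subrr mulr0|exact: int2].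
move=> <-; apply: eq_cint => v cv; rewrite E !node_prod_cons.
have := node_prod_neq0 ca cv; have := node_prod_neq0 cb cv.
rewrite !node_prod_cons !mulf_eq0 !negb_or => /andP[vb p0] /andP[va _].
by move: (node_prod s' v) p0 => p p0; field; rewrite ab0 va vb p0.
Qed.

Lemma poly_divXsubC N b : exists N', N = N.[b]%:P + ('X - b%:P) * N'.
Proof.
have : root (N - N.[b]%:P) b by rewrite rootE !hornerE subrr.
move=> /factor_theorem[N' E]; exists N'.
by rewrite mulrC -E addrC subrK.
Qed.

(** This is minus the residue at infinity. Dividing [N] by [X - a] removes the node
[a] from the denominator, up to a constant over the whole product. *)
Lemma cint_rational c s N : loop c -> surrounds c s -> (size N <= size s)%N ->
  cint c (fun v => N.[v] / node_prod s v) = N`_(size s).-1.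
Proof.
move=> lc; elim: s N => [|a s IH] N cs sN.
  move: sN; rewrite leqn0 size_poly_eq0 => /eqP ->; rewrite coef0 -[RHS](cint0 c).
  by apply: eq_cint => v _; rewrite horner0 mul0r.
have [N' NE] := poly_divXsubC N a.
have cs' := surrounds_cons cs.
have sN' : (size N' <= size s)%N.
  have [->|N'0] := eqVneq N' 0; first by rewrite size_poly0.
  rewrite -ltnS (leq_trans _ sN)//; have szM : size (('X - a%:P) * N') = (size N').+1.
    by rewrite size_monicM ?monicXsubC// size_XsubC.
  rewrite NE addrC size_polyDl szM// (leq_ltn_trans (size_polyC_leq1 _))//.
  by rewrite ltnS size_poly_gt0.
have cinv : contour_cont c (fun v => (node_prod (a :: s) v)^-1).
  by apply: contour_contV (@contour_cont_node_prod c _) => z; exact: node_prod_neq0.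
have i1 := contour_integrableZ N.[a] (contour_cont_integrable (loop_compact lc) cinv).
have i2 := contour_cont_integrable (loop_compact lc)
  (contour_cont_div cs' (@contour_cont_horner c N')).
have -> : cint c (fun v => N.[v] / node_prod (a :: s) v) =
    N.[a] * cint c (fun v => (node_prod (a :: s) v)^-1) +
    cint c (fun v => N'.[v] / node_prod s v).
  rewrite -cintZ; last exact: contour_cont_integrable (loop_compact lc) cinv.
  rewrite -(cintD i1 i2); apply: eq_cint => v cv.
  have := node_prod_neq0 cs cv; rewrite node_prod_cons mulf_eq0 negb_or => /andP[va p0].
  rewrite {1}NE !hornerE; move: (node_prod s v) p0 => p p0.
  by field; rewrite va p0.
rewrite (IH _ cs' sN').
have [s0|s0] := posnP (size s).
  move: sN'; rewrite s0 leqn0 size_poly_eq0 => /eqP N'0.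
  rewrite N'0 coef0 addr0 /= s0 NE N'0 mulr0 addr0 coefC eqxx hornerC.
  have -> : cint c (fun v => (node_prod (a :: s) v)^-1) = 1.
    rewrite -(cs a (mem_head _ _)).2; apply: eq_cint => v _.
    by rewrite node_prod_cons (size0nil s0) node_prod_nil mulr1.
  by rewrite mulr1.
rewrite cint_inv_node_prod//= mulr0 add0r NE coefD coefC gtn_eqF// add0r.
rewrite mulrBl coefB coefXM gtn_eqF// coefCM.
by rewrite [N'`_(size s)]nth_default// mulr0 subr0.
Qed.

End Residues.

Section AnalyticResidues.
Variables (R : realType) (Omega : set R[i]).
Hypotheses (Omega_open : open Omega) (Omega_sc : simply_connected Omega).
Implicit Types (c : contour R) (f g h : R[i] -> R[i]) (a b v w z : R[i])
  (s : seq R[i]) (N : {poly R[i]}).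

Lemma analyticM f g : analytic_on Omega f -> analytic_on Omega g ->
  analytic_on Omega (fun v => f v * g v).
Proof. by move=> fO gO z zO; apply: (@derivableM R[i] R[i]); [exact: fO|exact: gO]. Qed.

Lemma analyticD f g : analytic_on Omega f -> analytic_on Omega g ->
  analytic_on Omega (fun v => f v + g v).
Proof. by move=> fO gO z zO; apply: (@derivableD R[i] R[i] R[i]); [exact: fO|exact: gO]. Qed.

Lemma analytic_cst (k : R[i]) : analytic_on Omega (fun=> k).
Proof. by move=> z _; exact: derivable_cst. Qed.

Lemma analytic_id : analytic_on Omega id.
Proof. by move=> z _; exact: derivable_id. Qed.

Lemma eq_analytic f g : (forall v, Omega v -> f v = g v) -> analytic_on Omega f ->
  analytic_on Omega g.
Proof.
move=> fg fO z zO; apply: near_eq_derivable (fO _ zO).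
by apply: filterS (open_nbhs_nbhs (conj Omega_open zO)) => v /fg.
Qed.

Lemma analyticV f : (forall v, Omega v -> f v != 0) -> analytic_on Omega f ->
  analytic_on Omega (fun v => (f v)^-1).
Proof. by move=> f0 fO z zO; apply: (@derivableV R[i] R[i] f); [exact: f0|exact: fO]. Qed.

Lemma analytic_horner N : analytic_on Omega (fun v => N.[v]).
Proof.
elim/poly_ind: N => [|N k IH].
  apply: (eq_analytic (f := fun=> 0)); last exact: analytic_cst.
  by move=> v _; rewrite horner0.
apply: (eq_analytic (f := fun v => N.[v] * v + k)).
  by move=> v _; rewrite hornerMXaddC.
apply: (@analyticD (fun v => N.[v] * v) (fun=> k)); last exact: analytic_cst.
by apply: (@analyticM (fun v => N.[v]) id); [exact: IH|exact: analytic_id].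
Qed.

Definition difference_quotient f b w : R[i] :=
  if w == b then derive f b 1 else (f w - f b) / (w - b).

Lemma difference_quotientE f b w :
  f w = f b + (w - b) * difference_quotient f b w.
Proof. exact: (quotient_atE f b (derive f b 1)). Qed.

Lemma analytic_difference_quotient f b : Omega b -> analytic_on Omega f ->
  analytic_on Omega (difference_quotient f b).
Proof.
move=> bO fO; have [g gO gE] := divided_difference Omega_open bO fO.
have -> // : difference_quotient f b = g.
apply/funext => w; rewrite /difference_quotient; have [->|wb] := eqVneq w b.
  have dg : has_cderiv f b (g b).
    exists g; split; [exact: derivable_continuous (gO _ bO)|exact: erefl|exact: gE].
  by have [_] := has_cderiv_is_derive dg.
by rewrite gE [f b + _]addrC addrK mulrC mulKf// subr_eq0.
Qed.

Definition contour_of c s := [/\ loop c, contour_image c `<=` Omega & surrounds c s].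

(** For [h] analytic and a contour that surrounds [s], this is the divided difference
of [h] at the nodes [s], repetitions allowed. *)
Definition residue c s h := cint c (fun v => h v / node_prod s v).

Lemma analytic_contour_cont c h : contour_image c `<=` Omega ->
  analytic_on Omega h -> contour_cont c h.
Proof. by move=> cO hO z cz; apply: derivable_continuous; apply: hO; exact: cO. Qed.

Lemma residue_integrable c s h : contour_of c s -> analytic_on Omega h ->
  contour_integrable c (fun v => h v / node_prod s v).
Proof.
move=> [lc cO cs] hO; apply: contour_cont_integrable (loop_compact lc) _.
exact: contour_cont_div cs (analytic_contour_cont cO hO).
Qed.

Lemma eq_residue c s f g : contour_image c `<=` Omega ->
  (forall v, Omega v -> f v = g v) -> residue c s f = residue c s g.
Proof. by move=> cO fg; apply: eq_cint => v /cO vO; rewrite fg. Qed.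

Lemma residueD c s f g : contour_of c s -> analytic_on Omega f ->
  analytic_on Omega g ->
  residue c s (fun v => f v + g v) = residue c s f + residue c s g.
Proof.
move=> cc fO gO; rewrite /residue.
rewrite -(cintD (residue_integrable cc fO) (residue_integrable cc gO)).
by apply: eq_cint => v _; rewrite mulrDl.
Qed.

Lemma residueZ c s (k : R[i]) f : contour_of c s -> analytic_on Omega f ->
  residue c s (fun v => k * f v) = k * residue c s f.
Proof.
move=> cc fO; rewrite /residue -(cintZ _ (residue_integrable cc fO)).
by apply: eq_cint => v _; rewrite mulrA.
Qed.

Lemma residue_nil c h : contour_of c [::] -> analytic_on Omega h ->
  residue c [::] h = 0.
Proof.
move=> [lc cO _] hO; rewrite -[RHS](cauchy_simply_connected Omega_open Omega_sc lc cO hO).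
by apply: eq_cint => v _; rewrite node_prod_nil divr1.
Qed.

Lemma contour_of_cons c a s : contour_of c (a :: s) -> contour_of c s.
Proof. by move=> [lc cO /surrounds_cons]. Qed.

Lemma residue_cons c a s h : contour_of c (a :: s) ->
  residue c (a :: s) (fun v => (v - a) * h v) = residue c s h.
Proof.
move=> [lc cO cs]; apply: eq_cint => v cv.
have := node_prod_neq0 cs cv; rewrite node_prod_cons mulf_eq0 negb_or => /andP[va p0].
by move: (node_prod s v) p0 => p p0; field; rewrite va p0.
Qed.

Lemma residue_node_prod c s h : contour_of c s -> analytic_on Omega h ->
  residue c s (fun v => h v * node_prod s v) = 0.
Proof.
move=> [lc cO cs] hO; rewrite -[RHS](cauchy_simply_connected Omega_open Omega_sc lc cO hO).
by apply: eq_cint => v cv; rewrite mulfK//; exact: node_prod_neq0 cv.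
Qed.

Lemma residue_horner c s N : contour_of c s -> (size N <= size s)%N ->
  residue c s (fun v => N.[v]) = N`_(size s).-1.
Proof. by move=> [lc _ cs]; exact: cint_rational. Qed.

(** Cauchy's formula: the difference quotient of [h] at [a] integrates to [0]. *)
Lemma residue1 c a h : contour_of c [:: a] -> Omega a -> analytic_on Omega h ->
  residue c [:: a] h = h a.
Proof.
move=> cc aO hO; have [lc cO cs] := cc.
have gO := analytic_difference_quotient aO hO.
have -> : residue c [:: a] h = residue c [:: a] (fun v => (h a)%:P.[v] +
    (v - a) * difference_quotient h a v).
  by apply: eq_residue => // v _; rewrite hornerC -difference_quotientE.
have mO : analytic_on Omega (fun v => (v - a) * difference_quotient h a v).
  apply: (@analyticM (fun v => v - a)); last exact: gO.
  apply: (@analyticD id (fun=> - a)); [exact: analytic_id|exact: analytic_cst].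
rewrite (residueD cc (@analytic_horner (h a)%:P) mO).
rewrite (residue_horner cc (size_polyC_leq1 _)) /= coefC eqxx.
by rewrite (residue_cons _ cc) (residue_nil (contour_of_cons cc) gO) addr0.
Qed.

(** Newton's scheme: the difference quotient at the next node of the cofactor [g]
of the node product is the new cofactor. *)
Lemma hermite_interpolation h s : (forall x, x \in s -> Omega x) ->
  analytic_on Omega h -> exists N, exists2 g, analytic_on Omega g &
    (size N <= size s)%N /\ forall v, h v = N.[v] + g v * node_prod s v.
Proof.
move=> sO hO; elim: s sO => [|a s IH] sO.
  by exists 0, h => //; rewrite size_poly0; split=> // v; rewrite horner0 add0r node_prod_nil mulr1.
have [|N [g gO [sN gE]]] := IH; first by move=> x xs; apply: sO; rewrite inE xs orbT.
have aO := sO a (mem_head _ _).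
exists (N + g a *: node_poly s), (difference_quotient g a).
  exact: analytic_difference_quotient.
split.
  rewrite (leq_trans (size_polyD _ _))// geq_max (leq_trans sN)//=.
  by rewrite (leq_trans (size_scale_leq _ _))// /node_poly size_prod_XsubC.
move=> v; rewrite gE {1}(difference_quotientE g a v) node_prod_cons hornerD hornerZ node_polyE.
by ring.
Qed.

(** For [w] outside the contour, the Cauchy kernel keeps the rational part of
[h / node_prod s]. The difference of its values at [v] and [w], divided by
[v - w], is up to a constant [Q / node_prod s] with [Q] the polynomial below,
whose integral is given by the top coefficient of [Q]. *)
Lemma cint_cauchy_kernel c s h N g w : contour_of c s -> (0 < size s)%N ->
  (size N <= size s)%N -> analytic_on Omega g ->
  (forall v, h v = N.[v] + g v * node_prod s v) ->
  Omega w -> ~ contour_image c w -> winding c w = 0 ->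
  cint c (fun v => h v / node_prod s v / (w - v)) = N.[w] / node_prod s w.
Proof.
move=> cc s0 sN gO hE wO cw w0; have [lc cO cs] := cc.
have comp := loop_compact lc.
have Dw : node_prod s w != 0.
  rewrite /node_prod prodf_seq_neq0; apply/allP => x /cs[_ wx] /=.
  by rewrite subr_eq0; apply: contra_eqN w0 => /eqP ->; rewrite wx oner_neq0.
pose p := (node_prod s w) *: N - N.[w] *: node_poly s.
have /factor_theorem[Q QE] : root p w.
  by rewrite rootE /p !hornerE node_polyE mulrC subrr.
have szD : size (node_poly s) = (size s).+1 by rewrite size_prod_XsubC.
have szp : (size p <= (size s).+1)%N.
  rewrite (leq_trans (size_polyD _ _))// size_polyN geq_max.
  rewrite (leq_trans (size_scale_leq _ _)) ?(leq_trans sN)//=.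
  by rewrite (leq_trans (size_scale_leq _ _))// szD.
have szQ : (size Q <= size s)%N.
  have [->|Q0] := eqVneq Q 0; first by rewrite size_poly0.
  by rewrite -ltnS (leq_trans _ szp)// QE size_Mmonic ?monicXsubC// size_XsubC addn2.
have Qlead : Q`_(size s).-1 = - N.[w].
  have := congr1 (fun q : {poly R[i]} => q`_(size s)) QE.
  rewrite /p coefB !coefZ [N`_(size s)]nth_default// mulr0 sub0r.
  have -> : (node_poly s)`_(size s) = 1.
    have := monic_prod_XsubC s xpredT id; rewrite monicE /lead_coef.
    by rewrite -/(node_poly s) szD => /eqP.
  rewrite mulr1 mulrBr coefB coefMX gtn_eqF// coefMC [Q`_(size s)]nth_default// mul0r subr0.
  by move=> ->.
have gq := analytic_difference_quotient wO gO.
pose k1 := - (N.[w] / node_prod s w + g w).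
have E v : contour_image c v -> h v / node_prod s v / (w - v) =
    k1 * (v - w)^-1 + ((- (node_prod s w)^-1) * (Q.[v] / node_prod s v) +
    -1 * difference_quotient g w v).
  move=> cv; have p0 := node_prod_neq0 cs cv.
  have vw : v - w != 0 by rewrite subr_eq0; apply: contra_notN cw => /eqP <-.
  have wv : w - v != 0 by rewrite -opprB oppr_eq0.
  have Qv : Q.[v] * (v - w) = node_prod s w * N.[v] - N.[w] * node_prod s v.
    have := congr1 (fun q : {poly R[i]} => q.[v]) QE.
    by rewrite /p !hornerE node_polyE => <-.
  rewrite hE {1}(difference_quotientE g w v).
  have -> : Q.[v] = (node_prod s w * N.[v] - N.[w] * node_prod s v) / (v - w).
    by rewrite -Qv mulfK.
  rewrite /k1; move: (node_prod s w) (node_prod s v) Dw p0 => X Y X0 Y0.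
  by field; rewrite X0 Y0 vw wv.
rewrite (eq_cint E).
have i0 := contour_cont_integrable comp (contour_cont_sub_inv cw).
have i1 := residue_integrable cc (@analytic_horner Q).
have i2 := contour_cont_integrable comp (analytic_contour_cont cO gq).
rewrite (cintD (contour_integrableZ _ i0) (contour_integrableD (contour_integrableZ _ i1)
  (contour_integrableZ _ i2))).
rewrite (cintD (contour_integrableZ _ i1) (contour_integrableZ _ i2)).
rewrite (cintZ _ i0) (cintZ _ i1) (cintZ _ i2).
have -> : cint c (fun z => (z - w)^-1) = 0 by exact: w0.
rewrite (cauchy_simply_connected Omega_open Omega_sc lc cO gq) !mulr0 add0r addr0.
have -> : cint c (fun v => Q.[v] / node_prod s v) = - N.[w].
  by rewrite -Qlead; exact: residue_horner.
by rewrite mulrNN mulrC.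
Qed.

End AnalyticResidues.

(** * Nested contour integrals as iterated residues *)

Section NestedContours.
Variables (R : realType) (Omega : set R[i]).
Hypotheses (Omega_open : open Omega) (Omega_sc : simply_connected Omega).
Variables (n : nat) (C_ : nat -> contour R) (b_ : nat -> R[i]) (P_ : nat -> R[i] -> R[i]).
Hypothesis b_in : forall i, (i < n)%N -> Omega (b_ i).
Hypothesis P_an : forall i, (i < n)%N -> analytic_on Omega (P_ i).
Hypothesis P_neq0 : forall i, (i < n)%N -> forall v, Omega v -> P_ i v != 0.
Hypothesis C_loop : forall i, (i < n)%N -> loop (C_ i).
Hypothesis C_in : forall i, (i < n)%N -> contour_image (C_ i) `<=` Omega.
Implicit Types (c : contour R) (f g h : R[i] -> R[i]) (v w z : R[i])
  (N : {poly R[i]}) (i j k m l : nat).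

Definition nodes k m := [seq b_ i | i <- iota k m].

Lemma size_nodes k m : size (nodes k m) = m.
Proof. by rewrite size_map size_iota. Qed.

Lemma nodesS k m : nodes k m.+1 = b_ k :: nodes k.+1 m.
Proof. by []. Qed.

Lemma mem_nodes k m x : x \in nodes k m -> exists2 i, (i < k + m)%N & x = b_ i.
Proof.
elim: m k => [//|m IH] k; rewrite nodesS inE => /predU1P[->|/IH[i im ->]].
  by exists k => //; rewrite addnS ltnS leq_addr.
by exists i => //; rewrite -addSnnS.
Qed.

Lemma nodes_in k m : (k + m <= n)%N -> forall x, x \in nodes k m -> Omega x.
Proof.
by move=> km x /mem_nodes[i im ->]; apply: b_in; exact: leq_trans im km.
Qed.

Lemma node_in_nodes i : (i < n)%N -> b_ i \in nodes 0 n.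
Proof.
suff H k m : (k <= i)%N -> (i < k + m)%N -> b_ i \in nodes k m.
  by move=> i_n; exact: (H 0%N n).
elim: m k => [|m IH] k; first by rewrite addn0 ltnNge => ->.
rewrite nodesS inE leq_eqVlt => /predU1P[->|ki im]; first by rewrite eqxx.
by apply/orP; right; apply: IH => //; rewrite addSnnS.
Qed.

Lemma surrounds_nodes c k m : surrounds c (nodes 0 n) -> (k + m <= n)%N ->
  surrounds c (nodes k m).
Proof.
move=> cs km x /mem_nodes[i im ->]; apply: cs; apply: node_in_nodes.
exact: leq_trans im km.
Qed.

Lemma contour_of_nodes c k m : contour_of Omega c (nodes 0 n) -> (k + m <= n)%N ->
  contour_of Omega c (nodes k m).
Proof. by move=> [lc cO cs] km; split; [exact: lc|exact: cO|exact: surrounds_nodes]. Qed.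

(** A divided difference of [h] at the nodes from [b_ k] to [b_ (k + m).-1] in which
a division by [P_ i] precedes the step at [b_ i]. These numbers are both the
coefficients of [residue_expansion] and the values of the nested integrals. *)
Fixpoint iterated_residue k m h : R[i] :=
  if m is m'.+1 then
    if m' is 0%N then h (b_ k) * (P_ k (b_ k))^-1
    else iterated_residue k.+1 m' (difference_quotient (fun v => h v * (P_ k v)^-1) (b_ k))
  else 0.

Lemma iterated_residueSS k m h : iterated_residue k m.+2 h =
  iterated_residue k.+1 m.+1 (difference_quotient (fun v => h v * (P_ k v)^-1) (b_ k)).
Proof. exact: erefl. Qed.

Lemma analytic_quotient k h : (k < n)%N -> analytic_on Omega h ->
  analytic_on Omega (fun v => h v * (P_ k v)^-1).
Proof.
move=> kn hO; apply: (@analyticM R Omega h); first exact: hO.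
by apply: (analyticV (f := P_ k)); [exact: P_neq0|exact: P_an].
Qed.

(** Write [h = (a + (v - b_ k) * h1) * P_ k], with [a] the value at [b_ k] and [h1]
the difference quotient of [h / P_ k]. The constant [a] gives the first term;
in the other part the factor [v - b_ k] cancels a node, and induction applies to
[h1] and [P_ k * f]. The coefficients do not involve [f], nor the number of
nodes that follow. *)
Lemma residue_expansion m k c h f : (k + m <= n)%N ->
  contour_of Omega c (nodes k m) -> analytic_on Omega h -> analytic_on Omega f ->
  residue c (nodes k m) (fun v => h v * f v) =
  \sum_(i < m) iterated_residue k i.+1 h *
    residue c (nodes (k + i) (m - i)) (fun v => (\prod_(q < i.+1) P_ (k + q) v) * f v).
Proof.
elim: m k h f => [|m IH] k h f km cc hO fO.
  rewrite big_ord0; apply: (residue_nil Omega_open Omega_sc cc).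
  exact: analyticM hO fO.
have kn : (k < n)%N by rewrite (leq_trans _ km)// addnS ltnS leq_addr.
have [lc cO cs] := cc.
set a := h (b_ k) * (P_ k (b_ k))^-1.
have uO := analytic_quotient kn hO.
set h1 := difference_quotient (fun v => h v * (P_ k v)^-1) (b_ k).
have h1O : analytic_on Omega h1.
  exact (analytic_difference_quotient Omega_open (b_in kn) uO).
have PfO : analytic_on Omega (fun v => P_ k v * f v) := analyticM (P_an kn) fO.
have E v : Omega v -> h v * f v = a * (P_ k v * f v) + (v - b_ k) * (h1 v * (P_ k v * f v)).
  move=> vO; have := difference_quotientE (fun v => h v * (P_ k v)^-1) (b_ k) v.
  rewrite -/a -/h1 => Eh; have P0 := P_neq0 kn vO.
  have -> : h v = (a + (v - b_ k) * h1 v) * P_ k v by rewrite -Eh divfK.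
  by ring.
rewrite (eq_residue _ cO E).
have h1PfO : analytic_on Omega (fun v => h1 v * (P_ k v * f v)) := analyticM h1O PfO.
have aO : analytic_on Omega (fun v => a * (P_ k v * f v)).
  by apply: (@analyticM R Omega (fun=> a)); [exact: analytic_cst|exact: PfO].
have bO : analytic_on Omega (fun v => (v - b_ k) * (h1 v * (P_ k v * f v))).
  apply: (@analyticM R Omega (fun v => v - b_ k)); last exact: h1PfO.
  by apply: (@analyticD R Omega id (fun=> - b_ k)); [exact: analytic_id|exact: analytic_cst].
rewrite (residueD cc aO bO) (residueZ _ cc PfO) nodesS (residue_cons _ cc).
have km' : (k.+1 + m <= n)%N by rewrite addSnnS.
rewrite (IH k.+1 h1 _ km' (contour_of_cons cc) h1O PfO) big_ord_recl; congr (_ + _).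
  rewrite /= addn0 subn0; congr (_ * _); apply: eq_residue cO _ => v _.
  by rewrite big_ord_recl big_ord0 addn0 mulr1.
apply: eq_bigr => i _; rewrite /= /bump leq0n add1n subSS addnS -addSn; congr (_ * _).
apply: eq_residue cO _ => v _; rewrite [in RHS]big_ord_recl addn0 mulrCA !mulrA.
congr (_ * _ * _); apply: eq_bigr => q _.
by rewrite /= /bump leq0n add1n addSnnS.
Qed.

(** The step of [residue_expansion] for a polynomial [N]: the value at [b_ k]
contributes the top coefficient of [N], which vanishes by the bound on its size. *)
Lemma residue_quotient_horner k m c h N : (k + m.+2 <= n)%N ->
  contour_of Omega c (nodes k m.+2) -> analytic_on Omega h -> (size N <= m.+1)%N ->
  residue c (nodes k m.+2) (fun v => h v * (P_ k v)^-1 * N.[v]) =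
  residue c (nodes k.+1 m.+1)
    (fun v => difference_quotient (fun v => h v * (P_ k v)^-1) (b_ k) v * N.[v]).
Proof.
move=> km cc hO sN.
have kn : (k < n)%N by rewrite (leq_trans _ km)// addnS ltnS leq_addr.
have [lc cO cs] := cc.
set a := h (b_ k) * (P_ k (b_ k))^-1.
have uO := analytic_quotient kn hO.
set h1 := difference_quotient (fun v => h v * (P_ k v)^-1) (b_ k).
have h1O : analytic_on Omega h1.
  exact (analytic_difference_quotient Omega_open (b_in kn) uO).
have NO := @analytic_horner R Omega Omega_open N.
have E v : Omega v -> h v * (P_ k v)^-1 * N.[v] = a * N.[v] + (v - b_ k) * (h1 v * N.[v]).
  move=> _; have := difference_quotientE (fun v => h v * (P_ k v)^-1) (b_ k) v.
  by rewrite -/a -/h1 => ->; ring.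
rewrite (eq_residue _ cO E).
have h1NO : analytic_on Omega (fun v => h1 v * N.[v]) := analyticM h1O NO.
have aO : analytic_on Omega (fun v => a * N.[v]).
  by apply: (@analyticM R Omega (fun=> a)); [exact: analytic_cst|exact: NO].
have bO : analytic_on Omega (fun v => (v - b_ k) * (h1 v * N.[v])).
  apply: (@analyticM R Omega (fun v => v - b_ k)); last exact: h1NO.
  by apply: (@analyticD R Omega id (fun=> - b_ k)); [exact: analytic_id|exact: analytic_cst].
rewrite (residueD cc aO bO) (residueZ _ cc NO).
have sN' : (size N <= size (nodes k m.+2))%N by rewrite size_nodes (leq_trans sN).
rewrite (residue_horner cc sN') size_nodes /= nth_default// mulr0 add0r.
by rewrite nodesS (residue_cons _ cc).
Qed.

Definition chain_factor k w v : R[i] := (P_ k v)^-1 / ((w - v) * (v - b_ k)).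

(** The contribution to the nested integral of the contours inside the one on which
[w] lies. *)
Fixpoint chain k m w : R[i] :=
  if m is m'.+1 then cint (C_ k) (fun v => chain_factor k w v * chain k.+1 m' v)
  else 1.

Lemma chainS k m w :
  chain k m.+1 w = cint (C_ k) (fun v => chain_factor k w v * chain k.+1 m v).
Proof. exact: erefl. Qed.

Hypothesis C_surrounds : forall i, (i < n)%N -> surrounds (C_ i) (nodes 0 n).
Hypothesis C_nested : forall i, (i.+1 < n)%N -> forall w, contour_image (C_ i) w ->
  ~ contour_image (C_ i.+1) w /\ winding (C_ i.+1) w = 0.

Lemma C_contour_of i k m : (i < n)%N -> (k + m <= n)%N ->
  contour_of Omega (C_ i) (nodes k m).
Proof.
move=> i_n; apply: contour_of_nodes.
by split; [exact: C_loop|exact: C_in|exact: C_surrounds].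
Qed.

(** By induction the inner chain is rational on [C_ k], because the points of [C_ k]
have winding number [0] about the next contour; with numerator [N'], let [N]
interpolate [N' / P_ k] at the nodes: then the Cauchy kernel leaves [N] over the
node product. Integrated against an analytic [h], the interpolation error
cancels the nodes and disappears, which gives the last clause. *)
Lemma chain_rational m k : (k + m.+1 <= n)%N -> exists N,
  [/\ (size N <= m.+1)%N,
    (forall w, Omega w -> ~ contour_image (C_ k) w -> winding (C_ k) w = 0 ->
      chain k m.+1 w = N.[w] / node_prod (nodes k m.+1) w) &
    forall c h, contour_of Omega c (nodes k m.+1) -> analytic_on Omega h ->
      residue c (nodes k m.+1) (fun v => h v * N.[v]) = iterated_residue k m.+1 h].
Proof.
elim: m k => [|m IH] k km.
  have kn : (k < n)%N by rewrite -addn1.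
  have uO := analytic_quotient kn (@analytic_cst R Omega 1).
  have [N [g gO [sN gE]]] := hermite_interpolation Omega_open (nodes_in km) uO.
  exists N; split; first by rewrite size_nodes in sN.
    move=> w wO cw w0; rewrite chainS -(cint_cauchy_kernel Omega_open Omega_sc
      (C_contour_of kn km) _ sN gO gE wO cw w0) ?size_nodes//.
    apply: eq_cint => v _; rewrite /= mulr1 mul1r /chain_factor.
    by rewrite node_prod_cons node_prod_nil mulr1 invfM [(w - v)^-1 * _]mulrC mulrA.
  move=> c h cc hO; have hNO : analytic_on Omega (fun v => h v * N.[v]).
    by apply: (@analyticM R Omega h); [exact: hO|exact: analytic_horner].
  rewrite (residue1 Omega_open Omega_sc cc (b_in kn) hNO) /=.
  have := gE (b_ k); rewrite node_prod_cons subrr mul0r mulr0 addr0 mul1r => ->.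
  exact: erefl.
have km' : (k.+1 + m.+1 <= n)%N by rewrite addSnnS.
have [N' [sN' chainE resE]] := IH _ km'.
have kn : (k < n)%N by rewrite (leq_trans _ km)// addnS ltnS leq_addr.
have k1n : (k.+1 < n)%N by rewrite (leq_trans _ km')// addnS ltnS leq_addr.
have uO := analytic_quotient kn (@analytic_cst R Omega 1).
have fO : analytic_on Omega (fun v => 1 * (P_ k v)^-1 * N'.[v]).
  by apply: (analyticM uO); exact: analytic_horner.
have [N [g gO [sN gE]]] := hermite_interpolation Omega_open (nodes_in km) fO.
exists N; split; first by rewrite size_nodes in sN.
  move=> w wO cw w0; rewrite chainS -(cint_cauchy_kernel Omega_open Omega_sc
    (C_contour_of kn km) _ sN gO gE wO cw w0) ?size_nodes//.
  apply: eq_cint => v cv; have [nv v0] := C_nested k1n cv.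
  rewrite (chainE _ (C_in kn cv) nv v0) mul1r /chain_factor (nodesS k m.+1) (node_prod_cons (b_ k)).
  move: (node_prod _ _) (P_ k v)^-1 => p q.
  by rewrite !invfM; ring.
move=> c h cc hO; have [lc cO cs] := cc.
have h1O : analytic_on Omega (difference_quotient (fun v => h v * (P_ k v)^-1) (b_ k)).
  exact (analytic_difference_quotient Omega_open (b_in kn) (analytic_quotient kn hO)).
rewrite iterated_residueSS -(resE _ _ (contour_of_cons cc) h1O).
rewrite -(residue_quotient_horner km cc hO sN').
have E v : Omega v -> h v * (P_ k v)^-1 * N'.[v] =
    h v * N.[v] + (h v * g v) * node_prod (nodes k m.+2) v.
  move=> _; rewrite -[_ * _ * N'.[v]]mulrA; have := gE v; rewrite mul1r => ->.
  by ring.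
rewrite (eq_residue _ cO E).
have hNO : analytic_on Omega (fun v => h v * N.[v]).
  by apply: (@analyticM R Omega h); [exact: hO|exact: analytic_horner].
have hgO : analytic_on Omega (fun v => h v * g v) := analyticM hO gO.
have dO : analytic_on Omega (fun v => h v * g v * node_prod (nodes k m.+2) v).
  apply: (@analyticM R Omega (fun v => h v * g v)); first exact: hgO.
  apply: (eq_analytic Omega_open (f := fun v => (node_poly (nodes k m.+2)).[v])).
    by move=> v _; exact: node_polyE.
  exact: analytic_horner.
by rewrite (residueD cc hNO dO) (residue_node_prod Omega_open Omega_sc cc hgO) addr0.
Qed.

Lemma outer_chain_integral m k h : (k + m.+1 <= n)%N -> analytic_on Omega h ->
  cint (C_ k) (fun v => h v * ((P_ k v)^-1 / (v - b_ k)) * chain k.+1 m v) =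
  iterated_residue k m.+1 h.
Proof.
move=> km hO.
have kn : (k < n)%N by rewrite (leq_trans _ km)// addnS ltnS leq_addr.
have cc := C_contour_of kn km.
case: m km cc => [|m] km cc.
  have uO := analytic_quotient kn hO.
  rewrite [RHS]/= -(residue1 Omega_open Omega_sc cc (b_in kn) uO).
  by apply: eq_cint => v _; rewrite mulr1 node_prod_cons node_prod_nil mulr1 mulrA.
have km' : (k.+1 + m.+1 <= n)%N by rewrite addSnnS.
have k1n : (k.+1 < n)%N by rewrite (leq_trans _ km')// addnS ltnS leq_addr.
have [N [sN chainE resE]] := chain_rational km'.
have h1O : analytic_on Omega (difference_quotient (fun v => h v * (P_ k v)^-1) (b_ k)).
  exact (analytic_difference_quotient Omega_open (b_in kn) (analytic_quotient kn hO)).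
rewrite iterated_residueSS -(resE _ _ (contour_of_cons cc) h1O).
rewrite -(residue_quotient_horner km cc hO sN).
apply: eq_cint => v cv; have [nv v0] := C_nested k1n cv.
rewrite (chainE _ (C_in kn cv) nv v0) (nodesS k m.+1) (node_prod_cons (b_ k)).
move: (node_prod _ _) (P_ k v)^-1 => p q.
by rewrite !invfM; ring.
Qed.

(** On [C_ k] the inner chain coincides with a rational function, so that the
integrand is continuous there. *)
Lemma chain_integrable m k w : (k + m.+1 <= n)%N -> ~ contour_image (C_ k) w ->
  contour_integrable (C_ k) (fun v => chain_factor k w v * chain k.+1 m v).
Proof.
move=> km cw.
have kn : (k < n)%N by rewrite (leq_trans _ km)// addnS ltnS leq_addr.
have [lc cO cs] := C_contour_of kn km.
have uO := analytic_quotient kn (@analytic_cst R Omega 1).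
have cu := analytic_contour_cont cO uO.
have iw := contour_cont_sub_inv cw.
have cw1 : contour_cont (C_ k) (fun v => -1 * (v - w)^-1).
  exact: contour_contM (@contour_cont_cst R (C_ k) (-1)) iw.
have wvE v : (w - v)^-1 = -1 * (v - w)^-1 by rewrite -opprB invrN mulN1r.
case: m km cs => [|m] km cs.
  apply: (@eq_contour_integrable R (C_ k)
    (fun v => (1 * (P_ k v)^-1) * (-1 * (v - w)^-1) / node_prod (nodes k 1) v)).
    move=> v _; rewrite /chain_factor mulr1 node_prod_cons node_prod_nil mulr1 invfM.
    by rewrite wvE; ring.
  apply: (contour_cont_integrable (loop_compact lc)).
  exact (contour_cont_div cs (contour_contM cu cw1)).
have km' : (k.+1 + m.+1 <= n)%N by rewrite addSnnS.
have k1n : (k.+1 < n)%N by rewrite (leq_trans _ km')// addnS ltnS leq_addr.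
have [N [sN chainE _]] := chain_rational km'.
apply: (@eq_contour_integrable R (C_ k)
    (fun v => (1 * (P_ k v)^-1) * (-1 * (v - w)^-1) * N.[v] / node_prod (nodes k m.+2) v)).
  move=> v cv; have [nv v0] := C_nested k1n cv.
  rewrite (chainE _ (C_in kn cv) nv v0) (nodesS k m.+1) (node_prod_cons (b_ k)) /chain_factor !invfM wvE.
  by ring.
apply: (contour_cont_integrable (loop_compact lc)).
exact (contour_cont_div cs (contour_contM (contour_contM cu cw1) (@contour_cont_horner R (C_ k) N))).
Qed.

Fixpoint chain_integrand k w (vs : seq R[i]) : R[i] :=
  if vs is v :: vs' then chain_factor k w v * chain_integrand k.+1 v vs' else 1.

Lemma eq_iter_cint (cs : seq (contour R)) (F G : seq R[i] -> R[i]) :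
  (forall vs, size vs = size cs -> F vs = G vs) ->
  iter_cint cs F = iter_cint cs G.
Proof.
elim: cs F G => [|c cs IH] F G FG /=; first exact: FG.
by apply: eq_cint => z _; apply: IH => vs szvs; apply: FG; rewrite /= szvs.
Qed.

Lemma iter_cint_chain m k w (A : R[i]) : (k + m <= n)%N ->
  ((0 < m)%N -> ~ contour_image (C_ k) w) ->
  iter_cint [seq C_ i | i <- iota k m] (fun vs => A * chain_integrand k w vs) =
  A * chain k m w.
Proof.
elim: m k w A => [//|m IH] k w A km /(_ isT) cw.
have kn : (k < n)%N by rewrite (leq_trans _ km)// addnS ltnS leq_addr.
have km' : (k.+1 + m <= n)%N by rewrite addSnnS.
rewrite chainS -(cintZ _ (chain_integrable km cw)).
apply: eq_cint => v cv; rewrite mulrA -(IH k.+1 v _ km'); last first.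
  move=> m0; have k1n : (k.+1 < n)%N.
    by apply: leq_trans km'; rewrite -[X in (X < _)%N]addn0 ltn_add2l.
  by have [] := C_nested k1n cv.
by apply: eq_iter_cint => vs _; rewrite /= mulrA.
Qed.

Lemma iter_cint_outer m h : (m < n)%N -> analytic_on Omega h ->
  iter_cint [seq C_ i | i <- iota 0 m.+1] (fun vs =>
    h vs`_0 * ((P_ 0 vs`_0)^-1 / (vs`_0 - b_ 0)) * chain_integrand 1 vs`_0 (behead vs)) =
  iterated_residue 0 m.+1 h.
Proof.
move=> mn hO; rewrite -(outer_chain_integral (k := 0) mn hO).
apply: eq_cint => v cv; rewrite -iter_cint_chain//.
move=> m0; have n1 : (1 < n)%N by apply: leq_ltn_trans mn.
by have [] := C_nested n1 cv.
Qed.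

Lemma chain_integrandE k w vs : chain_integrand k w vs =
  (\prod_(i < size vs) ((w :: vs)`_i - vs`_i))^-1 *
  (\prod_(i < size vs) ((vs`_i - b_ (k + i)) * P_ (k + i) vs`_i))^-1.
Proof.
elim: vs k w => [|v vs IH] k w; first by rewrite !big_ord0 invr1 mulr1.
rewrite [LHS]/= IH !big_ord_recl /= addn0.
have -> : \prod_(i < size vs) ((vs`_i - b_ (k + bump 0 i)) * P_ (k + bump 0 i) vs`_i) =
    \prod_(i < size vs) ((vs`_i - b_ (k.+1 + i)) * P_ (k.+1 + i) vs`_i).
  by apply: eq_bigr => i _; rewrite /bump leq0n add1n addSnnS.
rewrite /chain_factor; move: (\prod_(i < _) _) (\prod_(i < _) _) => X Y.
by rewrite !invfM; ring.
Qed.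

End NestedContours.

(** * Square-integrable functions on a contour *)

Section SquareIntegrable.
Variable R : realType.
Implicit Types (c : contour R) (f q g : R[i] -> R[i]) (D : set (measurableTypeR R)).
Notation mu := (@lebesgue_measure R).

(** The compact subintervals with rational end points cover the interval up to its
end points. The points left over are told apart by the existence of a rational
of the interval below them, so they are countably many. *)
Lemma measurable_fun_interval (i : interval R) (u : measurableTypeR R -> R) :
  (forall a b, a \in i -> b \in i -> a < b -> measurable_fun `[a, b] u) ->
  measurable_fun [set` i] u.
Proof.
move=> mu_ab.
pose J (k : nat) : set (measurableTypeR R) :=
  if unpickle k is Some (r, s) then
    if [&& ratr r \in i, ratr s \in i & (ratr r : R) < ratr s]
    then `[ratr r, ratr s]%classic else set0
  else set0.
have mJ k : measurable (J k) /\ measurable_fun (J k) u.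
  rewrite /J; case: unpickle => [[r s]|]; last first.
    by split; [exact: measurable0|exact: measurable_fun_set0].
  case: ifP => [/and3P[ri si rs]|_]; last first.
    by split; [exact: measurable0|exact: measurable_fun_set0].
  by split; [exact: measurable_itv|exact: mu_ab ri si rs].
pose E : set (measurableTypeR R) := [set` i] `\` \bigcup_k J k.
have Ji k : J k `<=` [set` i].
  rewrite /J; case: unpickle => [[r s]|]; last by [].
  case: ifP => [/and3P[ri si rs]|_]; last by [].
  by move=> t; apply: (interval_is_interval ri si).
have EP t : E t -> forall r s : rat, ratr r \in i -> ratr s \in i ->
    (ratr r : R) < ratr s -> ~ (ratr r <= t <= ratr s).
  move=> [_ nJ] r s ri si rs rts; apply: nJ; exists (pickle (r, s)); first exact: I.
  by rewrite /J pickleK ri si rs /= in_itv.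
have cE : countable E.
  apply/countable_injP.
  exists (fun t => nat_of_bool `[< exists2 r : rat, ratr r \in i & (ratr r : R) <= t >]).
  suff lt_neq s t : E s -> E t -> s < t ->
      `[< exists2 r : rat, ratr r \in i & (ratr r : R) <= s >] <>
      `[< exists2 r : rat, ratr r \in i & (ratr r : R) <= t >].
    move=> s t /set_mem Es /set_mem Et st.
    have st' : `[< exists2 r : rat, ratr r \in i & (ratr r : R) <= s >] =
        `[< exists2 r : rat, ratr r \in i & (ratr r : R) <= t >].
      by move: st; case: asboolP; case: asboolP.
    by case: (ltgtP s t) => // [/(lt_neq _ _ Es Et)|/(lt_neq _ _ Et Es)]; rewrite st'.
  move=> Es Et st; have [r] := rat_in_itvoo st.
  rewrite in_itv /= => /andP[sr rt].
  have ri : ratr r \in i.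
    by apply: (interval_is_interval (proj1 Es) (proj1 Et)); rewrite (ltW sr) (ltW rt).
  have -> : `[< exists2 r : rat, ratr r \in i & (ratr r : R) <= t >].
    by apply/asboolP; exists r => //; exact: ltW.
  move=> /asboolP[r' r'i r's].
  apply: (EP _ Es r' r r'i ri (le_lt_trans r's sr)).
  by rewrite r's ltW.
have -> : [set` i] = E `|` \bigcup_k J k.
  by rewrite /E setDKU => [|t [k _]]; [exact: erefl|exact: Ji].
have mE : measurable E by apply: countable_measurable cE => t; exact: measurable_set1.
apply/measurable_funU; [exact: mE|by apply: bigcup_measurable => k _; exact: (mJ k).1|].
split; last by apply/measurable_fun_bigcup => k; [exact: (mJ k).1|exact: (mJ k).2].
move=> _ Y _; apply: countable_measurable => [t|]; first exact: measurable_set1.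
by apply: sub_countable cE; apply: subset_card_le; exact: subIsetl.
Qed.

Definition cmeasurable D (F : R -> R[i]) :=
  measurable_fun D (fun t => complex.Re (F t)) /\
  measurable_fun D (fun t => complex.Im (F t)).

Lemma cmeasurableM D F G : cmeasurable D F -> cmeasurable D G ->
  cmeasurable D (fun t => F t * G t).
Proof.
move=> [fr fi] [gr gi]; split.
- have -> : (fun t => complex.Re (F t * G t)) =
     (fun t => complex.Re (F t) * complex.Re (G t) - complex.Im (F t) * complex.Im (G t)).
    by apply/funext => t; rewrite ReM.
  by apply: measurable_funB; apply: measurable_funM.
- have -> : (fun t => complex.Im (F t * G t)) =
     (fun t => complex.Re (F t) * complex.Im (G t) + complex.Im (F t) * complex.Re (G t)).
    by apply/funext => t; rewrite ImM.
  by apply: measurable_funD; apply: measurable_funM.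
Qed.

Lemma cmeasurable_cabs D F : cmeasurable D F -> measurable_fun D (fun t => cabs (F t)).
Proof.
move=> [fr fi].
have -> : (fun t => cabs (F t)) =
    (@Num.sqrt R) \o (fun t => complex.Re (F t) ^+ 2 + complex.Im (F t) ^+ 2).
  by apply/funext => t; rewrite /cabs normc_def.
apply: measurableT_comp.
  by apply: continuous_measurable_fun; exact: sqrt_continuous.
by apply: measurable_funD; exact: measurable_funX.
Qed.

Lemma cmeasurable_contour c f : {within contour_image c, continuous f} ->
  cmeasurable [set` contour_dom c] (fun t => f (c t)).
Proof.
move=> cf.
have cfc a b : a \in contour_dom c -> b \in contour_dom c -> a < b ->
    {within `[a, b], continuous (fun t => f (c t))}.
  move=> ad bd ab; apply: within_comp (contour_continuous ad bd ab) _ cf.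
  move=> t tab; exists t => //.
  by apply: (interval_is_interval ad bd); move: tab; rewrite /= in_itv.
split; apply: measurable_fun_interval => a b ad bd ab;
  apply: subspace_continuous_measurable_fun; try exact: measurable_itv;
  move=> t; [apply: continuous_Re|apply: continuous_Im]; exact: cfc.
Qed.

Lemma cmeasurable_velocity c : cmeasurable [set` contour_dom c] (velocity c).
Proof.
have vE t : cintegrand c (fun=> 1) t = velocity c t by rewrite /cintegrand mul1r.
have vi a b : a \in contour_dom c -> b \in contour_dom c -> a < b ->
    cintegrable `[a, b] (velocity c).
  move=> ad bd ab; apply: (eq_cintegrable _ (g := cintegrand c (fun=> 1))).
  - exact: measurable_itv.
  - by move=> t _; exact: vE.
  - apply: within_contour_integrable ad bd ab _.
    by apply: continuous_subspaceT => t; exact: cst_continuous.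
split; apply: measurable_fun_interval => a b ad bd ab;
  have [ir ii] := vi _ _ ad bd ab; apply/measurable_EFinP.
- by have [] := elimT (integrableP _ _ _) ir.
- by have [] := elimT (integrableP _ _ _) ii.
Qed.

Lemma square_integrableP c q : {within contour_image c, continuous q} ->
  square_integrable c q ->
  mu.-integrable [set` contour_dom c]
    (EFin \o (fun t => cabs (q (c t)) ^+ 2 * cabs (velocity c t))).
Proof.
move=> cq q2.
have E t : complex.Re (`|q (c t)| ^+ 2 * `|velocity c t|) =
    cabs (q (c t)) ^+ 2 * cabs (velocity c t).
  by rewrite -normrX -normrM -/(cabs _) !cabsM.
apply/integrableP; split.
  apply/measurable_EFinP; apply: measurable_funM.
    by apply: measurable_funX; apply: cmeasurable_cabs; exact: cmeasurable_contour.
  by apply: cmeasurable_cabs; exact: cmeasurable_velocity.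
apply: le_lt_trans q2; rewrite le_eqVlt; apply/orP; left; apply/eqP.
apply: eq_integral => t _; rewrite E /= ger0_norm//.
by rewrite mulr_ge0 ?sqr_ge0 ?cabs_ge0.
Qed.

(** The integrand is dominated through [`|q * g| <= `|q| ^+ 2 + `|g| ^+ 2]. *)
Lemma square_integrable_mul c q g :
  {within contour_image c, continuous q} -> {within contour_image c, continuous g} ->
  square_integrable c q -> square_integrable c g ->
  contour_integrable c (fun u => q u * g u).
Proof.
move=> cq cg q2 g2; have mD := contour_dom_measurable c.
have := integrableD mD (square_integrableP cq q2) (square_integrableP cg g2).
set h := (X in mu.-integrable _ X) => ih.
have [mr mi] : cmeasurable [set` contour_dom c] (cintegrand c (fun u => q u * g u)).
  apply: cmeasurableM (cmeasurable_velocity c).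
  by apply: cmeasurableM; exact: cmeasurable_contour.
have bnd t : cabs (cintegrand c (fun u => q u * g u) t) <=
    cabs (q (c t)) ^+ 2 * cabs (velocity c t) + cabs (g (c t)) ^+ 2 * cabs (velocity c t).
  rewrite /cintegrand !cabsM -mulrDl; apply: ler_wpM2r; first exact: cabs_ge0.
  move: (cabs_ge0 (q (c t))) (cabs_ge0 (g (c t))).
  move: (cabs _) (cabs _) => x y x0 y0.
  by nra.
have hE t : (`|h t| = (cabs (q (c t)) ^+ 2 * cabs (velocity c t) + cabs (g (c t)) ^+ 2 * cabs (velocity c t))%:E)%E.
  rewrite /h /= ger0_norm// addr_ge0// mulr_ge0 ?sqr_ge0 ?cabs_ge0//.
split; apply: (le_integrable mD _ _ ih); try exact/measurable_EFinP;
  move=> t _; rewrite hE /= lee_fin; apply: le_trans (bnd t); rewrite -lecR -cabsE.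
- exact: norm_Re_le.
- exact: norm_Im_le.
Qed.

End SquareIntegrable.

(** * Fredholm determinants of finite rank *)

From mathcomp Require Import fingroup perm.

Section FiniteRankDeterminant.
Variable F : comNzRingType.
Implicit Types (n k : nat).

(** Sylvester's identity, from the two triangular factorizations of the block matrix
with rows [(1, - X)] and [(Y, 1)]. *)
Lemma det1_mulC n k (X : 'M[F]_(n, k)) (Y : 'M[F]_(k, n)) :
  \det (1%:M + X *m Y) = \det (1%:M + Y *m X).
Proof.
have E1 : block_mx 1%:M (- X) Y 1%:M =
    block_mx 1%:M 0 Y 1%:M *m block_mx 1%:M (- X) 0 (1%:M + Y *m X).
  rewrite mulmx_block !mul1mx ?mul0mx ?mulmx1 ?mulmx0 ?addr0 mulmxN.
  by rewrite addrCA addNr addr0.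
have E2 : block_mx 1%:M (- X) Y 1%:M =
    block_mx (1%:M + X *m Y) (- X) 0 1%:M *m block_mx 1%:M 0 Y 1%:M.
  rewrite mulmx_block ?mul1mx ?mul0mx ?mulmx1 ?mulmx0 ?add0r mulNmx.
  by rewrite addrK.
have := congr1 determinant E1; rewrite {1}E2 !det_mulmx !det_ublock det_lblock.
by rewrite !det1 !mulr1 !mul1r.
Qed.

Variables (n : nat) (M : 'M[F]_n).

(** The rows of the identity outside [S] make the determinant of this matrix the
principal minor of [M] at [S]. *)
Definition rows_from (S : {set 'I_n}) : 'M[F]_n :=
  \matrix_(i, j) if i \in S then M i j else (i == j)%:R.

(** Multilinearity of the determinant in the rows of [1%:M + M]. *)
Lemma det1D_rows_from : \det (1%:M + M) = \sum_(S : {set 'I_n}) \det (rows_from S).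
Proof.
under [RHS]eq_bigr do rewrite /determinant.
rewrite exchange_big; apply: eq_bigr => s _; rewrite -mulr_sumr; congr (_ * _).
under eq_bigr do rewrite !mxE addrC.
rewrite bigA_distr; apply: eq_bigr => S _; apply: eq_bigr => i _.
by rewrite mxE; case: ifP => _; rewrite ?mulr1n.
Qed.

(** Let [P] be the matrix that selects the rows [phi a]. The left matrix is
[P *m M *m P^T] and the right one is [1%:M + P^T *m (P *m (M - 1%:M))], with
[P *m P^T = 1%:M]; so [det1_mulC] applies. *)
Lemma det_rows_from k (phi : {ffun 'I_k -> 'I_n}) : injective phi ->
  \det (\matrix_(a, b) M (phi a) (phi b)) = \det (rows_from [set phi a | a : 'I_k]).
Proof.
move=> phi_inj; pose P : 'M[F]_(k, n) := \matrix_(a, i) (phi a == i)%:R.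
have PM m (A : 'M[F]_(n, m)) : P *m A = \matrix_(a, j) A (phi a) j.
  apply/matrixP => a j; rewrite !mxE (bigD1 (phi a))//= mxE eqxx mul1r.
  by rewrite big1 ?addr0// => i; rewrite mxE eq_sym => /negPf->; rewrite mul0r.
have PP : P *m P^T = 1%:M.
  by rewrite PM; apply/matrixP => a b; rewrite !mxE (inj_eq phi_inj) eq_sym.
have -> : rows_from [set phi a | a : 'I_k] = 1%:M + P^T *m (P *m (M - 1%:M)).
  apply/matrixP => i j; rewrite PM !mxE; case: imsetP => [[a _ ->]|ni].
    rewrite (bigD1 a)//= !mxE eqxx mul1r big1 ?addr0; first by rewrite addrCA subrr addr0.
    by move=> b ba; rewrite !mxE (inj_eq phi_inj) (negPf ba) mul0r.
  rewrite big1 ?addr0// => a _; rewrite !mxE.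
  by case: eqP => [ai|_]; [case: ni; exists a|rewrite mul0r].
rewrite det1_mulC mulmxBr mulmx1 mulmxBl PP addrCA subrr addr0.
congr (\det _); rewrite PM; apply/matrixP => a b; rewrite !mxE (bigD1 (phi b))//= !mxE eqxx mulr1.
rewrite big1 ?addr0// => i; rewrite !mxE => /negPf ib.
by rewrite eq_sym ib mulr0.
Qed.

(** A choice that is not injective repeats a row, and a set of size [k] is the image
of [k`!] injective choices. *)
Lemma sum_det_ffun k :
  \sum_(phi : {ffun 'I_k -> 'I_n}) \det (\matrix_(a, b) M (phi a) (phi b)) =
  k`!%:R * \sum_(S : {set 'I_n} | #|S| == k) \det (rows_from S).
Proof.
rewrite (bigID (fun phi : {ffun 'I_k -> 'I_n} => injectiveb phi))/=.
rewrite [X in _ + X]big1 ?addr0; last first.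
  move=> phi /injectivePn[a [b ab phi_ab]]; apply: determinant_alternate ab _.
  by move=> j; rewrite !mxE phi_ab.
rewrite (partition_big (fun phi : {ffun 'I_k -> 'I_n} => [set phi a | a : 'I_k])
  (fun S : {set 'I_n} => #|S| == k))/=; last first.
  by move=> phi /injectiveP phi_inj; rewrite card_imset// card_ord.
rewrite mulr_sumr; apply: eq_bigr => S /eqP Sk.
rewrite (eq_bigr (fun=> \det (rows_from S))); last first.
  by move=> phi /andP[/injectiveP phi_inj /eqP <-]; exact: det_rows_from.
rewrite sumr_const mulr_natl; congr (_ *+ _).
have := card_inj_ffuns_on 'I_k (mem S); rewrite [X in X ^_ _]Sk card_ord ffactnn => <-.
rewrite cardsE; apply: eq_card => phi; rewrite unfold_in [RHS]unfold_in /= andbC.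
apply: andb_id2r => /injectiveP phi_inj.
rewrite eqEcard card_imset// card_ord Sk leqnn andbT.
apply/idP/ffun_onP => [/fintype.subsetP phiS a|phiS].
  by apply: phiS; apply: imset_f.
by apply/fintype.subsetP => _ /imsetP[a _ ->]; exact: phiS.
Qed.

Lemma sum_det_rows_from N : (n < N)%N ->
  \sum_(k < N) \sum_(S : {set 'I_n} | #|S| == k) \det (rows_from S) =
  \det (1%:M + M).
Proof.
move=> nN; rewrite det1D_rows_from (exchange_big_dep predT)//=; apply: eq_bigr => S _.
have SN : (#|S| < N)%N by rewrite (leq_ltn_trans _ nN)// -[n in X in (_ <= X)%N]card_ord max_card.
by rewrite (big_pred1 (Ordinal SN))// => k; rewrite -val_eqE /= eq_sym.
Qed.

End FiniteRankDeterminant.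

Section FredholmDeterminant.
Variables (R : realType) (c : contour R).
Implicit Types (k n : nat).

Lemma eq_iter_cint_nseq k (F G : seq R[i] -> R[i]) :
  (forall us, size us = k -> (forall u, u \in us -> contour_image c u) -> F us = G us) ->
  iter_cint (nseq k c) F = iter_cint (nseq k c) G.
Proof.
elim: k F G => [|k IH] F G FG /=; first exact: FG.
apply: eq_cint => z cz; apply: IH => us usk cus; apply: FG; first by rewrite /= usk.
by move=> u; rewrite inE => /predU1P[->|]; [exact: cz|exact: cus].
Qed.

(** A finite sum of products of functions of one variable each is integrated by
linearity, one variable at a time. *)
Lemma iter_cint_sum_prod (J : Type) (r : seq J) k (A : J -> R[i])
    (F : J -> 'I_k -> R[i] -> R[i]) :
  (forall j i, contour_integrable c (F j i)) ->
  iter_cint (nseq k c) (fun us => \sum_(j <- r) A j * \prod_(i < k) F j i us`_i) =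
  \sum_(j <- r) A j * \prod_(i < k) cint c (F j i).
Proof.
elim: k A F => [|k IH] A F Fi /=.
  by apply: eq_bigr => j _; rewrite !big_ord0.
transitivity (cint c (fun z => \sum_(j <- r)
    (A j * \prod_(i < k) cint c (F j (lift ord0 i))) * F j ord0 z)).
  apply: eq_cint => z _.
  transitivity (iter_cint (nseq k c) (fun us => \sum_(j <- r)
      (A j * F j ord0 z) * \prod_(i < k) F j (lift ord0 i) us`_i)).
    congr (iter_cint _ _); apply/funext => us; apply: eq_bigr => j _.
    by rewrite big_ord_recl mulrA.
  rewrite (IH (fun j => A j * F j ord0 z) (fun j i => F j (lift ord0 i))); last by move=> j i; exact: Fi.
  by apply: eq_bigr => j _; rewrite mulrAC.
rewrite cint_sum; last by move=> j; apply: contour_integrableZ; exact: Fi.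
apply: eq_bigr => j _; rewrite cintZ; last exact: Fi.
by rewrite big_ord_recl -mulrA [X in A j * X]mulrC.
Qed.

Variables (n : nat) (q G : 'I_n -> R[i] -> R[i]) (K : R[i] -> R[i] -> R[i]).
Hypothesis K_rank : forall u1 u2, contour_image c u1 -> contour_image c u2 ->
  K u1 u2 = \sum_(l < n) q l u2 * G l u1.
Hypothesis qG_int : forall l m, contour_integrable c (fun u => q l u * G m u).

Let M : 'M[R[i]]_n := \matrix_(l, m) cint c (fun u => q l u * G m u).

(** Andreief's identity: expand the determinant over permutations and the products
of kernels over the choices [phi], then collect the two factors that depend on
the same variable. *)
Lemma andreief k :
  iter_cint (nseq k c) (fun us => \det (\matrix_(a < k, b < k) K us`_a us`_b)) =
  \sum_(phi : {ffun 'I_k -> 'I_n}) \det (\matrix_(a, b) M (phi a) (phi b)).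
Proof.
pose r := [seq (phi, s) | phi <- index_enum {ffun 'I_k -> 'I_n}, s <- index_enum {perm 'I_k}].
pose F (ps : {ffun 'I_k -> 'I_n} * {perm 'I_k}) (b : 'I_k) u := q (ps.1 (ps.2 b)) u * G (ps.1 b) u.
transitivity (iter_cint (nseq k c) (fun us => \sum_(ps <- r)
   (-1) ^+ ps.2 * \prod_(b < k) F ps b us`_b)).
  apply: eq_iter_cint_nseq => us usk cus.
  have uc (a : 'I_k) : contour_image c us`_a by apply: cus; rewrite mem_nth// usk.
  rewrite /r big_allpairs exchange_big (reindex_inj invg_inj)/=.
  apply: eq_bigr => s _; rewrite odd_permV -mulr_sumr; congr (_ * _).
  under eq_bigr do rewrite mxE K_rank//.
  rewrite bigA_distr_bigA; apply: eq_bigr => phi _.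
  rewrite !big_split /=; congr (_ * _); rewrite [RHS](reindex_inj (@perm_inj _ s))/=.
  by apply: eq_bigr => b _; rewrite permK.
rewrite iter_cint_sum_prod; last by move=> ps b; exact: qG_int.
rewrite /r big_allpairs; apply: eq_bigr => phi _; rewrite -det_tr.
apply: eq_bigr => s _; congr (_ * _); apply: eq_bigr => b _.
by rewrite !mxE.
Qed.

(** The [k]-th term is the sum of the principal minors of size [k], so the partial
sums are constant after [n]. *)
Lemma fredholm_seriesE N : (n < N)%N -> fredholm_series c K N = \det (1%:M + M).
Proof.
move=> nN; rewrite -(sum_det_rows_from M nN) /fredholm_series seriesEord.
apply: eq_bigr => k _; rewrite andreief sum_det_ffun mulrA mulVf ?mul1r//.
Qed.

Lemma fredholm_det_finite_rank :
  cvgn (fredholm_series c K) /\ fredholm_det c K = \det (1%:M + M).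
Proof.
have N : \forall N \near \oo, fredholm_series c K N = \det (1%:M + M).
  by exists n.+1 => // N; exact: fredholm_seriesE.
split; first exact: is_cvg_near_cst N.
by rewrite /fredholm_det; apply: lim_near_cst N; exact: norm_hausdorff.
Qed.

End FredholmDeterminant.

(** * The kernel and the triangular system *)

Lemma enum_leq_insubd (n : nat) (i0 : 'I_n) (T : Type) (F : 'I_n -> T) (l : 'I_n) :
  [seq F i | i : 'I_n <- enum 'I_n & (i <= l)%N] =
  [seq F (insubd i0 i) | i <- iota 0 l.+1].
Proof.
have := filter_iota_leq 0 (ltn_ord l); rewrite add0n => <-.
rewrite -val_enum_ord filter_map -map_comp; apply: eq_map => i /=.
by rewrite valKd.
Qed.

Section NestedKernel.
Variables (R : realType) (n : nat) (n_gt0 : (0 < n)%N) (Omega : set R[i]).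
Hypotheses (Omega_open : open Omega) (Omega_sc : simply_connected Omega).
Variables (beta : 'I_n -> R[i]) (p : 'I_n -> R[i] -> R[i]) (Cs : 'I_n -> contour R).
Hypotheses (beta_in : forall i, Omega (beta i)) (p_an : forall i, analytic_on Omega (p i))
  (p_neq0 : forall i v, Omega v -> p i v != 0).
Hypotheses (Cs_in : forall i, closed_contour_in Omega (Cs i))
  (Cs_beta : forall i j, encloses (Cs i) (beta j))
  (Cs_nested : forall i j : 'I_n, (i < j)%N -> contour_image (Cs j) `<=` encloses (Cs i)).

(** Indices from [n] on are sent to [0], so that families over ['I_n] become
sequences whose segments are described by [iota]. *)
Let o (i : nat) : 'I_n := insubd (Ordinal n_gt0) i.
Let b_ i := beta (o i).
Let P_ i := pratio p (o i).

Let o_val i : (i < n)%N -> val (o i) = i.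
Proof. by move=> i_n; rewrite val_insubd i_n. Qed.

Let oK (i : 'I_n) : o i = i. Proof. exact: valKd. Qed.

Let b_in i : (i < n)%N -> Omega (b_ i).
Proof. by move=> _; exact: beta_in. Qed.

Let P_an i : (i < n)%N -> analytic_on Omega (P_ i).
Proof.
rewrite /P_ /pratio => _; case: (_ == _); first exact: p_an.
apply: analyticM; first exact: p_an.
by apply: analyticV; [exact: p_neq0|exact: p_an].
Qed.

Let P_neq0 i : (i < n)%N -> forall v, Omega v -> P_ i v != 0.
Proof.
rewrite /P_ /pratio => _ v vO; case: ifP => _; first exact: p_neq0.
by rewrite mulf_neq0 ?invr_eq0 ?p_neq0.
Qed.

Let contour_of_beta C : closed_contour_in Omega C -> (forall i, encloses C (beta i)) ->
  contour_of Omega C (nodes b_ 0 n).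
Proof.
move=> [sC pC CO] Cb; split; [exact: simple_closed_loop|exact: CO|].
by move=> _ /mem_nodes[i _ ->]; split; [have [] := Cb (o i)|exact: pC (Cb _)].
Qed.

Let C_loop i : (i < n)%N -> loop (Cs (o i)).
Proof. by move=> _; have [? _ _] := Cs_in (o i); exact: simple_closed_loop. Qed.

Let C_in i : (i < n)%N -> contour_image (Cs (o i)) `<=` Omega.
Proof. by move=> _; have [_ _] := Cs_in (o i). Qed.

Let C_surrounds i : (i < n)%N -> surrounds (Cs (o i)) (nodes b_ 0 n).
Proof. by move=> _; have [] := contour_of_beta (Cs_in (o i)) (Cs_beta (o i)). Qed.

Let C_nested i : (i.+1 < n)%N -> forall w, contour_image (Cs (o i)) w ->
  ~ contour_image (Cs (o i.+1)) w /\ winding (Cs (o i.+1)) w = 0.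
Proof.
move=> i_n w; apply: nested_winding; [exact: C_loop (ltnW i_n)|exact: C_loop i_n|].
by apply: Cs_nested; rewrite !o_val// ltnW.
Qed.

Definition kernel_factor (h : R[i] -> R[i]) (l : 'I_n) : R[i] :=
  iterated_residue b_ P_ 0 l.+1 h.

Lemma nested_kernelE q H u1 u2 : analytic_on Omega (H ^~ u1) ->
  nested_kernel beta p q H Cs u1 u2 = \sum_(l < n) q l u2 * kernel_factor (H ^~ u1) l.
Proof.
move=> hO; apply: eq_bigr => l _; congr (_ * _).
rewrite /kernel_factor -(iter_cint_outer Omega_open Omega_sc b_in P_an P_neq0
  C_loop C_in C_surrounds C_nested (ltn_ord l) hO) (enum_leq_insubd (Ordinal n_gt0)).
apply: eq_iter_cint => vs; rewrite size_map size_iota.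
case: vs => [//|v vs] [szvs]; rewrite chain_integrandE szvs.
rewrite -(big_ord_widen n (fun i => (v :: vs)`_i - (v :: vs)`_i.+1) (ltnW (ltn_ord l))).
have -> : \prod_(i < n | (i <= l)%N) (((v :: vs)`_i - beta i) * pratio p i (v :: vs)`_i) =
    \prod_(i < n | (i < l.+1)%N) (((v :: vs)`_i - b_ i) * P_ i (v :: vs)`_i).
  by apply: eq_bigr => i _; rewrite /b_ /P_ oK.
rewrite -(big_ord_widen n (fun i => ((v :: vs)`_i - b_ i) * P_ i (v :: vs)`_i) (ltn_ord l)).
rewrite [in LHS]big_ord_recl /=.
have -> : \prod_(i < l) ((vs`_i - b_ (bump 0 i)) * P_ (bump 0 i) vs`_i) =
    \prod_(i < l) ((vs`_i - b_ (1 + i)%N) * P_ (1 + i)%N vs`_i).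
  exact: eq_bigr.
move: (\prod_(i < l) _) (\prod_(i < l) _) (P_ _ _) => X Y Z.
by rewrite !invfM; ring.
Qed.

Section TriangularSystem.
Variables (C : contour R) (f : 'I_n -> R[i] -> R[i]).
Hypotheses (C_in_Omega : closed_contour_in Omega C) (C_beta : forall i, encloses C (beta i)).
Hypothesis f_an : forall i, analytic_on Omega (f i).

Definition residue_matrix : 'M[R[i]]_n := \matrix_(i, j)
  cint C (fun v => (\prod_(l < n | (l < i)%N) (v - beta l)) /
                   (\prod_(l < n | (l <= j)%N) (v - beta l)) * p i v * f j v).

Let node_prodE m v : (m <= n)%N ->
  \prod_(l < n | (l < m)%N) (v - beta l) = node_prod (nodes b_ 0 m) v.
Proof.
move=> mn; rewrite /node_prod big_map -[m in iota 0 m]subn0 big_mkord.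
by rewrite (big_ord_widen n (fun i => v - b_ i) mn); apply: eq_bigr => i _; rewrite /b_ oK.
Qed.

Let nodes_cat k m : nodes b_ 0 (k + m) = nodes b_ 0 k ++ nodes b_ k m.
Proof. by rewrite /nodes iotaD map_cat. Qed.

Let node_prod_neq0 k v : (k <= n)%N -> contour_image C v -> node_prod (nodes b_ 0 k) v != 0.
Proof.
move=> kn Cv; rewrite /node_prod prodf_seq_neq0; apply/allP => _ /mem_nodes[i _ ->].
rewrite implyTb; apply/eqP => /subr0_eq vb; have [nb _] := C_beta (o i).
by apply: nb; rewrite -/(b_ i) -vb.
Qed.

(** The node factors with index less than [i] cancel. *)
Lemma residue_matrix_upper (i j : 'I_n) : (i <= j)%N -> residue_matrix i j =
  residue C (nodes b_ i (j.+1 - i)) (fun v => p i v * f j v).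
Proof.
move=> ij; rewrite mxE; apply: eq_cint => v Cv.
rewrite (node_prodE _ (ltnW (ltn_ord i))) (node_prodE (m := j.+1) _ (ltn_ord j)).
rewrite -{1}(subnKC (leqW ij)) nodes_cat /node_prod big_cat /= -!/(node_prod _ _).
have := node_prod_neq0 (ltnW (ltn_ord i)) Cv.
move: (node_prod _ v) (node_prod _ v) => x y x0.
by rewrite invfM mulrA divff// mul1r -mulrA mulrC.
Qed.

(** All node factors of the denominator cancel, and the integrand is analytic. *)
Lemma residue_matrix_lower (i j : 'I_n) : (j < i)%N -> residue_matrix i j = 0.
Proof.
move=> ij; rewrite mxE.
have [m im] : exists m, (i = j.+1 + m :> nat)%N by exists (i - j.+1)%N; rewrite subnKC.
have cc := contour_of_nodes (k := 0) (m := 0) (contour_of_beta C_in_Omega C_beta) (leq0n n).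
have hO : analytic_on Omega (fun v => (node_poly (nodes b_ j.+1 m)).[v] * (p i v * f j v)).
  apply: (analyticM (f := fun v => (node_poly (nodes b_ j.+1 m)).[v])).
    exact: analytic_horner.
  by apply: analyticM; [exact: p_an|exact: f_an].
rewrite -(residue_nil Omega_open Omega_sc cc hO); apply: eq_cint => v Cv.
rewrite (node_prodE _ (ltnW (ltn_ord i))) (node_prodE (m := j.+1) _ (ltn_ord j)).
rewrite im nodes_cat /node_prod big_cat /= big_nil divr1 -!/(node_prod _ _) node_polyE.
have := node_prod_neq0 (ltn_ord j) Cv.
move: (node_prod _ v) (node_prod _ v) => x y x0.
by rewrite [y * x]mulrC mulfK// mulrA.
Qed.

(** The diagonal entries are the values at [beta i] of [p i * f i]. *)
Lemma det_residue_matrix : (forall i, p i (beta i) = 1) -> (forall i, f i (beta i) = 1) ->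
  \det residue_matrix = 1.
Proof.
move=> p1 f1; rewrite -det_tr det_trig.
  apply: big1 => j _; rewrite mxE residue_matrix_upper// subSnn.
  have cc := contour_of_nodes (k := j) (m := 1) (contour_of_beta C_in_Omega C_beta).
  rewrite (residue1 Omega_open Omega_sc (cc _) (b_in (ltn_ord j))) ?addn1//.
    by rewrite /b_ oK p1 f1 mulr1.
  by apply: analyticM; [exact: p_an|exact: f_an].
by apply/is_trig_mxP => j i ji; rewrite mxE residue_matrix_lower.
Qed.

Let prod_pratio i v : (i < n)%N -> Omega v -> \prod_(q < i.+1) P_ (0 + q)%N v = p (o i) v.
Proof.
move=> + vO; elim: i => [|i IH] i_n.
  by rewrite big_ord_recl big_ord0 mulr1 /P_ /pratio /= o_val.
rewrite big_ord_recr IH ?(ltnW i_n)//= /P_ /pratio add0n o_val//=.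
have -> : ord_pred (o i.+1) = o i.
  apply: val_inj; rewrite /= !o_val ?(ltnW i_n)//.
  by rewrite addSn /= modnDr modn_small// ltnW.
by rewrite mulrC divfK// p_neq0.
Qed.

(** This is [residue_expansion] at the first [j.+1] nodes. The product of the
[P_ q] up to [i] telescopes to [p i], which identifies the residues in the
expansion with the entries of [residue_matrix]. *)
Lemma kernel_factor_system (h : R[i] -> R[i]) (j : 'I_n) : analytic_on Omega h ->
  cint C (fun v => f j v / (\prod_(l < n | (l <= j)%N) (v - beta l)) * h v) =
  \sum_(i < n) kernel_factor h i * residue_matrix i j.
Proof.
move=> hO; have cc := contour_of_beta C_in_Omega C_beta.
have [_ CO _] := cc.
have cj := contour_of_nodes (k := 0) (m := j.+1) cc (ltn_ord j).
transitivity (residue C (nodes b_ 0 j.+1) (fun v => h v * f j v)).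
  apply: eq_cint => v Cv; rewrite (node_prodE (m := j.+1) _ (ltn_ord j)).
  by rewrite mulrAC [f j v * _]mulrC.
rewrite (@residue_expansion R Omega Omega_open Omega_sc n b_ P_ b_in P_an P_neq0
  j.+1 0 C h (f j) (ltn_ord j) cj hO (@f_an j)).
rewrite (big_ord_widen n (fun i => iterated_residue b_ P_ 0 i.+1 h *
  residue C (nodes b_ (0 + i) (j.+1 - i)) (fun v => \prod_(q < i.+1) P_ (0 + q)%N v * f j v)))//.
rewrite [RHS](bigID (fun i : 'I_n => (i < j.+1)%N))/= [X in _ + X]big1 ?addr0; last first.
  by move=> i; rewrite -leqNgt => ji; rewrite residue_matrix_lower// mulr0.
apply: eq_bigr => i ij; congr (_ * _); rewrite residue_matrix_upper// add0n.
by apply: eq_residue CO _ => v vO; rewrite prod_pratio// oK.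
Qed.

End TriangularSystem.
End NestedKernel.

(** * The determinant identity *)

Theorem theorem1p2 (R : realType) (n : nat) (n_gt0 : (0 < n)%N)
  (Omega : set R[i]) (Omega_open : open Omega)
  (Omega_sc : simply_connected Omega)
  (beta : 'I_n -> R[i]) (beta_in : forall i, Omega (beta i))
  (C : contour R) (C_in : closed_contour_in Omega C)
  (C_beta : forall i, encloses C (beta i))
  (Gamma : contour R) (Gamma_simple : simple_contour Gamma)
  (p f : 'I_n -> R[i] -> R[i])
  (p_an : forall i, analytic_on Omega (p i))
  (f_an : forall i, analytic_on Omega (f i))
  (p_beta : forall i, p i (beta i) = 1)
  (f_beta : forall i, f i (beta i) = 1)
  (p_neq0 : forall i v, Omega v -> p i v != 0)
  (q g : 'I_n -> R[i] -> R[i])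
  (q_cont : forall i, {within contour_image Gamma, continuous (q i)})
  (g_cont : forall i, {within contour_image Gamma, continuous (g i)})
  (q_L2 : forall i, square_integrable Gamma (q i))
  (g_L2 : forall i, square_integrable Gamma (g i))
  (H : R[i] -> R[i] -> R[i])
  (H_an : forall u, contour_image Gamma u -> analytic_on Omega (H ^~ u))
  (H_g : forall i u, contour_image Gamma u ->
    cint C (fun v => f i v / (\prod_(l < n | (l <= i)%N) (v - beta l)) * H v u)
    = g i u)
  (Cs : 'I_n -> contour R)
  (Cs_in : forall i, closed_contour_in Omega (Cs i))
  (Cs_beta : forall i j, encloses (Cs i) (beta j))
  (Cs_nested : forall i j : 'I_n, (i < j)%N ->
    contour_image (Cs j) `<=` encloses (Cs i)) :
  let K := nested_kernel beta p q H Cs in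
  cvgn (fredholm_series Gamma K) /\
  \det (\matrix_(i < n, j < n)
    (cint C (fun v => (\prod_(l < n | (l < i)%N) (v - beta l)) /
                      (\prod_(l < n | (l <= j)%N) (v - beta l)) *
                      p i v * f j v) +
     cint Gamma (fun u => q i u * g j u))) =
  fredholm_det Gamma K.
Proof.
move=> K.
pose G l u := kernel_factor n_gt0 beta p (H ^~ u) l.
pose A := residue_matrix beta p C f.
have gE j u : contour_image Gamma u -> g j u = \sum_(i < n) G i u * A i j.
  move=> Gu; rewrite -(@H_g j u Gu).
  exact (@kernel_factor_system R n n_gt0 Omega Omega_open Omega_sc beta p beta_in p_an
    p_neq0 C f C_in C_beta f_an (H ^~ u) j (@H_an u Gu)).
have A1 : \det A = 1.
  exact (@det_residue_matrix R n n_gt0 Omega Omega_open Omega_sc beta p beta_in p_an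
    C f C_in C_beta f_an p_beta f_beta).
(* As [A] is invertible, the [G m] are combinations of the [g j], and are
   integrable against the [q l]. *)
have GE m u : contour_image Gamma u -> G m u = \sum_(j < n) invmx A j m * g j u.
  move=> Gu; have Au : A \in unitmx by rewrite unitmxE A1 unitr1.
  transitivity (\sum_(i < n) G i u * (A *m invmx A) i m).
    rewrite mulmxV// (bigD1 m)//= mxE eqxx mulr1 big1 ?addr0// => i /negPf im.
    by rewrite mxE im mulr0.
  under [RHS]eq_bigr do rewrite gE// mulr_sumr.
  rewrite [RHS]exchange_big; apply: eq_bigr => i _; rewrite mxE mulr_sumr.
  by apply: eq_bigr => j _; rewrite [RHS]mulrC mulrA.
have qg l j : contour_integrable Gamma (fun u => q l u * g j u).
  exact: square_integrable_mul.
have qG l m : contour_integrable Gamma (fun u => q l u * G m u).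
  apply: (@eq_contour_integrable R Gamma
    (fun u => \sum_(j < n) invmx A j m * (q l u * g j u))).
    by move=> u Gu; rewrite (GE m u Gu) mulr_sumr; apply: eq_bigr => j _; rewrite mulrCA.
  by apply: contour_integrable_sum => j; apply: contour_integrableZ; exact: qg.
have KE u1 u2 : contour_image Gamma u1 -> contour_image Gamma u2 ->
    K u1 u2 = \sum_(l < n) q l u2 * G l u1.
  move=> Gu1 _.
  exact (@nested_kernelE R n n_gt0 Omega Omega_open Omega_sc beta p Cs beta_in p_an
    p_neq0 Cs_in Cs_beta Cs_nested q H u1 u2 (@H_an u1 Gu1)).
have [cvgK ->] := fredholm_det_finite_rank KE qG; split; first exact: cvgK.
(* The matrix of the theorem is [(1%:M + M) *m A]. *)
rewrite -[RHS]mulr1 -[X in _ = _ * X]A1 -det_mulmx; congr (\det _).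
apply/matrixP => i j; rewrite mulmxDl mul1mx !mxE; congr (_ + _).
clearbody A.
transitivity (cint Gamma (fun u => \sum_(m < n) A m j * (q i u * G m u))).
  apply: eq_cint => u Gu; rewrite gE// mulr_sumr; apply: eq_bigr => m _.
  by rewrite mulrA mulrC.
rewrite cint_sum; last by move=> m; apply: contour_integrableZ; exact: qG.
apply: eq_bigr => m _; rewrite (cintZ (A m j) (qG i m)) [in RHS]mxE.
exact: mulrC.
Qed.
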